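(* Let $\mathbb{R}^d=\mathbb{R}^{d_1}\times\mathbb{R}^{d_2}$ and $\alpha\in(0,1)$. Then $$\mathrm{VMO}^{\alpha,0}(\mathbb{R}^d)=\overline{C_c^\infty(\mathbb{R}^d)}^{\,\mathrm{BMO}^{\alpha,0}(\mathbb{R}^d)},$$ i.e. $\mathrm{VMO}^{\alpha,0}(\mathbb{R}^d)$ is the closure of $C_c^\infty(\mathbb{R}^d)$ with respect to the seminorm of $\mathrm{BMO}^{\alpha,0}(\mathbb{R}^d)$.
   Context: Rectangles are $R=I_1\times I_2$ with $I_i\subset\mathbb{R}^{d_i}$ cubes of side length $\ell(I_i)$. $\langle b\rangle_{I_1}$ is the function $x_2\mapsto\frac1{|I_1|}\int_{I_1}b(y_1,x_2)\,dy_1$, $\langle b\rangle_{I_2}$ the function $x_1\mapsto\frac1{|I_2|}\int_{I_2}b(x_1,y_2)\,dy_2$, and $\langle b\rangle_R$ the average over $R$. For $b\in L^1_{\mathrm{loc}}(\mathbb{R}^d)$, $$\mathcal{O}^{\alpha,0}(b,R):=\ell(I_1)^{-\alpha}\frac1{|R|}\int_R|b-\langle b\rangle_{I_1}-\langle b\rangle_{I_2}+\langle b\rangle_R|,\qquad \|b\|_{\mathrm{BMO}^{\alpha,0}}:=\sup_R\mathcal{O}^{\alpha,0}(b,R).$$ $b\in\mathrm{BMO}^{\alpha,0}$ belongs to $\mathrm{VMO}^{\alpha,0}$ if for all $\varepsilon>0$ there exists $t>0$ so that $\mathcal{O}^{\alpha,0}(b,R)<\varepsilon$ whenever $R=I_1\times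 I_2$ satisfies $\ell(I_i)<t$ or $\ell(I_i)>t^{-1}$ for $i=1$ or $i=2$, or $\mathrm{dist}(R,\{0\})>t^{-1}$. The closure consists of those $f$ for which $\inf_{\varphi\in C_c^\infty(\mathbb{R}^d)}\|f-\varphi\|_{\mathrm{BMO}^{\alpha,0}}=0$. *)

(* Defs.v *)
From HB Require Import structures.
From mathcomp Require Import all_boot all_order all_algebra.
From mathcomp Require Import all_classical all_reals all_analysis.
Import Order.TTheory GRing.Theory Num.Theory.
Import numFieldNormedType.Exports.

Set Implicit Arguments.
Unset Strict Implicit.
Unset Printing Implicit Defensive.

Local Open Scope classical_set_scope.
Local Open Scope ring_scope.

(* The sigma-algebra on R^n generated by the coordinates, as the library does
   for tuples; this is the Borel sigma-algebra. *)
Definition measure_rV_display : measure_display -> measure_display.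
Proof. exact. Qed.

Section measurable_rV.
Context {d} {T : measurableType d} {n : nat}.

Definition rV_coord (i : 'I_n) (x : 'rV[T]_n) : T := x ord0 i.

Let rV_set0 : g_sigma_preimage rV_coord set0.
Proof. exact: sigma_algebra0. Qed.

Let rV_setC A : g_sigma_preimage rV_coord A -> g_sigma_preimage rV_coord (~` A).
Proof. exact: sigma_algebraC. Qed.

Let rV_bigcup (F : (set 'rV[T]_n)^nat) :
  (forall i, g_sigma_preimage rV_coord (F i)) ->
  g_sigma_preimage rV_coord (\bigcup_i (F i)).
Proof. exact: sigma_algebra_bigcup. Qed.

HB.instance Definition _ := @isMeasurable.Build
  (measure_rV_display d)
  'rV[T]_n (g_sigma_preimage rV_coord) rV_set0 rV_setC rV_bigcup.

End measurable_rV.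

Section measurable_rV_theory.
Context d1 d2 (T1 : measurableType d1) (T2 : measurableType d2).

Lemma measurable_rV_coord n (i : 'I_n) :
  measurable_fun [set: 'rV[T2]_n] (rV_coord i).
Proof.
move=> _ Y mY; rewrite setTI; apply: sub_sigma_algebra => /=.
rewrite -bigcup_seq/=; exists i => /=; first by rewrite mem_index_enum.
by exists Y => //; rewrite setTI.
Qed.

Lemma measurable_fun_rVP n (f : T1 -> 'rV[T2]_n) :
  (forall i, measurable_fun [set: T1] (fun x => f x ord0 i)) ->
  measurable_fun [set: T1] f.
Proof.
move=> mf.
have H : g_sigma_preimage (fun i => rV_coord i \o f) `<=` measurable.
  apply: smallest_sub; first exact: sigma_algebra_measurable.
  case: n => [|n] in f mf *; first by rewrite big_ord0.
  rewrite -bigcup_mkord_ord; apply: bigcup_sub => i Ii.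
  by move=> A [B mB <-]; exact: mf.
rewrite g_sigma_preimage_comp in H.
by move=> _ A mA; apply: H; exists A.
Qed.

End measurable_rV_theory.

Section lebesgue_rV.
Context {R : realType}.

(* [measurableTypeR R] rather than [R]: it carries the display of the domain of
   [lebesgue_measure]. *)
Definition rV_cons n (p : measurableTypeR R * 'rV[R]_n) : 'rV[R]_n.+1 :=
  \row_i if unlift ord0 i is Some j then p.2 ord0 j else p.1.

Definition rV_uncons n (x : 'rV[R]_n.+1) : measurableTypeR R * 'rV[R]_n :=
  (x ord0 ord0, \row_j x ord0 (lift ord0 j)).

Lemma rV_consE0 n (p : measurableTypeR R * 'rV[R]_n) :
  rV_cons p ord0 ord0 = p.1.
Proof. by rewrite mxE unlift_none. Qed.

Lemma rV_consES n (p : measurableTypeR R * 'rV[R]_n) (i : 'I_n) :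
  rV_cons p ord0 (lift ord0 i) = p.2 ord0 i.
Proof. by rewrite mxE liftK. Qed.

Lemma rV_consK n : cancel (@rV_cons n) (@rV_uncons n).
Proof.
case=> a x; rewrite /rV_uncons rV_consE0; congr pair.
by apply/rowP => j; rewrite mxE rV_consES.
Qed.

Lemma measurable_rV_cons n : measurable_fun setT (@rV_cons n).
Proof.
apply: measurable_fun_rVP => i; have [j ->|->] := unliftP ord0 i.
  under eq_fun do rewrite rV_consES.
  exact: (measurableT_comp (measurable_rV_coord j) measurable_snd).
under eq_fun do rewrite rV_consE0.
exact: measurable_fst.
Qed.

Lemma measurable_rV_uncons n : measurable_fun setT (@rV_uncons n).
Proof.
apply/measurable_fun_pair => /=; first exact: measurable_rV_coord.
apply: measurable_fun_rVP => i.
under eq_fun do rewrite mxE.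
exact: measurable_rV_coord.
Qed.

Section lebesgue_rV_step.
Variables (n : nat) (mu : {sigma_finite_measure set 'rV[R]_n -> \bar R}).

Definition lebesgue_rV_step : set 'rV[R]_n.+1 -> \bar R :=
  pushforward (lebesgue_measure \x mu)%E (@rV_cons n).

Let pushforward_measure : {measure set 'rV[R]_n.+1 -> \bar R}.
Proof.
refine (pushforward (lebesgue_measure \x mu)%E (@rV_cons n) : measure _ _).
exact: measurable_rV_cons.
Defined.

HB.instance Definition _ := isMeasure.Build _ _ _ lebesgue_rV_step
  (measure0 pushforward_measure) (measure_ge0 pushforward_measure)
  (@measure_semi_sigma_additive _ _ _ pushforward_measure).

Let lebesgue_rV_step_sigma_finite : sigma_finite setT lebesgue_rV_step.
Proof.
have /sigma_finiteP[F [TF ndF Foo]] := sigma_finiteT (@lebesgue_measure R).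
have /sigma_finiteP[G [TG ndG Goo]] := sigma_finiteT mu.
exists (fun k => @rV_uncons n @^-1` (F k `*` G k)).
  apply/seteqP; split=> // x _; rewrite -preimage_bigcup /=.
  have [k _ Fk] : (\bigcup_i F i) (rV_uncons x).1 by rewrite -TF.
  have [l _ Gl] : (\bigcup_i G i) (rV_uncons x).2 by rewrite -TG.
  exists (maxn k l) => //; split.
    by move: Fk; exact/subsetPset/ndF/leq_maxl.
  by move: Gl; exact/subsetPset/ndG/leq_maxr.
move=> k; have [mF Fk] := Foo k; have [mG Gk] := Goo k; split.
  rewrite -[X in measurable X]setTI; apply: measurable_rV_uncons => //.
  exact: measurableX.
rewrite /lebesgue_rV_step /pushforward -comp_preimage.
rewrite (_ : _ @^-1` (F k `*` G k) = F k `*` G k); last first.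
  by rewrite (_ : _ \o _ = id)//; apply/funext => p; exact: rV_consK.
by rewrite product_measure1E// lte_mul_pinfty// ge0_fin_numE.
Qed.

HB.instance Definition _ := Measure_isSigmaFinite.Build _ _ _ lebesgue_rV_step
  lebesgue_rV_step_sigma_finite.

End lebesgue_rV_step.

Fixpoint lebesgue_rV n : {sigma_finite_measure set 'rV[R]_n -> \bar R} :=
  if n is m.+1 then lebesgue_rV_step (lebesgue_rV m) else \d_(0 : 'rV[R]_0).

(* This determines lebesgue_rV n as Lebesgue measure on R^n. *)
Lemma lebesgue_rV_box n (a b : 'rV[R]_n) :
  (forall i, a ord0 i <= b ord0 i) ->
  measurable [set x : 'rV[R]_n | forall i, a ord0 i <= x ord0 i <= b ord0 i] /\
  lebesgue_rV n [set x | forall i, a ord0 i <= x ord0 i <= b ord0 i] =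
  (\prod_i (b ord0 i - a ord0 i))%:E.
Proof.
elim: n a b => [|n IH] a b ab.
  rewrite (_ : mkset _ = setT); last by apply/seteqP; split=> // x _ [].
  split; first exact: measurableT.
  by rewrite big_ord0 /= diracE mem_set// => -[].
pose a' := \row_j a ord0 (lift ord0 j); pose b' := \row_j b ord0 (lift ord0 j).
have [|mB IHv] := IH a' b'; first by move=> i; rewrite !mxE.
set B := mkset _ in mB IHv.
set A := mkset _.
have AE : @rV_cons n @^-1` A = `[a ord0 ord0, b ord0 ord0] `*` B.
  apply/seteqP; split => -[u x] /=.
    move=> H; split; first by have := H ord0; rewrite in_itv/= rV_consE0.
    by move=> i; have := H (lift ord0 i); rewrite rV_consES !mxE.
  rewrite in_itv/= => -[u01 H] i.
  case: (unliftP ord0 i) => [j ->|->]; last by rewrite rV_consE0.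
  by rewrite rV_consES; have := H j; rewrite !mxE.
have mI :
    measurable (`[a ord0 ord0, b ord0 ord0] : set (measurableTypeR R)).
  exact: measurable_itv.
have AE2 : A = @rV_uncons n @^-1` (`[a ord0 ord0, b ord0 ord0] `*` B).
  rewrite -AE; apply/seteqP; split => x; rewrite /preimage/=;
  (suff -> : rV_cons (rV_uncons x) = x by []);
  apply/rowP => i; case: (unliftP ord0 i) => [j ->|->];
  by rewrite ?rV_consES ?rV_consE0 ?mxE.
split.
  rewrite AE2 -[X in measurable X]setTI; apply: measurable_rV_uncons => //.
  exact: measurableX.
rewrite /= /lebesgue_rV_step /pushforward AE product_measure1E// IHv.
rewrite big_ord_recl EFinM.
congr (_ * _)%E.
  rewrite [LHS](_ : _ = lebesgue_measure (`[a ord0 ord0, b ord0 ord0] : set R))//.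
  rewrite lebesgue_measure_itv/= lte_fin.
  by move: (ab ord0); rewrite le_eqVlt => /orP[/eqP ->|->//]; rewrite ltxx subrr.
by congr EFin; apply: eq_bigr => i _; rewrite !mxE.
Qed.

End lebesgue_rV.
Arguments lebesgue_rV {R} n.

Section cubes.
Context {R : realType}.

Record cube (n : nat) := Cube {
  corner : 'rV[R]_n ;
  side : R ;
  side_gt0 : 0 < side }.

Definition cube_set n (I : cube n) : set 'rV[R]_n :=
  [set x | forall i, corner I ord0 i <= x ord0 i <= corner I ord0 i + side I].

End cubes.
Arguments cube : clear implicits.

Definition average d (T : measurableType d) (R : realType)
    (mu : {measure set T -> \bar R}) (A : set T) (f : T -> R) : R :=
  (fine (mu A))^-1 * \int[mu]_(x in A) f x.

Section smooth.
Context {R : realType} {E : normedModType R}.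

(* Derivatives along all vectors instead of coordinate directions only: for
   finite-dimensional E this gives the usual C^k functions. *)
Fixpoint Ck (k : nat) (f : E -> R) : Prop :=
  if k is j.+1 then
    continuous f /\ forall v, (forall x, derivable f x v) /\ Ck j ('D_v f)
  else continuous f.

Definition Cc_smooth : set (E -> R) :=
  [set f | (forall k, Ck k f) /\ compact (closure [set x | f x != 0])].

End smooth.

Section bmo.
Context {R : realType} (d1 d2 : nat) (alpha : R).

Local Notation E := ('rV[R]_d1 * 'rV[R]_d2)%type.

Definition lebesgue_prod : {measure set E -> \bar R} :=
  (lebesgue_rV d1 \x lebesgue_rV d2)%E.

(* Elements of L^1_loc are represented by Borel functions, without quotient:
   oscillation only depends on the a.e. class. *)
Definition loc_integrable (b : E -> R) : Prop :=
  measurable_fun setT b /\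
  forall K, compact K -> lebesgue_prod.-integrable K (EFin \o b).

Definition rect (I1 : cube R d1) (I2 : cube R d2) : set E :=
  cube_set I1 `*` cube_set I2.

(* For locally integrable b the slices are integrable for almost all values of
   the frozen variable; for the others Rintegral returns a default value. *)
Definition average1 (I1 : cube R d1) (b : E -> R) (x2 : 'rV[R]_d2) : R :=
  average (lebesgue_rV d1) (cube_set I1) (fun y1 => b (y1, x2)).

Definition average2 (I2 : cube R d2) (b : E -> R) (x1 : 'rV[R]_d1) : R :=
  average (lebesgue_rV d2) (cube_set I2) (fun y2 => b (x1, y2)).

Definition oscillation (b : E -> R) (I1 : cube R d1) (I2 : cube R d2) : R :=
  side I1 `^ (- alpha) *
  average lebesgue_prod (rect I1 I2) (fun x =>
    `| b x - average1 I1 b x.2 - average2 I2 b x.1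
       + average lebesgue_prod (rect I1 I2) b |).

Definition bmo_norm (b : E -> R) : \bar R :=
  ereal_sup [set (oscillation b I.1 I.2)%:E | I in [set: cube R d1 * cube R d2]].

Definition BMO : set (E -> R) :=
  [set b | loc_integrable b /\ (bmo_norm b < +oo)%E].

(* The library norm on E is the sup norm. *)
Definition euclidean_norm (x : E) : R :=
  Num.sqrt (\sum_i x.1 ord0 i ^+ 2 + \sum_i x.2 ord0 i ^+ 2).

Definition dist_origin (A : set E) : R := inf [set euclidean_norm x | x in A].

Definition VMO : set (E -> R) :=
  [set b | BMO b /\
    forall eps, 0 < eps -> exists2 t, 0 < t &
      forall (I1 : cube R d1) (I2 : cube R d2),
        (side I1 < t \/ t^-1 < side I1) \/
        (side I2 < t \/ t^-1 < side I2) \/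
        t^-1 < dist_origin (rect I1 I2) ->
        oscillation b I1 I2 < eps].

Definition bmo_closure (S : set (E -> R)) : set (E -> R) :=
  [set f | BMO f /\ ereal_inf [set bmo_norm (f \- phi) | phi in S] = 0%E].

End bmo.
Arguments VMO {R} d1 d2 alpha.
Arguments bmo_closure {R} d1 d2 alpha S.

(* Main.v *)
Require Import Defs.
From HB Require Import structures.
From mathcomp Require Import all_boot all_order all_algebra.
From mathcomp Require Import ring lra.
From mathcomp Require Import all_classical all_reals all_analysis.
From mathcomp Require Import measurable_realfun measurable_fun_approximation.
Import Order.TTheory GRing.Theory Num.Theory.
Import numFieldNormedType.Exports.

Set Implicit Arguments.
Unset Strict Implicit.
Unset Printing Implicit Defensive.

Local Open Scope classical_set_scope.
Local Open Scope ring_scope.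

(* The inner integral of [|b - <b>_{I_1} - <b>_{I_2} + <b>_R|] is comparable
   to the double difference [|b(x_1,x_2) - b(y_1,x_2) - b(x_1,y_2) +
   b(y_1,y_2)|] averaged over [I_1 x I_1 x I_2 x I_2]. For fixed [I_2],
   averaging in the second variables gives a pseudometric in the first ones,
   and Campanato's theorem makes it alpha-Hoelder: b lies in BMO^{alpha,0}
   iff [x_1 |-> b(x_1, .)] is alpha-Hoelder with values in BMO modulo
   constants. For b in VMO^{alpha,0}, mollification produces a locally
   Lipschitz u with b - u small; its slices [u(x_1, .) - u(y_1, .)] have
   small Hoelder quotient as soon as x_1, y_1, their distance or the cube
   [I_2] is large. Then u is normalised (subtracting functions of one
   variable) and cut off: in x_1 by a Lipschitz cutoff at a large scale, in
   x_2 by the average of Lipschitz cutoffs over many dyadic scales: where a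
   single cutoff acts, the means of the function may be large, but a given
   cube meets essentially one of the scales, so that averaging over L of them
   divides this contribution by L. The resulting compactly supported
   Lipschitz function is approximated by smooth interpolation on a fine grid,
   one coordinate after the other: this keeps the Lipschitz constant bounded
   and is uniformly close, hence close in C^alpha. *)

(** Double differences annihilate functions of one variable and obey the triangle inequality in each
    pair of variables; so all bounds are carried through [ddosc], and the comparison with
    oscillations is paid for only at the two ends. Smallness holds for small and for far cubes, yet
    mollification must be controlled on all large ones: there the error f - f(. + z) sees only pairs
    at distance at most delta, hence is dominated by cubes of side comparable to delta. The cutoff
    in x_2 is the delicate step. A slice difference is only a BMO function, whose mean at radius 2^i
    may grow linearly in i. Normalised on the unit ball, it reaches the radius N with a mean bounded
    by some B depending on A and N, and from there gains O(e) per doubling. Over M scales the means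
    are at most B + O(M e), and averaging leaves O(e) once B <= M e. The resulting cutoff depends on
    A, e and N alone, so it serves all pairs x_1, y_1 at once. In the final smoothing the Lipschitz
    constant must not depend on the grid: it determines the distance below which a Lipschitz bound
    beats the C^alpha one, and only then is the grid chosen. *)

(** * Uniform probability measures on cubes *)

Section uniform_cube.
Context {R : realType} {n : nat}.
Implicit Types I J : cube R n.
Local Notation mu := (@lebesgue_rV R n).

Lemma cube_setE I : cube_set I = [set x : 'rV[R]_n | forall i,
  corner I ord0 i <= x ord0 i <= (corner I + const_mx (side I)) ord0 i].
Proof. by apply/seteqP; split=> x /= H i; have := H i; rewrite !mxE. Qed.

Lemma lebesgue_cube I :
  measurable (cube_set I) /\ mu (cube_set I) = (side I ^+ n)%:E.
Proof.
rewrite cube_setE.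
have [|mI ->] := @lebesgue_rV_box R n (corner I) (corner I + const_mx (side I)).
  by move=> i; rewrite !mxE lerDl ltW// side_gt0.
split=> //; under eq_bigr do rewrite !mxE addrAC subrr add0r.
by rewrite prodr_const card_ord.
Qed.

Lemma measurable_cube I : measurable (cube_set I).
Proof. by have [] := lebesgue_cube I. Qed.

Lemma side_exp_gt0 I k : 0 < side I ^+ k.
Proof. by rewrite exprn_gt0// side_gt0. Qed.

Lemma side_expV_ge0 I : 0 <= (side I ^+ n)^-1.
Proof. by rewrite invr_ge0 ltW// side_exp_gt0. Qed.

(** A probability measure on the whole space rather than integration restricted to [cube_set I]:
    Tonelli and the estimate of a mean by a mean of absolute values then apply on full product
    spaces. *)
Definition unif I : set 'rV[R]_n -> \bar R :=
  mscale (NngNum (side_expV_ge0 I)) (mrestr mu (measurable_cube I)).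

HB.instance Definition _ I := Measure.on (unif I).

Let unif_setT I : unif I [set: _] = 1%E.
Proof.
rewrite /unif /mscale/= /mrestr setTI.
have [_ ->] := lebesgue_cube I.
by rewrite -EFinM mulVf// gt_eqF// side_exp_gt0.
Qed.

HB.instance Definition _ I :=
  Measure_isProbability.Build _ _ R (unif I) (unif_setT I).

Lemma unif_negligible I : unif I (~` cube_set I) = 0%E.
Proof. by rewrite /unif /mscale/= /mrestr setICl measure0 mule0. Qed.

Lemma integral_unif I (f : 'rV[R]_n -> \bar R) :
  measurable_fun setT f -> (forall x, (0 <= f x)%E) ->
  (\int[unif I]_x f x = ((side I ^+ n)^-1)%:E * \int[mu]_(x in cube_set I) f x)%E.
Proof.
move=> mf f0.
rewrite (ge0_negligible_integral _ _ _ _ (unif_negligible I))//; last first.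
  by apply: measurableC; exact: measurable_cube.
rewrite setTD setCK ge0_integral_mscale//; last 2 first.
  exact: measurable_cube.
  exact: measurable_funTS.
congr (_ * _)%E; apply: eq_measure_integral => A mA AI.
by rewrite /= /mrestr setIidl.
Qed.

Lemma le_integral_unif I (f g : 'rV[R]_n -> \bar R) :
  measurable_fun setT f -> measurable_fun setT g -> (forall x, (0 <= f x)%E) ->
  (forall x, (0 <= g x)%E) ->
  (forall x, cube_set I x -> (f x <= g x)%E) ->
  (\int[unif I]_x f x <= \int[unif I]_x g x)%E.
Proof.
move=> mf mg f0 g0 fg; rewrite !integral_unif// lee_pmul2l//; last first.
  by rewrite lte_fin invr_gt0 side_exp_gt0.
apply: ge0_le_integral => //; first exact: measurable_cube.
- exact: measurable_funTS.
- exact: measurable_funTS.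
Qed.

Lemma integral_unif_cst I (c : \bar R) : (\int[unif I]_x c = c)%E.
Proof.
rewrite (@integral_cst _ _ _ (unif I) setT)//.
by rewrite [X in (_ * X)%E](unif_setT I) mule1.
Qed.

Lemma integral_unif_sub I J (f : 'rV[R]_n -> \bar R) :
  measurable_fun setT f -> (forall x, (0 <= f x)%E) ->
  cube_set J `<=` cube_set I ->
  (\int[unif J]_x f x <= ((side I / side J) ^+ n)%:E * \int[unif I]_x f x)%E.
Proof.
move=> mf f0 JI; rewrite !integral_unif//.
rewrite muleA -EFinM expr_div_n mulrAC divff ?gt_eqF ?side_exp_gt0// mul1r.
apply: lee_wpmul2l; first by rewrite lee_fin side_expV_ge0.
apply: ge0_subset_integral => //; try exact: measurable_cube.
exact: measurable_funTS.
Qed.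

Definition shift_cube (z : 'rV[R]_n) I := Cube (corner I + z) (side_gt0 I).

Lemma shift_cubeE z I x : cube_set (shift_cube z I) (x + z) = cube_set I x.
Proof.
apply/propext; split=> H i; have := H i; rewrite /= !mxE.
  by rewrite addrAC !lerD2r.
by rewrite [_ + z _ _ + _]addrAC !lerD2r.
Qed.

End uniform_cube.

(** * Translation invariance of Lebesgue measure *)

Section translation_invariance.
Context {R : realType}.
Local Open Scope ereal_scope.

Lemma measurable_addr1 (a : R) :
  measurable_fun setT (fun x : measurableTypeR R => (x + a)%R : measurableTypeR R).
Proof. exact: measurable_funD. Qed.

Lemma measurable_addrV n (a : 'rV[R]_n) :
  measurable_fun setT (fun x : 'rV[R]_n => (x + a)%R).
Proof.
apply: measurable_fun_rVP => i; under eq_fun do rewrite mxE.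
by apply: measurable_funD => //; exact: measurable_rV_coord.
Qed.

Lemma lebesgue_measure_shift (a : R) (f : measurableTypeR R -> \bar R) :
  measurable_fun setT f -> (forall x, 0 <= f x) ->
  \int[lebesgue_measure]_x f (x + a)%R = \int[lebesgue_measure]_x f x.
Proof.
move=> mf f0.
rewrite -[LHS](@ge0_integral_pushforward _ _ _ _ _ _ (measurable_addr1 a)
  lebesgue_measure setT f)//.
apply: eq_measure_integral => [|mphi A mA _].
  exact: measurable_addr1.
(* The translated measure agrees with Lebesgue measure on half-open intervals, which determine
   it. *)
apply/esym; apply: lebesgue_measure_unique mA => _ [[u v]] _ <- /=.
rewrite /pushforward.
have -> : (fun x : measurableTypeR R => (x + a)%R : measurableTypeR R) @^-1`
    [set` `]u, v]] = [set` `]u - a, v - a]%R].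
  by apply/seteqP; split=> x /=; rewrite !in_itv/= ltrBlDr lerBrDr.
rewrite !lebesgue_measure_itv/= !lte_fin ltrD2r.
by case: ifP => // _; rewrite -!EFinB opprB addrA subrK.
Qed.

Lemma integral_rV_cons n (f : 'rV[R]_n.+1 -> \bar R) :
  measurable_fun setT f -> (forall x, 0 <= f x) ->
  \int[lebesgue_rV n.+1]_x f x =
  \int[lebesgue_measure]_u \int[lebesgue_rV n]_v f (rV_cons (u, v)).
Proof.
move=> mf f0.
rewrite [LHS](@ge0_integral_pushforward _ _ _ _ _ _ (@measurable_rV_cons R n)
  (lebesgue_measure \x lebesgue_rV n) setT f)//.
rewrite -(fubini_tonelli1 (f \o @rV_cons R n))//=.
by apply: measurableT_comp => //; exact: measurable_rV_cons.
Qed.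

Lemma lebesgue_rV_shift n (a : 'rV[R]_n) (f : 'rV[R]_n -> \bar R) :
  measurable_fun setT f -> (forall x, 0 <= f x) ->
  \int[lebesgue_rV n]_x f (x + a)%R = \int[lebesgue_rV n]_x f x.
Proof.
elim: n a f => [|n IH] a f mf f0.
  by apply: eq_integral => x _; congr f; apply/rowP => -[].
have mfa : measurable_fun setT (fun x : 'rV[R]_n.+1 => f (x + a)%R).
  by apply: measurableT_comp mf _; exact: measurable_addrV.
rewrite !integral_rV_cons//.
pose a' : 'rV[R]_n := \row_j a ord0 (lift ord0 j).
have consD (u : R) (v : 'rV[R]_n) :
    (rV_cons (u, v) + a = rV_cons ((u + a ord0 ord0)%R, v + a'))%R.
  apply/rowP => i; rewrite mxE; case: (unliftP ord0 i) => [j ->|->].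
    by rewrite !rV_consES !mxE.
  by rewrite !rV_consE0.
have mc : measurable_fun setT (f \o @rV_cons R n).
  by apply: measurableT_comp => //; exact: measurable_rV_cons.
transitivity (\int[lebesgue_measure]_u
    \int[lebesgue_rV n]_v f (rV_cons ((u + a ord0 ord0)%R, v))).
  apply: eq_integral => u _.
  rewrite -(IH a' (fun v => f (rV_cons ((u + a ord0 ord0)%R, v))))//.
    by apply: eq_integral => v _; rewrite consD.
  apply: (measurableT_comp mc).
  exact: measurable_pair1.
rewrite (lebesgue_measure_shift (a ord0 ord0)
  (f := fun u => \int[lebesgue_rV n]_v f (rV_cons (u, v))))//.
  by apply: (measurable_fun_fubini_tonelli_F (f \o @rV_cons R n)) => // p; exact: f0.
by move=> u; apply: integral_ge0 => v _; exact: f0.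
Qed.

Lemma integral_unif_shift n (I : cube R n) (z : 'rV[R]_n)
    (f : 'rV[R]_n -> \bar R) :
  measurable_fun setT f -> (forall x, 0 <= f x) ->
  \int[unif (shift_cube z I)]_x f x = \int[unif I]_x f (x + z)%R.
Proof.
move=> mf f0.
have mI (J : cube R n) : measurable (cube_set J) by exact: measurable_cube.
have mfz : measurable_fun setT (fun x : 'rV[R]_n => f (x + z)%R).
  by apply: measurableT_comp mf _; exact: measurable_addrV.
rewrite !integral_unif//=; congr (_ * _).
rewrite [LHS]integral_mkcond [RHS]integral_mkcond -(@lebesgue_rV_shift n z)//; last 2 first.
- by apply/(measurable_restrictT _ (mI _)) => //; exact: measurable_funTS.
- by move=> x; apply: erestrict_ge0.
apply: eq_integral => x _; rewrite !patchE.
suff -> : (x + z \in cube_set (shift_cube z I))%R = (x \in cube_set I) by [].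
by apply/idP/idP; rewrite !inE shift_cubeE.
Qed.

End translation_invariance.

(** * Sup norm, compact cubes and Borel sets *)

Section sup_norm.
Context {R : realType}.

Lemma rV_norm_le n (x : 'rV[R]_n) r : 0 <= r ->
  (`|x| <= r) <-> (forall i, `|x ord0 i| <= r).
Proof.
move=> r0; rewrite [`|x|]mx_normrE; split=> [/bigmax_leP[_ H] i|H].
  exact: (H (ord0, i)).
by apply/bigmax_leP; split=> // -[i j] _; rewrite ord1 H.
Qed.

Lemma rV_norm_lt n (x : 'rV[R]_n) r : 0 < r ->
  (`|x| < r) <-> (forall i, `|x ord0 i| < r).
Proof.
move=> r0; rewrite [`|x|]mx_normrE; split=> [/bigmax_ltP[_ H] i|H].
  exact: (H (ord0, i)).
by apply/bigmax_ltP; split=> // -[i j] _; rewrite ord1 H.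
Qed.

Lemma coord_le_norm n (x : 'rV[R]_n) i : `|x ord0 i| <= `|x|.
Proof. by have /(_ (lexx _)) := (rV_norm_le x (normr_ge0 x)).1. Qed.

Lemma prod_normE n m (p : 'rV[R]_n * 'rV[R]_m) : `|p| = Num.max `|p.1| `|p.2|.
Proof. by []. Qed.

Lemma compact_cube n (I : cube R n) : compact (cube_set I).
Proof.
have -> : cube_set I = [set v : 'rV[R]_n | forall i,
    [set` `[corner I ord0 i, corner I ord0 i + side I]] (v ord0 i)].
  by apply/seteqP; split=> x /= H i; have := H i; rewrite in_itv.
apply: (@rV_compact _ _ (fun i =>
  `[corner I ord0 i, corner I ord0 i + side I]%classic)) => i.
exact: segment_compact.
Qed.

Lemma compact_rect n m (I : cube R n) (J : cube R m) : compact (rect I J).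
Proof. by apply: compact_setX; exact: compact_cube. Qed.

End sup_norm.

Section borel.
Context {R : realType} {n m : nat}.
Local Notation E := ('rV[R]_n * 'rV[R]_m)%type.

Lemma rat_approx_rV k (x : 'rV[R]_k) (r : R) : 0 < r ->
  exists q : 'rV[rat]_k, `|x - map_mx ratr q| < r.
Proof.
move=> r0.
have H i : exists q : rat, `|x ord0 i - ratr q| < r.
  have [q] := @rat_in_itvoo R (x ord0 i - r) (x ord0 i + r) ltac:(lra).
  by rewrite in_itv/= => /andP[? ?]; exists q; rewrite ltr_norml; lra.
have [q Hq] := choice H.
exists (\row_i q i); apply/(rV_norm_lt _ r0) => i.
by rewrite !mxE.
Qed.

Lemma measurable_rV_ball k (c : 'rV[R]_k) (r : R) : 0 < r ->
  measurable [set x : 'rV[R]_k | `|x - c| < r].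
Proof.
move=> r0.
have -> : [set x : 'rV[R]_k | `|x - c| < r] =
    \bigcap_i (rV_coord i @^-1` `]c ord0 i - r, c ord0 i + r[%classic).
  apply/seteqP; split=> x /=.
    move=> /(rV_norm_lt _ r0) H i _; have := H i.
    by rewrite /= in_itv/= !mxE ltr_norml /rV_coord => /andP[? ?]; apply/andP; split; lra.
  move=> H; apply/(rV_norm_lt _ r0) => i; have := H i Logic.I.
  by rewrite /= in_itv/= !mxE ltr_norml /rV_coord => /andP[? ?]; apply/andP; split; lra.
apply: fin_bigcap_measurable => // i _.
by rewrite -[X in measurable X]setTI; apply: measurable_rV_coord.
Qed.

(** In the sup norm a ball is a product of strips in the coordinates, hence measurable for the
    product sigma-algebra, and an open set is the union of the countably many rational balls that it
    contains. *)
Lemma open_measurable_prod (U : set E) : open U -> measurable U.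
Proof.
move=> oU.
pose ballq (q : 'rV[rat]_n * 'rV[rat]_m * rat) : set E :=
  [set x | `|x - (map_mx ratr q.1.1, map_mx ratr q.1.2)| < ratr q.2].
pose F q := if pselect (0 < q.2 /\ ballq q `<=` U) is left _ then ballq q else set0.
have -> : U = \bigcup_q F q.
  apply/seteqP; split=> [x Ux|x [q _]]; last first.
    by rewrite /F; case: pselect => // -[_]; exact.
  have /nbhs_ballP[e /= e0 eU] : nbhs x U by exact: open_nbhs_nbhs.
  have [r] := @rat_in_itvoo R 0 (e / 2) ltac:(lra).
  rewrite in_itv/= => /andP[r0 re].
  have [q1 h1] := rat_approx_rV x.1 r0; have [q2 h2] := rat_approx_rV x.2 r0.
  have xq : `|x - (map_mx ratr q1, map_mx ratr q2)| < ratr r.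
    by rewrite prod_normE gt_max h1 h2.
  exists (q1, q2, r) => //; rewrite /F; case: pselect => // -[]; split.
    by move: r0; rewrite ltr0q.
  move=> y; rewrite /ballq/= => yq; apply: eU.
  rewrite -ball_normE/=.
  rewrite (le_lt_trans (ler_distD (map_mx ratr q1, map_mx ratr q2) _ _))//.
  rewrite (distrC _ y); lra.
apply: countable_bigcupT_measurable => [|q].
  exact: (@countableP ('rV[rat]_n * 'rV[rat]_m * rat)%type).
rewrite /F; case: pselect => // -[r0 _].
have -> : ballq q = [set x : 'rV[R]_n | `|x - map_mx ratr q.1.1| < ratr q.2] `*`
    [set x : 'rV[R]_m | `|x - map_mx ratr q.1.2| < ratr q.2].
  by apply/seteqP; split=> -[x y]; rewrite /ballq/= prod_normE gt_max/= => /andP.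
by apply: measurableX; apply: measurable_rV_ball; rewrite ltr0q.
Qed.

Lemma compact_measurable_prod (K : set E) : compact K -> measurable K.
Proof.
move=> cK; have clK : closed K by apply: compact_closed.
by rewrite -[K]setCK; apply: measurableC; apply: open_measurable_prod; exact: closed_openC.
Qed.

Lemma continuous_measurable_prod (f : E -> R) :
  continuous f -> measurable_fun setT f.
Proof.
move=> /continuousP cf; apply: (measurability _ (RGenOpens.measurableE R)).
move=> _ [_ [a [b ->] <-]]; rewrite setTI; apply: open_measurable_prod.
by apply: cf; exact: interval_open.
Qed.

End borel.

Section borel_rV.
Context {R : realType} {n : nat}.

Lemma continuous_measurable_rV (f : 'rV[R]_n -> R) :
  continuous f -> measurable_fun setT f.
Proof.
move=> cf.
(* A function on R^n is viewed on R^n x R^0, which reduces it to the case of a product. *)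
have : measurable_fun setT (f \o fst : 'rV[R]_n * 'rV[R]_0 -> R).
  apply: continuous_measurable_prod => x.
  by apply: continuous_comp; [exact: cvg_fst | exact: cf].
move=> /measurableT_comp/(_ (@measurable_pair2 _ _ 'rV[R]_n 'rV[R]_0 0)).
by [].
Qed.

Lemma continuous_cube_bounded (f : 'rV[R]_n -> R) (I : cube R n) :
  continuous f -> exists M, forall x, cube_set I x -> `|f x| <= M.
Proof.
move=> cf.
have /compact_bounded[M [_ H]] : compact (f @` cube_set I).
  apply: continuous_compact; last exact: compact_cube.
  exact: continuous_subspaceT.
by exists (M + 1) => x Ix; apply: H; [rewrite ltrDl|exists x].
Qed.

Lemma integrable_unif_bounded (f : 'rV[R]_n -> R) (I : cube R n) M :
  measurable_fun setT f -> (forall x, cube_set I x -> `|f x| <= M) ->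
  (unif I).-integrable setT (EFin \o f).
Proof.
move=> mf fM; apply/integrableP; split; first exact/measurable_EFinP.
apply: (@le_lt_trans _ _ (`|M|%:E)); last exact: ltry.
rewrite -[leRHS](integral_unif_cst I); apply: le_integral_unif => //.
  by apply: measurableT_comp => //; exact/measurable_EFinP.
by move=> x Ix /=; rewrite lee_fin (le_trans (fM _ Ix))// ler_norm.
Qed.

Lemma integrable_unif_continuous (f : 'rV[R]_n -> R) (I : cube R n) :
  continuous f -> (unif I).-integrable setT (EFin \o f).
Proof.
move=> cf; have [M fM] := continuous_cube_bounded I cf.
exact: integrable_unif_bounded (continuous_measurable_rV cf) fM.
Qed.

End borel_rV.

(** * Subdivision of a cube into half cubes *)

Section dyadic_subdivision.
Context {R : realType} {n : nat}.
Local Open Scope ereal_scope.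

Lemma half_side_gt0 (I : cube R n) : (0 < side I / 2)%R.
Proof. by rewrite divr_gt0// side_gt0. Qed.

Definition half_cube (I : cube R n) (b : {ffun 'I_n -> bool}) : cube R n :=
  Cube (corner I + \row_i ((b i)%:R * (side I / 2)))%R (half_side_gt0 I).

Lemma half_cube_cover (I : cube R n) x :
  cube_set I x -> exists b, cube_set (half_cube I b) x.
Proof.
move=> Ix; exists [ffun i => (corner I ord0 i + side I / 2 <= x ord0 i)%R] => i.
have /andP[h1 h2] := Ix i; rewrite !mxE ffunE.
by case: (leP (corner I ord0 i + side I / 2)%R) => /= h3; apply/andP; split; lra.
Qed.

(** A covering is enough: the 2^n half cubes overlap on faces, but for nonnegative f the integral
    over I is still at most the sum over them, and their volumes add up to that of I. *)
Lemma integral_unif_half (I : cube R n) (f : 'rV[R]_n -> \bar R) (M : \bar R) :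
  measurable_fun setT f -> (forall x, 0 <= f x) ->
  (forall b, \int[unif (half_cube I b)]_x f x <= M) ->
  \int[unif I]_x f x <= M.
Proof.
move=> mf f0 fM.
pose mu := @lebesgue_rV R n.
have M0 : 0 <= M by apply: le_trans (fM [ffun => false]); exact: integral_ge0.
have l0 := side_exp_gt0 I n; have h0 := half_side_gt0 I.
have mI (J : cube R n) : measurable (cube_set J) by exact: measurable_cube.
have fJ b : \int[mu]_(x in cube_set (half_cube I b)) f x <=
    ((side I / 2) ^+ n)%:E * M.
  have := fM b; rewrite integral_unif//=.
  move=> /(@lee_wpmul2l _ ((side I / 2) ^+ n)%:E).
  rewrite lee_fin exprn_ge0 ?(ltW h0)// => /(_ isT).
  by rewrite muleA -EFinM divff ?mul1e// gt_eqF// exprn_gt0.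
have H : \int[mu]_(x in cube_set I) f x <=
    \sum_(b : {ffun 'I_n -> bool}) \int[mu]_(x in cube_set (half_cube I b)) f x.
  under eq_bigr do rewrite integral_mkcond.
  have mfJ (J : cube R n) : measurable_fun setT (f \_ (cube_set J)).
    by apply/(measurable_restrictT _ (mI _)) => //; exact: measurable_funTS.
  have f0J (J : cube R n) x : 0 <= (f \_ (cube_set J)) x by apply: erestrict_ge0.
  rewrite -ge0_integral_sum// [leLHS]integral_mkcond; apply: ge0_le_integral => //.
    by apply: emeasurable_sum => b _; exact: mfJ.
  move=> x _; rewrite patchE; case: ifPn => [|_]; last exact: sume_ge0.
  rewrite inE => /half_cube_cover[b xb].
  rewrite (bigD1 b)//= patchE mem_set// leeDl//.
  by apply: sume_ge0 => b' _.
rewrite integral_unif// lee_pdivrMl//.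
apply: (le_trans H); apply: (le_trans (lee_sum _ (fun b _ => fJ b))).
rewrite sumr_const -[X in X <= _]mule_natl.
have -> : #|{: {ffun 'I_n -> bool}}| = (2 ^ n)%N.
  by rewrite card_ffun card_bool card_ord.
rewrite muleA -EFinM natrX -exprMn mulrCA divff ?mulr1//.
Qed.

End dyadic_subdivision.

(** * Products of probability measures and double differences *)

Section probability_product.
Context d1 d2 (T1 : measurableType d1) (T2 : measurableType d2) {R : realType}.
Variables (P : probability T1 R) (Q : probability T2 R).
Local Open Scope ereal_scope.

(* The library's product of two probabilities is not inferred to be
   sigma-finite, which iterated products need. *)
Definition pprod : probability (T1 * T2)%type R := P \x Q.

Variable f : T1 * T2 -> \bar R.
Hypotheses (mf : measurable_fun setT f) (f0 : forall x, 0 <= f x).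

Lemma pprod_tonelli1 : \int[pprod]_z f z = \int[P]_x \int[Q]_y f (x, y).
Proof. exact: (@fubini_tonelli1 _ _ _ _ R P Q f). Qed.

Lemma pprod_tonelli2 : \int[pprod]_z f z = \int[Q]_y \int[P]_x f (x, y).
Proof. exact: (@fubini_tonelli2 _ _ _ _ R P Q f). Qed.

Lemma pprod_tonelli :
  \int[P]_x \int[Q]_y f (x, y) = \int[Q]_y \int[P]_x f (x, y).
Proof. exact: (@fubini_tonelli _ _ _ _ R P Q f). Qed.

Lemma measurable_pprod1 : measurable_fun setT (fun x => \int[Q]_y f (x, y)).
Proof. exact: (@measurable_fun_fubini_tonelli_F _ _ _ _ R Q f). Qed.

Lemma measurable_pprod2 : measurable_fun setT (fun y => \int[P]_x f (x, y)).
Proof. exact: (@measurable_fun_fubini_tonelli_G _ _ _ _ R P f). Qed.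

End probability_product.

Section double_difference.
Context d1 d2 (T1 : measurableType d1) (T2 : measurableType d2) {R : realType}.
Implicit Types f g : T1 * T2 -> R.
Local Open Scope ereal_scope.

(** It vanishes on functions of a single variable, which is what makes both the partial averages in
    the oscillation and the later normalisation invisible. *)
Definition ddiff f (p : T1 * T1) (q : T2 * T2) : R :=
  (f (p.1, q.1) - f (p.2, q.1) - f (p.1, q.2) + f (p.2, q.2))%R.

Definition ddosc (P : probability T1 R) (Q : probability T2 R) f : \bar R :=
  \int[pprod P P]_p \int[pprod Q Q]_q `|ddiff f p q|%:E.

Lemma measurable_ddiff f : measurable_fun setT f ->
  measurable_fun setT (fun pq : (T1 * T1) * (T2 * T2) => ddiff f pq.1 pq.2).
Proof.
move=> mf; rewrite /ddiff.
have m11 : measurable_fun setT (fun pq : (T1 * T1) * (T2 * T2) => pq.1.1).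
  exact: (measurableT_comp measurable_fst measurable_fst).
have m12 : measurable_fun setT (fun pq : (T1 * T1) * (T2 * T2) => pq.1.2).
  exact: (measurableT_comp measurable_snd measurable_fst).
have m21 : measurable_fun setT (fun pq : (T1 * T1) * (T2 * T2) => pq.2.1).
  exact: (measurableT_comp measurable_fst measurable_snd).
have m22 : measurable_fun setT (fun pq : (T1 * T1) * (T2 * T2) => pq.2.2).
  exact: (measurableT_comp measurable_snd measurable_snd).
by apply: measurable_funD; [apply: measurable_funB; [apply: measurable_funB|]|];
  apply: (measurableT_comp mf); apply/measurable_fun_pair.
Qed.

Lemma measurable_abs_ddiff f : measurable_fun setT f ->
  measurable_fun setT
    (fun pq : (T1 * T1) * (T2 * T2) => `|ddiff f pq.1 pq.2|%:E).
Proof.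
move=> mf; apply/measurable_EFinP; apply: measurableT_comp => //.
exact: measurable_ddiff.
Qed.

End double_difference.

Section ddosc_probability.
Context d1 d2 (T1 : measurableType d1) (T2 : measurableType d2) {R : realType}.
Variables (P : probability T1 R) (Q : probability T2 R).
Implicit Types f g : T1 * T2 -> R.
Local Open Scope ereal_scope.

Let absdd f : (T1 * T1) * (T2 * T2) -> \bar R := fun pq => `|ddiff f pq.1 pq.2|%:E.

Let absdd0 f x : 0 <= absdd f x. Proof. by rewrite lee_fin. Qed.

Lemma measurable_ddosc_in f : measurable_fun setT f ->
  measurable_fun setT (fun p : T1 * T1 => \int[pprod Q Q]_q `|ddiff f p q|%:E).
Proof.
move=> mf.
exact: (@measurable_pprod1 _ _ _ _ R (pprod Q Q) (absdd f) (measurable_abs_ddiff mf)).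
Qed.

Lemma measurable_ddiff_p f p : measurable_fun setT f ->
  measurable_fun setT (fun q => `|ddiff f p q|%:E).
Proof.
by move=> mf; exact: (measurableT_comp (measurable_abs_ddiff mf) (measurable_pair1 p)).
Qed.

Lemma ddosc_ge0 f : 0 <= ddosc P Q f.
Proof. by apply: integral_ge0 => p _; exact: integral_ge0. Qed.

Lemma le_ddosc f g : measurable_fun setT f -> measurable_fun setT g ->
  (forall p q, `|ddiff f p q| <= `|ddiff g p q|)%R -> ddosc P Q f <= ddosc P Q g.
Proof.
move=> mf mg fg; apply: ge0_le_integral => //.
- by move=> p _; exact: integral_ge0.
- exact: measurable_ddosc_in.
- exact: measurable_ddosc_in.
move=> p _; apply: ge0_le_integral => //.
- exact: measurable_ddiff_p.
- exact: measurable_ddiff_p.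
- by move=> q _; rewrite lee_fin.
Qed.

Lemma ddoscD f g : measurable_fun setT f -> measurable_fun setT g ->
  ddosc P Q (f \+ g)%R <= ddosc P Q f + ddosc P Q g.
Proof.
move=> mf mg; have mfg : measurable_fun setT (f \+ g)%R by exact: measurable_funD.
have ge0 (h : T1 * T2 -> R) p : 0 <= \int[pprod Q Q]_q `|ddiff h p q|%:E.
  exact: integral_ge0.
rewrite /ddosc -ge0_integralD//; try exact: measurable_ddosc_in.
apply: ge0_le_integral => //; first exact: measurable_ddosc_in.
  by apply: emeasurable_funD; exact: measurable_ddosc_in.
move=> p _; rewrite -ge0_integralD//; try exact: measurable_ddiff_p.
apply: ge0_le_integral => //; first exact: measurable_ddiff_p.
  by apply: emeasurable_funD; exact: measurable_ddiff_p.
move=> q _; rewrite -EFinD lee_fin; apply: le_trans (ler_normD _ _).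
by rewrite /ddiff/= le_eqVlt; apply/orP; left; apply/eqP; congr `|_|%R; ring.
Qed.

Lemma ddosc_swap f : measurable_fun setT f ->
  ddosc P Q f = \int[pprod Q Q]_q \int[pprod P P]_p `|ddiff f p q|%:E.
Proof.
move=> mf.
exact: (pprod_tonelli (pprod P P) (pprod Q Q) (measurable_abs_ddiff mf) (@absdd0 f)).
Qed.

(** The corner (x1, x2) is brought to the outside: the inner integral then averages the absolute
    value of a quantity whose mean over y is the deviation at (x1, x2). *)
Lemma ddosc_corner f : measurable_fun setT f ->
  ddosc P Q f = \int[P]_x1 \int[Q]_x2
    \int[pprod P Q]_y `|ddiff f (x1, y.1) (x2, y.2)|%:E.
Proof.
move=> mf; have mF := measurable_abs_ddiff mf.
pose G x1 := fun z : (T1 * T2) * T2 => `|ddiff f (x1, z.1.1) (z.1.2, z.2)|%:E.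
have mG x1 : measurable_fun setT (G x1).
  apply: (measurableT_comp (f := absdd f) mF (g := fun z => ((x1, z.1.1), (z.1.2, z.2)))).
  have m11 : measurable_fun setT (fun z : (T1 * T2) * T2 => z.1.1).
    exact: (measurableT_comp measurable_fst measurable_fst).
  have m12 : measurable_fun setT (fun z : (T1 * T2) * T2 => z.1.2).
    exact: (measurableT_comp measurable_snd measurable_fst).
  by apply/measurable_fun_pair => /=; apply/measurable_fun_pair.
rewrite /ddosc (pprod_tonelli1 P P (measurable_ddosc_in mf)); last first.
  by move=> p; exact: integral_ge0.
apply: eq_integral => x1 _.
under eq_integral => y1 _.
  rewrite (@pprod_tonelli1 _ _ _ _ R Q Q (fun q => `|ddiff f (x1, y1) q|%:E))//;
    last exact: measurable_ddiff_p.
  over.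
rewrite (@pprod_tonelli _ _ _ _ R P Q (fun yx : T1 * T2 =>
  \int[Q]_y2 G x1 (yx, y2)))/=; last 2 first.
- by apply: (@measurable_pprod1 _ _ _ _ R Q (G x1)) => // z; rewrite lee_fin.
- by move=> ?; apply: integral_ge0 => y _; rewrite lee_fin.
apply: eq_integral => x2 _.
rewrite (@pprod_tonelli1 _ _ _ _ R P Q (fun y => `|ddiff f (x1, y.1) (x2, y.2)|%:E))//.
apply: (measurableT_comp (f := G x1) (mG x1) (g := fun y => ((y.1, x2), y.2))).
by apply/measurable_fun_pair => //=; apply/measurable_fun_pair.
Qed.

End ddosc_probability.

(** * Deviation from the averages versus double differences *)

Section marginals.
Context d1 d2 (T1 : measurableType d1) (T2 : measurableType d2) {R : realType}.
Variables (P : probability T1 R) (Q : probability T2 R).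
Local Open Scope ereal_scope.

Lemma integral_prob_cst (c : \bar R) : \int[P]_x c = c.
Proof. by rewrite (@integral_cst _ _ _ P setT)// [X in _ * X]probability_setT mule1. Qed.

Lemma integral_pprod_fst (g : T1 -> \bar R) : measurable_fun setT g ->
  (forall x, 0 <= g x) -> \int[pprod P Q]_z g z.1 = \int[P]_x g x.
Proof.
move=> mg g0; rewrite (@pprod_tonelli1 _ _ _ _ R P Q (g \o fst)); last 2 first.
- exact: measurableT_comp.
- by move=> x; exact: g0.
apply: eq_integral => x _ /=.
by rewrite (@integral_cst _ _ _ Q setT)// [X in _ * X]probability_setT mule1.
Qed.

Lemma integral_pprod_snd (g : T2 -> \bar R) : measurable_fun setT g ->
  (forall x, 0 <= g x) -> \int[pprod P Q]_z g z.2 = \int[Q]_y g y.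
Proof.
move=> mg g0; rewrite (@pprod_tonelli2 _ _ _ _ R P Q (g \o snd)); last 2 first.
- exact: measurableT_comp.
- by move=> x; exact: g0.
apply: eq_integral => x _ /=.
by rewrite (@integral_cst _ _ _ P setT)// [X in _ * X]probability_setT mule1.
Qed.

Lemma integrable_pprod_fst (g : T1 -> R) : P.-integrable setT (EFin \o g) ->
  (pprod P Q).-integrable setT (EFin \o g \o fst).
Proof.
move=> /integrableP[mg ig]; apply/integrableP; split.
  exact: (measurableT_comp mg measurable_fst).
rewrite (integral_pprod_fst (g := abse \o (EFin \o g)))//; first exact: measurableT_comp.
by move=> x; exact: abse_ge0.
Qed.

Lemma integrable_pprod_snd (g : T2 -> R) : Q.-integrable setT (EFin \o g) ->
  (pprod P Q).-integrable setT (EFin \o g \o snd).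
Proof.
move=> /integrableP[mg ig]; apply/integrableP; split.
  exact: (measurableT_comp mg measurable_snd).
rewrite (integral_pprod_snd (g := abse \o (EFin \o g)))//; first exact: measurableT_comp.
by move=> x; exact: abse_ge0.
Qed.

Lemma Rintegral_pprod_fst (g : T1 -> R) : P.-integrable setT (EFin \o g) ->
  (\int[pprod P Q]_z g z.1 = \int[P]_x g x)%R.
Proof.
move=> ig; rewrite /Rintegral; apply: (congr1 fine).
rewrite integralE [RHS]integralE; apply: (congr2 (fun a b => a - b)).
  transitivity (\int[pprod P Q]_z (EFin \o g)^\+ z.1).
    by apply: eq_integral => z _; rewrite funepos.unlock.
  rewrite (integral_pprod_fst (g := (EFin \o g)^\+))//.
  by apply: measurable_funepos; exact: measurable_int ig.
transitivity (\int[pprod P Q]_z (EFin \o g)^\- z.1).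
  by apply: eq_integral => z _; rewrite funeneg.unlock.
rewrite (integral_pprod_fst (g := (EFin \o g)^\-))//.
by apply: measurable_funeneg; exact: measurable_int ig.
Qed.

Lemma Rintegral_pprod_snd (g : T2 -> R) : Q.-integrable setT (EFin \o g) ->
  (\int[pprod P Q]_z g z.2 = \int[Q]_y g y)%R.
Proof.
move=> ig; rewrite /Rintegral; apply: (congr1 fine).
rewrite integralE [RHS]integralE; apply: (congr2 (fun a b => a - b)).
  transitivity (\int[pprod P Q]_z (EFin \o g)^\+ z.2).
    by apply: eq_integral => z _; rewrite funepos.unlock.
  rewrite (integral_pprod_snd (g := (EFin \o g)^\+))//.
  by apply: measurable_funepos; exact: measurable_int ig.
transitivity (\int[pprod P Q]_z (EFin \o g)^\- z.2).
  by apply: eq_integral => z _; rewrite funeneg.unlock.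
rewrite (integral_pprod_snd (g := (EFin \o g)^\-))//.
by apply: measurable_funeneg; exact: measurable_int ig.
Qed.

End marginals.

Section deviation.
Context d1 d2 (T1 : measurableType d1) (T2 : measurableType d2) {R : realType}.
Variables (P : probability T1 R) (Q : probability T2 R).
Implicit Types f g : T1 * T2 -> R.
Local Open Scope ereal_scope.

(** Each of the four corners of a random quadruple has the law of P x Q, so each contributes one L^1
    norm. *)
Lemma ddosc_le_norm g : measurable_fun setT g ->
  ddosc P Q g <= 4%:E * \int[pprod P Q]_x `|g x|%:E.
Proof.
move=> mg.
have mag : measurable_fun setT (fun x => `|g x|%:E).
  by apply/measurable_EFinP; apply: measurableT_comp.
have mpair (U : (T1 * T1) * (T2 * T2) -> T1) (V : (T1 * T1) * (T2 * T2) -> T2) :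
    measurable_fun setT U -> measurable_fun setT V ->
    measurable_fun setT (fun z => `|g (U z, V z)|%:E).
  by move=> mU mV; apply: (measurableT_comp mag); exact/measurable_fun_pair.
have m11 : measurable_fun setT (fun pq : (T1 * T1) * (T2 * T2) => pq.1.1).
  exact: (measurableT_comp measurable_fst measurable_fst).
have m12 : measurable_fun setT (fun pq : (T1 * T1) * (T2 * T2) => pq.1.2).
  exact: (measurableT_comp measurable_snd measurable_fst).
have m21 : measurable_fun setT (fun pq : (T1 * T1) * (T2 * T2) => pq.2.1).
  exact: (measurableT_comp measurable_fst measurable_snd).
have m22 : measurable_fun setT (fun pq : (T1 * T1) * (T2 * T2) => pq.2.2).
  exact: (measurableT_comp measurable_snd measurable_snd).
pose W := pprod (pprod P P) (pprod Q Q).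
pose t11 (z : (T1 * T1) * (T2 * T2)) : \bar R := `|g (z.1.1, z.2.1)|%:E.
pose t21 (z : (T1 * T1) * (T2 * T2)) : \bar R := `|g (z.1.2, z.2.1)|%:E.
pose t12 (z : (T1 * T1) * (T2 * T2)) : \bar R := `|g (z.1.1, z.2.2)|%:E.
pose t22 (z : (T1 * T1) * (T2 * T2)) : \bar R := `|g (z.1.2, z.2.2)|%:E.
have mt11 : measurable_fun setT t11 := mpair _ _ m11 m21.
have mt12 : measurable_fun setT t12 := mpair _ _ m11 m22.
have mt21 : measurable_fun setT t21 := mpair _ _ m12 m21.
have mt22 : measurable_fun setT t22 := mpair _ _ m12 m22.
have mF := measurable_abs_ddiff mg.
have mgx x : measurable_fun setT (fun y => `|g (x, y)|%:E).
  exact: (measurableT_comp mag (measurable_pair1 x)).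
have mgP : measurable_fun setT (fun x => \int[Q]_y `|g (x, y)|%:E).
  exact: (@measurable_pprod1 _ _ _ _ R Q (fun x => `|g x|%:E)).
have gP0 x : 0 <= \int[Q]_y `|g (x, y)|%:E by exact: integral_ge0.
have g0 z : 0 <= `|g z|%:E by rewrite lee_fin.
have gE : \int[pprod P Q]_x `|g x|%:E = \int[P]_x \int[Q]_y `|g (x, y)|%:E.
  exact: (pprod_tonelli1 P Q mag (fun=> g0 _)).
have E11 : \int[W]_z t11 z = \int[pprod P Q]_x `|g x|%:E.
  rewrite gE (pprod_tonelli1 (pprod P P) (pprod Q Q) mt11 (fun=> g0 _)).
  rewrite -(integral_pprod_fst P P)//; apply: eq_integral => p _.
  by rewrite (@integral_pprod_fst _ _ _ _ R Q Q (fun y => `|g (p.1, y)|%:E)).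
have E12 : \int[W]_z t12 z = \int[pprod P Q]_x `|g x|%:E.
  rewrite gE (pprod_tonelli1 (pprod P P) (pprod Q Q) mt12 (fun=> g0 _)).
  rewrite -(integral_pprod_fst P P)//; apply: eq_integral => p _.
  by rewrite (@integral_pprod_snd _ _ _ _ R Q Q (fun y => `|g (p.1, y)|%:E)).
have E21 : \int[W]_z t21 z = \int[pprod P Q]_x `|g x|%:E.
  rewrite gE (pprod_tonelli1 (pprod P P) (pprod Q Q) mt21 (fun=> g0 _)).
  rewrite -(integral_pprod_snd P P)//; apply: eq_integral => p _.
  by rewrite (@integral_pprod_fst _ _ _ _ R Q Q (fun y => `|g (p.2, y)|%:E)).
have E22 : \int[W]_z t22 z = \int[pprod P Q]_x `|g x|%:E.
  rewrite gE (pprod_tonelli1 (pprod P P) (pprod Q Q) mt22 (fun=> g0 _)).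
  rewrite -(integral_pprod_snd P P)//; apply: eq_integral => p _.
  by rewrite (@integral_pprod_snd _ _ _ _ R Q Q (fun y => `|g (p.2, y)|%:E)).
apply: (@le_trans _ _ (\int[W]_z (t11 z + t12 z + t21 z + t22 z))); last first.
  rewrite !ge0_integralD//=; try do ?apply: emeasurable_funD => //;
    try (by move=> z _; do ?apply: adde_ge0; exact: g0).
  rewrite E11 E12 E21 E22.
  have -> : (4 = 1 + 1 + 1 + 1 :> R)%R by ring.
  by rewrite !EFinD !ge0_muleDl ?mul1e// ?adde_ge0.
rewrite /ddosc -(@pprod_tonelli1 _ _ _ _ R _ _ (fun z => `|ddiff g z.1 z.2|%:E))//.
apply: ge0_le_integral => //.
  by do ?apply: emeasurable_funD.
move=> [[x1 y1] [x2 y2]] _; rewrite /t11 /t12 /t21 /t22 -!EFinD lee_fin /ddiff/=.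
rewrite (le_trans (ler_normD _ _))// lerD2r.
rewrite (le_trans (ler_normB _ _))// addrAC lerD2r.
by rewrite (le_trans (ler_normB _ _)).
Qed.

Definition deviation f (x : T1 * T2) : R :=
  (f x - \int[P]_y f (y, x.2) - \int[Q]_y f (x.1, y) + \int[pprod P Q]_y f y)%R.

Variable f : T1 * T2 -> R.
Hypothesis mf : measurable_fun setT f.
Hypothesis intf : (pprod P Q).-integrable setT (EFin \o f).

Lemma ddiff_deviation p q : ddiff (deviation f) p q = ddiff f p q.
Proof. by rewrite /ddiff /deviation/=; ring. Qed.

Lemma measurable_deviation : measurable_fun setT (deviation f).
Proof.
have mF := measurable_fubini_F (m1 := P) (m2 := Q) intf.
have mG := measurable_fubini_G (m1 := P) (m2 := Q) intf.
have mA : measurable_fun setT (fun x2 : T2 => \int[P]_y f (y, x2))%R.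
  exact: (measurableT_comp (fine_measurable measurableT) mG).
have mB : measurable_fun setT (fun x1 : T1 => \int[Q]_y f (x1, y))%R.
  exact: (measurableT_comp (fine_measurable measurableT) mF).
apply: measurable_funD => //; apply: measurable_funB.
  by apply: measurable_funB => //; exact: (measurableT_comp mA measurable_snd).
exact: (measurableT_comp mB measurable_fst).
Qed.

Lemma ddosc_le_deviation :
  ddosc P Q f <= 4%:E * \int[pprod P Q]_x `|deviation f x|%:E.
Proof.
apply: le_trans (ddosc_le_norm measurable_deviation).
by apply: le_ddosc => // [|p q]; [exact: measurable_deviation|rewrite ddiff_deviation].
Qed.

(** For almost every x the deviation is the mean of the double difference over the opposite corner
    y, and the absolute value passes inside. Slices are integrable only for almost every frozen
    variable, hence the almost everywhere comparison of the iterated integrals. *)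
Lemma deviation_le_ddosc : \int[pprod P Q]_x `|deviation f x|%:E <= ddosc P Q f.
Proof.
have mT := measurable_deviation.
have maT : measurable_fun setT (fun x => `|deviation f x|%:E).
  by apply/measurable_EFinP; apply: measurableT_comp.
have mF := measurable_abs_ddiff mf.
have ae1 := ae_integrable1 (m1 := P) (m2 := Q) intf.
have ae2 := ae_integrable2 (m1 := P) (m2 := Q) intf.
pose H (x : T1 * T2) := \int[pprod P Q]_y `|ddiff f (x.1, y.1) (x.2, y.2)|%:E.
have mK : measurable_fun setT (fun z : (T1 * T2) * (T1 * T2) =>
    `|ddiff f (z.1.1, z.2.1) (z.1.2, z.2.2)|%:E).
  have m11 : measurable_fun setT (fun pq : (T1 * T2) * (T1 * T2) => pq.1.1).
    exact: (measurableT_comp measurable_fst measurable_fst).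
  have m12 : measurable_fun setT (fun pq : (T1 * T2) * (T1 * T2) => pq.1.2).
    exact: (measurableT_comp measurable_snd measurable_fst).
  have m21 : measurable_fun setT (fun pq : (T1 * T2) * (T1 * T2) => pq.2.1).
    exact: (measurableT_comp measurable_fst measurable_snd).
  have m22 : measurable_fun setT (fun pq : (T1 * T2) * (T1 * T2) => pq.2.2).
    exact: (measurableT_comp measurable_snd measurable_snd).
  apply: (measurableT_comp (f := fun pq : (T1 * T1) * (T2 * T2) =>
    `|ddiff f pq.1 pq.2|%:E) mF
    (g := fun z : (T1 * T2) * (T1 * T2) => ((z.1.1, z.2.1), (z.1.2, z.2.2)))).
  by apply/measurable_fun_pair => /=; apply/measurable_fun_pair.
have mH : measurable_fun setT H.
  apply: (@measurable_pprod1 _ _ _ _ R (pprod P Q) (fun z : (T1 * T2) * (T1 * T2) =>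
    `|ddiff f (z.1.1, z.2.1) (z.1.2, z.2.2)|%:E) mK).
  by move=> z; rewrite lee_fin.
have H0 x : 0 <= H x by exact: integral_ge0.
have aT0 x : 0 <= `|deviation f x|%:E by rewrite lee_fin.
rewrite ddosc_corner// (pprod_tonelli1 _ _ maT)//.
apply: ae_ge0_le_integral => //.
- by move=> x _; exact: integral_ge0.
- exact: (@measurable_pprod1 _ _ _ _ R Q (fun x => `|deviation f x|%:E)).
- by move=> x1 _; apply: integral_ge0 => x2 _; exact: (H0 (x1, x2)).
- exact: (@measurable_pprod1 _ _ _ _ R Q H).
apply: filterS ae1 => x1 int1 _.
apply: ae_ge0_le_integral => //.
- exact: (measurableT_comp maT (measurable_pair1 x1)).
- by move=> x2 _; exact: (H0 (x1, x2)).
- exact: (measurableT_comp mH (measurable_pair1 x1)).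
apply: filterS ae2 => x2 int2 _.
pose g (y : T1 * T2) : R := ddiff f (x1, y.1) (x2, y.2).
have i0 : (pprod P Q).-integrable setT (EFin \o (fun=> f (x1, x2))).
  exact: finite_measure_integrable_cst.
have i1 : (pprod P Q).-integrable setT (EFin \o (fun y => f (y.1, x2))).
  exact: (@integrable_pprod_fst _ _ _ _ R P Q (fun y => f (y, x2))).
have i2 : (pprod P Q).-integrable setT (EFin \o (fun y => f (x1, y.2))).
  exact: (@integrable_pprod_snd _ _ _ _ R P Q (fun y => f (x1, y))).
have i3 : (pprod P Q).-integrable setT (EFin \o (fun y : T1 * T2 => f (y.1, y.2))).
  apply: eq_integrable intf => // -[y1 y2] //.
have i01 : (pprod P Q).-integrable setT
    (EFin \o (fun y => f (x1, x2) - f (y.1, x2))%R).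
  by apply: (integrableB measurableT i0 i1).
have i012 : (pprod P Q).-integrable setT
    (EFin \o (fun y => f (x1, x2) - f (y.1, x2) - f (x1, y.2))%R).
  by apply: (integrableB measurableT i01 i2).
have ig : (pprod P Q).-integrable setT (EFin \o g).
  by apply: (integrableD measurableT i012 i3).
have -> : deviation f (x1, x2) = (\int[pprod P Q]_y g y)%R.
  rewrite /g /ddiff/= RintegralD// RintegralB// RintegralB//.
  rewrite (Rintegral_cst _ measurableT) [fine _](_ : _ = 1%R) ?mulr1; last first.
    by rewrite [X in fine X]probability_setT.
  rewrite (@Rintegral_pprod_fst _ _ _ _ R P Q (fun y => f (y, x2)))//.
  rewrite (@Rintegral_pprod_snd _ _ _ _ R P Q (fun y => f (x1, y)))//.
  by rewrite /deviation; congr (_ + _)%R; apply: eq_Rintegral => -[].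
rewrite EFin_normr_Rintegral//; apply: le_abse_integral => //.
exact: measurable_int ig.
Qed.

Lemma integrable_deviation : \int[pprod P Q]_x `|deviation f x|%:E < +oo.
Proof.
apply: (le_lt_trans deviation_le_ddosc); apply: (le_lt_trans (ddosc_le_norm mf)).
have /integrableP[_ /= H] := intf.
by rewrite lte_mul_pinfty.
Qed.

End deviation.

(** * Averages over rectangles as integrals for product probabilities *)

Section rectangles.
Context {R : realType}.
Local Open Scope ereal_scope.

(** [fine] sends infinite values to 0, so scaling by c commutes with it in every case; this also
    covers the nonintegrable slices on which [average1] and [average2] take a default value. *)
Lemma Rintegral_scaled d (T : measurableType d) (nu mu : {measure set T -> \bar R})
    (D : set T) (c : R) : (0 < c)%R -> measurable D ->
  (forall g : T -> \bar R, measurable_fun setT g -> (forall x, 0 <= g x) ->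
    \int[nu]_x g x = c%:E * \int[mu]_(x in D) g x) ->
  forall f : T -> R, measurable_fun setT f ->
    (\int[nu]_x f x = c * \int[mu]_(x in D) f x)%R.
Proof.
move=> c0 mD H f mf.
have mEf : measurable_fun setT (EFin \o f) by exact/measurable_EFinP.
rewrite /Rintegral [X in fine X = _]integralE [X in (_ * fine X)%R]integralE.
rewrite !H; try by move=> x; rewrite ?funepos_ge0 ?funeneg_ge0.
- have : 0 <= \int[mu]_(x in D) (fun x => (f x)%:E)^\+ x.
    by apply: integral_ge0 => x _; exact: funepos_ge0.
  have : 0 <= \int[mu]_(x in D) (fun x => (f x)%:E)^\- x.
    by apply: integral_ge0 => x _; exact: funeneg_ge0.
  case: (\int[mu]_(x in D) _) => [b| |] //= _;
    case: (\int[mu]_(x in D) _) => [a| |] //= _;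
    rewrite ?gt0_muley ?lte_fin//= ?mulr0//.
  by rewrite mulrBr.
- exact: measurable_funeneg.
- exact: measurable_funepos.
Qed.

Lemma average_unif n (I : cube R n) (f : 'rV[R]_n -> R) : measurable_fun setT f ->
  (average (lebesgue_rV n) (cube_set I) f = \int[unif I]_x f x)%R.
Proof.
move=> mf; have [mI lI] := lebesgue_cube I; have l0 := side_exp_gt0 I n.
rewrite /average [fine _](_ : _ = side I ^+ n)%R; last exact: (congr1 fine lI).
rewrite (@Rintegral_scaled _ _ (unif I) (lebesgue_rV n) _ ((side I ^+ n)^-1) _ mI)//.
  by rewrite invr_gt0.
by move=> g mg g0; exact: integral_unif.
Qed.

Variables d1 d2 : nat.
Local Notation E := ('rV[R]_d1 * 'rV[R]_d2)%type.
Local Notation U I1 I2 := (pprod (unif I1) (unif I2)).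

Lemma measurable_rect (I1 : cube R d1) (I2 : cube R d2) : measurable (rect I1 I2).
Proof. by apply: measurableX; exact: measurable_cube. Qed.

Lemma lebesgue_rect (I1 : cube R d1) (I2 : cube R d2) :
  (lebesgue_prod d1 d2) (rect I1 I2) = (side I1 ^+ d1 * side I2 ^+ d2)%:E.
Proof.
have [m1 l1] := lebesgue_cube I1; have [m2 l2] := lebesgue_cube I2.
rewrite EFinM -l1 -l2.
exact: (@product_measure1E _ _ _ _ R (lebesgue_rV d1) (lebesgue_rV d2)).
Qed.

Lemma integral_pprod_rect (I1 : cube R d1) (I2 : cube R d2) (g : E -> \bar R) : measurable_fun setT g ->
  (forall x, 0 <= g x) ->
  \int[U I1 I2]_x g x = ((side I1 ^+ d1 * side I2 ^+ d2)^-1)%:E *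
    \int[(lebesgue_prod d1 d2)]_(x in rect I1 I2) g x.
Proof.
move=> mg g0.
have m1 := measurable_cube I1; have m2 := measurable_cube I2.
rewrite (pprod_tonelli1 (unif I1) (unif I2) mg g0) integral_unif//; last 2 first.
- exact: (@measurable_pprod1 _ _ _ _ R (unif I2) g).
- by move=> x; exact: integral_ge0.
have mgx x : measurable_fun setT (fun y => g (x, y)).
  exact: (measurableT_comp mg (measurable_pair1 x)).
under eq_integral do rewrite integral_unif//.
have mgr : measurable_fun setT (g \_ (rect I1 I2)).
  apply/(measurable_restrictT _ (measurable_rect _ _)).
  exact: measurable_funTS.
have gr0 x : 0 <= (g \_ (rect I1 I2)) x by apply: erestrict_ge0.
rewrite ge0_integralZl ?lee_fin ?side_expV_ge0//; last 2 first.
- apply: (@measurable_funS _ _ _ _ setT) => //.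
  have := (@measurable_fun_fubini_tonelli_F _ _ _ _ R (lebesgue_rV d2)
    (g \_ (setT `*` cube_set I2))).
  move=> H; apply: eq_measurable_fun (H _ _).
  + move=> x _; rewrite /fubini_F [RHS]integral_mkcond.
    apply: eq_integral => y _; rewrite !patchE.
    by congr (if _ then _ else _); apply/idP/idP; rewrite !inE => // -[].
  + apply/(measurable_restrictT _ (measurableX measurableT m2)).
    exact: measurable_funTS.
  + by move=> x; apply: erestrict_ge0.
- by move=> x _; exact: integral_ge0.
rewrite muleA -EFinM -invfM; congr (_ * _).
rewrite [RHS]integral_mkcond.
transitivity (\int[lebesgue_rV d1]_x
    fubini_F (lebesgue_rV d2) (g \_ (rect I1 I2)) x); last first.
  by apply: esym; apply: fubini_tonelli1.
rewrite [LHS]integral_mkcond; apply: eq_integral => x _.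
rewrite /fubini_F patchE; case: ifPn => xI.
  rewrite [LHS]integral_mkcond; apply: eq_integral => y _; rewrite !patchE.
  congr (if _ then _ else _); apply/idP/idP; rewrite !inE; last by case.
  by move=> yI; split=> //; rewrite inE in xI.
rewrite integral0_eq// => y _; rewrite patchE ifF//; apply/negbTE.
by apply: contra xI; rewrite !inE => -[].
Qed.

Lemma average_rect (I1 : cube R d1) (I2 : cube R d2) (f : E -> R) : measurable_fun setT f ->
  (average (lebesgue_prod d1 d2) (rect I1 I2) f = \int[U I1 I2]_x f x)%R.
Proof.
move=> mf; rewrite /average [fine _](_ : _ = side I1 ^+ d1 * side I2 ^+ d2)%R; last first.
  exact: (congr1 fine (lebesgue_rect I1 I2)).
rewrite (@Rintegral_scaled _ _ (U I1 I2) (lebesgue_prod d1 d2) _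
  ((side I1 ^+ d1 * side I2 ^+ d2)^-1) _ (measurable_rect I1 I2))//.
  by rewrite invr_gt0 mulr_gt0// side_exp_gt0.
by move=> g mg g0; exact: integral_pprod_rect.
Qed.

Lemma loc_integrable_unif (I1 : cube R d1) (I2 : cube R d2) (f : E -> R) : loc_integrable f ->
  (U I1 I2).-integrable setT (EFin \o f).
Proof.
move=> [mf lf]; have /integrableP[_ intf] := lf _ (@compact_rect R d1 d2 I1 I2).
have mEf : measurable_fun setT (EFin \o f) by exact/measurable_EFinP.
apply/integrableP; split=> //.
rewrite (@integral_pprod_rect I1 I2 (abse \o (EFin \o f))).
- by rewrite lte_mul_pinfty// lee_fin invr_ge0 mulr_ge0// ltW// side_exp_gt0.
- exact: measurableT_comp.
- by move=> x; exact: abse_ge0.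
Qed.

End rectangles.

(** * Oscillation bounds and the vanishing condition *)

Section oscillation.
Context {R : realType} (d1 d2 : nat) (alpha : R).
Local Notation E := ('rV[R]_d1 * 'rV[R]_d2)%type.

(** An inequality between extended reals, so that such bounds can be added directly; up to the
    factor 4 it says that the oscillation is at most e. *)
Definition osc_bound (f : E -> R) (I1 : cube R d1) (I2 : cube R d2) (e : R) : Prop :=
  (ddosc (unif I1) (unif I2) f <= (e * side I1 `^ alpha)%:E)%E.

Lemma oscillationE (f : E -> R) (I1 : cube R d1) (I2 : cube R d2) : loc_integrable f ->
  oscillation alpha f I1 I2 = side I1 `^ (- alpha) *
    fine (\int[pprod (unif I1) (unif I2)]_x
      `|deviation (unif I1) (unif I2) f x|%:E)%E.
Proof.
move=> lf; have intf := loc_integrable_unif I1 I2 lf; have [mf _] := lf.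
have mT := measurable_deviation mf intf.
rewrite /oscillation; congr (_ * _).
transitivity (average (lebesgue_prod d1 d2) (rect I1 I2)
    (fun x => `|deviation (unif I1) (unif I2) f x|)); last first.
  by rewrite average_rect//; apply: measurableT_comp.
congr (average _ _ _); apply/funext => x; congr `|_|; rewrite /deviation.
rewrite average_rect// /average1 average_unif; last first.
  by apply: (measurableT_comp mf); exact: measurable_pair2.
rewrite /average2 average_unif//.
by apply: (measurableT_comp mf); exact: measurable_pair1.
Qed.

Lemma oscillation_le (f : E -> R) (I1 : cube R d1) (I2 : cube R d2) e : loc_integrable f ->
  osc_bound f I1 I2 e -> oscillation alpha f I1 I2 <= e.
Proof.
move=> lf fe; have intf := loc_integrable_unif I1 I2 lf; have [mf _] := lf.
have la : 0 < side I1 `^ alpha by rewrite powR_gt0// side_gt0.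
rewrite oscillationE// powRN mulrC ler_pdivrMr//.
have H := le_trans (deviation_le_ddosc mf intf) fe.
rewrite -lee_fin fineK// ge0_fin_numE; first exact: le_lt_trans H (ltry _).
by apply: integral_ge0 => x _; rewrite lee_fin.
Qed.

Lemma le_oscillation (f : E -> R) (I1 : cube R d1) (I2 : cube R d2) e : loc_integrable f ->
  oscillation alpha f I1 I2 <= e -> osc_bound f I1 I2 (4 * e).
Proof.
move=> lf; have intf := loc_integrable_unif I1 I2 lf; have [mf _] := lf.
have la : 0 < side I1 `^ alpha by rewrite powR_gt0// side_gt0.
rewrite oscillationE// powRN mulrC ler_pdivrMr// => fe.
apply: le_trans (ddosc_le_deviation mf intf) _.
rewrite -mulrA EFinM; apply: lee_wpmul2l => //.
rewrite -(@fineK _ (\int[_]_x _)%E) ?lee_fin// ge0_fin_numE.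
  exact: integrable_deviation.
by apply: integral_ge0 => x _; rewrite lee_fin.
Qed.

(* Large rectangles need no clause of their own: they reach far out. *)
Definition vanishing (f : E -> R) : Prop :=
  forall e, 0 < e -> exists2 T, 0 < T & forall (I1 : cube R d1) (I2 : cube R d2),
    [\/ side I1 < T^-1, side I2 < T^-1 |
      exists2 p, rect I1 I2 p & T <= `|p|] ->
    osc_bound f I1 I2 e.

Lemma cube_diam n (I : cube R n) x y : cube_set I x -> cube_set I y ->
  `|x - y| <= side I.
Proof.
move=> Ix Iy; apply/rV_norm_le => [|i]; first by rewrite ltW// side_gt0.
have := Ix i; have := Iy i; rewrite !mxE ler_norml => /andP[? ?] /andP[? ?].
by apply/andP; split; lra.
Qed.

Lemma corner_in n (I : cube R n) : cube_set I (corner I).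
Proof. by move=> i; rewrite lexx/= lerDl ltW// side_gt0. Qed.

Lemma norm_le_euclidean (p : E) : `|p| <= euclidean_norm p.
Proof.
have e0 : 0 <= euclidean_norm p by exact: sqrtr_ge0.
rewrite prod_normE ge_max; apply/andP; split; apply/rV_norm_le => // i;
  rewrite /euclidean_norm -sqrtr_sqr ler_wsqrtr//.
- rewrite (bigD1 i)//= -addrA lerDl addr_ge0//; apply: sumr_ge0 => j _;
  exact: sqr_ge0.
- rewrite addrC (bigD1 i)//= -addrA lerDl addr_ge0//; apply: sumr_ge0 => j _;
  exact: sqr_ge0.
Qed.

Lemma euclidean_le_norm (p : E) : euclidean_norm p <= (d1 + d2)%:R * `|p|.
Proof.
rewrite -[leRHS]ger0_norm ?mulr_ge0// -sqrtr_sqr ler_wsqrtr//.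
have sq n (x : 'rV[R]_n) : `|x| <= `|p| ->
    \sum_i x ord0 i ^+ 2 <= n%:R * `|p| ^+ 2.
  move=> xp; rewrite -[n in n%:R]card_ord -sum1_card natr_sum mulr_suml.
  apply: ler_sum => i _; rewrite mul1r -real_normK ?num_real// ler_sqr ?nnegrE//.
  exact: le_trans (coord_le_norm x i) xp.
have p1 : `|p.1| <= `|p| by rewrite prod_normE le_max lexx.
have p2 : `|p.2| <= `|p| by rewrite prod_normE le_max lexx orbT.
apply: (le_trans (lerD (sq _ _ p1) (sq _ _ p2))).
rewrite -mulrDl -natrD exprMn ler_wpM2r ?sqr_ge0// -natrX ler_nat.
by case: (d1 + d2)%N => // k; rewrite leq_pmulr.
Qed.

Lemma rect_dist (I1 : cube R d1) (I2 : cube R d2) p q : rect I1 I2 p -> rect I1 I2 q ->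
  `|p - q| <= Num.max (side I1) (side I2).
Proof.
move=> [p1 p2] [q1 q2]; rewrite prod_normE ge_max; apply/andP; split.
  by rewrite le_max (cube_diam p1 q1).
by rewrite le_max (cube_diam p2 q2) orbT.
Qed.

Lemma VMO_vanishing f : VMO d1 d2 alpha f ->
  [/\ loc_integrable f, vanishing f &
    exists2 A, 0 <= A & forall (I1 : cube R d1) (I2 : cube R d2), osc_bound f I1 I2 A].
Proof.
move=> [[lf bf] vf]; split=> //.
- move=> e e0; have [t t0 H] := vf (e / 4) ltac:(lra).
  (* If both sides are at most t^-1, a point of norm 3 t^-1 keeps the whole rectangle at distance at
     least 2 t^-1 from the origin. *)
  exists (3 * t^-1); first by rewrite mulr_gt0// invr_gt0.
  move=> I1 I2 far.
  have tV : 0 < t^-1 by rewrite invr_gt0.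
  have tT : (3 * t^-1)^-1 <= t.
    by rewrite invfM invrK ler_pdivrMl//; lra.
  suff deg : (side I1 < t \/ t^-1 < side I1) \/ (side I2 < t \/ t^-1 < side I2) \/
      t^-1 < dist_origin (rect I1 I2).
    have -> : e = 4 * (e / 4) by field.
    by apply: le_oscillation => //; exact/ltW/H.
  case: far => [h|h|[p Rp pT]].
  + by left; left; exact: lt_le_trans h tT.
  + by right; left; left; exact: lt_le_trans h tT.
  have [l1|l1] := ltP t^-1 (side I1); first by left; right.
  have [l2|l2] := ltP t^-1 (side I2); first by right; left; right.
  right; right; apply: (@lt_le_trans _ _ (2 * t^-1)); first lra.
  apply: lb_le_inf.
    by exists (euclidean_norm p); exists p.
  move=> _ [q Rq <-]; apply: le_trans (norm_le_euclidean q).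
  have := rect_dist Rp Rq; have : Num.max (side I1) (side I2) <= t^-1.
    by rewrite ge_max l1 l2.
  have := ler_normD (p - q) q; rewrite subrK; lra.
- have b0 : (0 <= bmo_norm alpha f)%E.
    pose I1 := @Cube R d1 0 1 ltr01; pose I2 := @Cube R d2 0 1 ltr01.
    apply: (@le_trans _ _ (oscillation alpha f I1 I2)%:E).
      rewrite oscillationE// lee_fin mulr_ge0 ?powR_ge0// fine_ge0//.
      by apply: integral_ge0 => x _; rewrite lee_fin.
    by apply: ereal_sup_ubound; exists (I1, I2).
  have bfin : bmo_norm alpha f \is a fin_num by rewrite ge0_fin_numE.
  exists (4 * fine (bmo_norm alpha f)); first by rewrite mulr_ge0// fine_ge0.
  move=> I1 I2; apply: le_oscillation => //.
  rewrite -lee_fin fineK//; apply: ereal_sup_ubound; by exists (I1, I2).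
Qed.

Lemma vanishing_VMO f : (0 < d1)%N -> (0 < d2)%N ->
  BMO alpha f -> vanishing f -> VMO d1 d2 alpha f.
Proof.
move=> d1_gt0 d2_gt0 bf vf; split=> // e e0.
have [lf _] := bf.
have [T T0 H] := vf (e / 2) ltac:(lra).
have cc0 : 0 < (2 + (d1 + d2))%:R :> R by rewrite ltr0n.
(* The 2: opposite corners of a cube of side above 2 T differ by more than 2 T in the first
   coordinate, so one of them has norm at least T. The d1 + d2 dominates the ratio of the Euclidean
   norm to the sup norm. *)
exists ((2 + (d1 + d2))%:R * T)^-1; first by rewrite invr_gt0 mulr_gt0.
move=> I1 I2; rewrite invrK => deg.
apply: (@le_lt_trans _ _ (e / 2)); last lra.
apply: oscillation_le => //; apply: H.
have cT : ((2 + (d1 + d2))%:R * T)^-1 <= T^-1.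
  by rewrite lef_pV2 ?posrE ?mulr_gt0//; apply: ler_peMl; [exact: ltW|rewrite ler1n].
have T2 : 2 * T <= (2 + (d1 + d2))%:R * T.
  by apply: ler_wpM2r; [exact: ltW|rewrite ler_nat leq_addr].
have large n (n0 : (0 < n)%N) (I : cube R n) : 2 * T < side I ->
    exists2 x, cube_set I x & T <= `|x|.
  move=> lI; pose i0 := Ordinal n0; have s0 := side_gt0 I.
  have [h|h] := leP T `|corner I ord0 i0|.
    by exists (corner I); [exact: corner_in|exact: le_trans h (coord_le_norm _ _)].
  exists (corner I + const_mx (side I)).
    by move=> i; rewrite !mxE lexx lerDl ltW.
  apply: le_trans (coord_le_norm _ i0); rewrite !mxE.
  move: h; rewrite ltr_norml => /andP[h1 h2].
  by apply: le_trans (ler_norm _); lra.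
case: deg => [[h|h]|[[h|h]|h]].
- by constructor 1; exact: lt_le_trans h cT.
- constructor 3; have [x Ix Tx] := large _ d1_gt0 I1 (le_lt_trans T2 h).
  exists (x, corner I2); first by split=> //; exact: corner_in.
  by rewrite prod_normE le_max Tx.
- by constructor 2; exact: lt_le_trans h cT.
- constructor 3; have [x Ix Tx] := large _ d2_gt0 I2 (le_lt_trans T2 h).
  exists (corner I1, x); first by split=> //; exact: corner_in.
  by rewrite prod_normE le_max Tx orbT.
constructor 3; exists (corner I1, corner I2); first by split; exact: corner_in.
set p := (_, _).
have : dist_origin (rect I1 I2) <= euclidean_norm p.
  apply: ge_inf; last by exists p => //; split; exact: corner_in.
  by exists 0 => _ [q _ <-]; exact: sqrtr_ge0.
move=> /(lt_le_trans h) hp.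
have := lt_le_trans hp (euclidean_le_norm p).
have : (d1 + d2)%:R * `|p| <= (2 + (d1 + d2))%:R * `|p|.
  by apply: ler_wpM2r; [exact: normr_ge0|rewrite ler_nat leq_addl].
move=> h1 h2; have := lt_le_trans h2 h1.
by rewrite ltr_pM2l// => /ltW.
Qed.

End oscillation.

(** * Compactly supported smooth functions are Lipschitz *)

Section smooth_lipschitz.
Context {R : realType} {V : normedModType R}.
Implicit Types (phi : V -> R) (a v : V).

Lemma derivable_line phi a v (t : R) :
  derivable phi (t *: v + a) v ->
  is_derive t (1 : R) (fun s : R => phi (s *: v + a)) ('D_v phi (t *: v + a)).
Proof.
move=> dphi.
have e : (fun h : R => h^-1 *: (((fun s : R => phi (s *: v + a)) \o shift t) (h *: 1)
      - phi (t *: v + a))) =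
    (fun h : R => h^-1 *: ((phi \o shift (t *: v + a)) (h *: v) - phi (t *: v + a))).
  by apply/funext => h /=; rewrite [h *: 1]mulr1 scalerDl addrA.
by split; [rewrite /derivable e | rewrite /derive e].
Qed.

Lemma line_lipschitz phi v M :
  (forall x, derivable phi x v) -> (forall x, `|'D_v phi x| <= M) ->
  forall a h, `|phi (h *: v + a) - phi a| <= M * `|h|.
Proof.
move=> dphi DM a h.
pose g (s : R) : R := phi (s *: v + a).
pose dg (s : R) : R := 'D_v phi (s *: v + a).
have dgP (s : R) : is_derive s (1 : R) g (dg s) by exact: derivable_line.
have cg (i : interval R) : {within [set` i], continuous g}.
  by apply: derivable_within_continuous => s _; have [] := dgP s.
have mvt x y : x <= y -> `|g y - g x| <= M * `|y - x|.
  move=> xy; have [c _ ->] := MVT_segment xy (fun s _ => dgP s) (cg _).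
  by rewrite normrM ler_wpM2r// DM.
have -> : phi (h *: v + a) - phi a = g h - g 0 by rewrite /g scale0r add0r.
have [h0|h0] := leP 0 h; first by rewrite (le_trans (mvt _ _ h0))// subr0.
by rewrite distrC (le_trans (mvt _ _ (ltW h0)))// sub0r normrN.
Qed.

(** Telescoping: the directions [w i] are added one after the other. *)
Lemma sum_lipschitz phi (I : Type) (s : seq I) (w : I -> V) (h : I -> R) (M : I -> R) :
  (forall i a t, `|phi (t *: w i + a) - phi a| <= M i * `|t|) ->
  forall a, `|phi (\sum_(i <- s) h i *: w i + a) - phi a| <=
    \sum_(i <- s) M i * `|h i|.
Proof.
move=> H; elim: s => [|i s IH] a; first by rewrite !big_nil add0r subrr normr0.
rewrite !big_cons -addrA.
rewrite (le_trans (ler_distD (phi (\sum_(i <- s) h i *: w i + a)) _ _))//.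
by rewrite lerD.
Qed.

(** The derivative is continuous, hence bounded on the compact support, and off the support phi is
    locally 0. *)
Lemma Cc_smooth_deriv_bounded phi v : Cc_smooth phi ->
  (forall x, derivable phi x v) /\ exists M, forall x, `|'D_v phi x| <= M.
Proof.
move=> [sphi cK].
have [_ /(_ v)[dphi cD]] := sphi 1.
split=> //.
have /compact_bounded[M [_ H]] : compact ('D_v phi @` closure [set x | phi x != 0]).
  by apply: continuous_compact cK; exact: continuous_subspaceT.
exists `|M + 1| => x.
have [Kx|Kx] := pselect (closure [set x | phi x != 0] x).
  rewrite (le_trans _ (ler_norm _))//.
  by apply: (H (M + 1)); [rewrite ltrDl|exists x].
rewrite (@near_eq_derive _ _ _ phi (cst 0)).
  by rewrite derive_cst normr0.
have oK : open (~` closure [set x | phi x != 0]) by apply: closed_openC; exact: closed_closure.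
have : nbhs x (~` closure [set x | phi x != 0]) by exact: open_nbhs_nbhs.
apply: filterS => y Ky; apply/eqP; apply: contrapT => /negP y0.
by apply: Ky; exact: subset_closure.
Qed.

End smooth_lipschitz.

Section compact_lipschitz.
Context {R : realType} {d1 d2 : nat}.
Local Notation E := ('rV[R]_d1 * 'rV[R]_d2)%type.

Definition compact_lipschitz (phi : E -> R) (L M S : R) : Prop :=
  [/\ forall p q, `|phi p - phi q| <= L * `|p - q|,
      forall p, `|phi p| <= M & forall p, S <= `|p| -> phi p = 0].

Lemma Cc_smooth_lipschitz (phi : E -> R) : Cc_smooth phi ->
  exists L M S, [/\ 0 < L, 0 < M, 0 < S & compact_lipschitz phi L M S].
Proof.
move=> sphi; have [sm cK] := sphi.
have cphi : continuous phi := sm 0%N.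
have [S [S0 HS]] : exists S, 0 < S /\ forall p, S <= `|p| -> phi p = 0.
  have [M [_ H]] := compact_bounded cK.
  exists (`|M| + 2); split=> [|p pM]; first by rewrite ltr_wpDl.
  apply/eqP; apply: contrapT => /negP p0.
  have Kp : closure [set x | phi x != 0] p by exact: subset_closure.
  have := le_trans pM (H (M + 1) ltac:(by rewrite ltrDl) p Kp).
  have := ler_norm M; lra.
have [M [M0 HM]] : exists M, 0 < M /\ forall p, `|phi p| <= M.
  have /compact_bounded[M [_ H]] : compact (phi @` closure [set x | phi x != 0]).
    by apply: continuous_compact cK; exact: continuous_subspaceT.
  exists (`|M| + 1); split=> [|p]; first by rewrite ltr_wpDl.
  have [->|p0] := eqVneq (phi p) 0; first by rewrite normr0 addr_ge0.
  apply: H; first by have := ler_norm M; lra.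
  by exists p => //; exact: subset_closure.
have dM v : exists N, 0 <= N /\ forall a h, `|phi (h *: v + a) - phi a| <= N * `|h|.
  have [dphi [N HN]] := Cc_smooth_deriv_bounded v sphi.
  exists N; split; first exact: le_trans (HN 0).
  exact: line_lipschitz.
have [N1 /all_and2[N10 HN1]] := choice (fun i : 'I_d1 => dM (delta_mx ord0 i, 0)).
have [N2 /all_and2[N20 HN2]] := choice (fun i : 'I_d2 => dM (0, delta_mx ord0 i)).
pose L := \sum_i N1 i + \sum_i N2 i.
exists (L + 1), M, S; split=> //.
  by rewrite ltr_wpDl// addr_ge0// sumr_ge0.
split=> // p q.
have sumL (I : finType) (N h : I -> R) (r : R) : (forall i, 0 <= N i) ->
    (forall i, `|h i| <= r) -> \sum_i N i * `|h i| <= (\sum_i N i) * r.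
  move=> N0 hr; rewrite mulr_suml; apply: ler_sum => i _.
  by apply: ler_wpM2l.
have pairD (a b : 'rV[R]_d1) (c d : 'rV[R]_d2) :
    ((a, c) : E) + (b, d) = (a + b, c + d) by [].
have pairZ (k : R) (a : 'rV[R]_d1) (c : 'rV[R]_d2) :
    k *: ((a, c) : E) = (k *: a, k *: c) by [].
have key (a : E) (x : 'rV[R]_d1) (y : 'rV[R]_d2) :
    `|phi ((x, y) + a) - phi a| <= L * `|(x, y)|.
  have x1 : (x, 0 : 'rV[R]_d2) = \sum_i x ord0 i *: ((delta_mx ord0 i, 0) : E).
    rewrite {1}(row_sum_delta x); elim/big_rec2: _ => // i u v _ <-.
    by rewrite pairZ pairD scaler0 addr0.
  have y1 : (0 : 'rV[R]_d1, y) = \sum_i y ord0 i *: ((0, delta_mx ord0 i) : E).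
    rewrite {1}(row_sum_delta y); elim/big_rec2: _ => // i u v _ <-.
    by rewrite pairZ pairD scaler0 addr0.
  have xy : ((x, y) : E) = (x, 0) + (0, y).
    by rewrite pairD addr0 add0r.
  have hx i : `|x ord0 i| <= `|(x, y)|.
    by rewrite prod_normE (le_trans (coord_le_norm x i))// le_max lexx.
  have hy i : `|y ord0 i| <= `|(x, y)|.
    by rewrite prod_normE (le_trans (coord_le_norm y i))// le_max lexx orbT.
  rewrite {1}xy -addrA (le_trans (ler_distD (phi ((0, y) + a)) _ _))// /L mulrDl lerD//.
    rewrite x1; apply: le_trans (sumL _ _ _ _ N10 hx).
    exact: sum_lipschitz.
  rewrite y1; apply: le_trans (sumL _ _ _ _ N20 hy).
  exact: sum_lipschitz.
have := key q (p - q).1 (p - q).2; rewrite -surjective_pairing subrK.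
move=> /le_trans; apply; rewrite ler_wpM2r// lerDl//.
Qed.

End compact_lipschitz.

(** * From pointwise bounds to averaged double differences *)

Section pointwise_to_integral.
Context {R : realType}.
Local Open Scope ereal_scope.

Lemma le_integral_rect n m (I : cube R n) (J : cube R m)
    (g h : 'rV[R]_n * 'rV[R]_m -> \bar R) :
  measurable_fun setT g -> measurable_fun setT h ->
  (forall x, 0 <= g x) -> (forall x, 0 <= h x) ->
  (forall x, rect I J x -> g x <= h x) ->
  \int[pprod (unif I) (unif J)]_x g x <= \int[pprod (unif I) (unif J)]_x h x.
Proof.
move=> mg mh g0 h0 gh.
rewrite (pprod_tonelli1 (unif I) (unif J) mg g0).
rewrite (pprod_tonelli1 (unif I) (unif J) mh h0).
apply: le_integral_unif.
- exact: (@measurable_pprod1 _ _ _ _ R (unif J) g).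
- exact: (@measurable_pprod1 _ _ _ _ R (unif J) h).
- by move=> x; exact: integral_ge0.
- by move=> x; exact: integral_ge0.
move=> x Ix; apply: le_integral_unif => //.
- exact: (measurableT_comp mg (measurable_pair1 x)).
- exact: (measurableT_comp mh (measurable_pair1 x)).
by move=> y Jy; apply: gh.
Qed.

Variables d1 d2 : nat.
Local Notation E := ('rV[R]_d1 * 'rV[R]_d2)%type.

(** A bound by a function of the second variable retains the gain when the support fills only a
    small fraction of a large cube I2, which a supremum would lose. *)
Lemma ddosc_le_fun (I1 : cube R d1) (I2 : cube R d2) (f : E -> R)
    (chi : 'rV[R]_d2 -> R) :
  measurable_fun setT f -> measurable_fun setT chi -> (forall x, 0 <= chi x)%R ->
  (forall x1 y1 x2 y2, cube_set I1 x1 -> cube_set I1 y1 ->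
     cube_set I2 x2 -> cube_set I2 y2 ->
     `|ddiff f (x1, y1) (x2, y2)| <= chi x2 + chi y2)%R ->
  ddosc (unif I1) (unif I2) f <= 2%:E * \int[unif I2]_x (chi x)%:E.
Proof.
move=> mf mchi chi0 H.
have mE : measurable_fun setT (EFin \o chi) by exact/measurable_EFinP.
have mc1 : measurable_fun setT (fun q : 'rV[R]_d2 * 'rV[R]_d2 => (chi q.1)%:E).
  exact: (measurableT_comp mE measurable_fst).
have mc2 : measurable_fun setT (fun q : 'rV[R]_d2 * 'rV[R]_d2 => (chi q.2)%:E).
  exact: (measurableT_comp mE measurable_snd).
have inner p : rect I1 I1 p ->
    \int[pprod (unif I2) (unif I2)]_q `|ddiff f p q|%:E <=
    2%:E * \int[unif I2]_x (chi x)%:E.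
  move=> [p1 p2].
  apply: (@le_trans _ _ (\int[pprod (unif I2) (unif I2)]_q ((chi q.1)%:E + (chi q.2)%:E))).
    apply: le_integral_rect => //.
    - exact: measurable_ddiff_p.
    - exact: emeasurable_funD.
    - by move=> q; rewrite adde_ge0// lee_fin.
    - by move=> [q1 q2] [? ?]; case: p p1 p2 => p1 p2 /= ? ?; rewrite -EFinD lee_fin H.
  rewrite ge0_integralD//; try by move=> q _; rewrite lee_fin.
  rewrite (integral_pprod_fst _ _ mE)//.
  rewrite (integral_pprod_snd _ _ mE)//.
  rewrite (_ : 2 = 1 + 1)%R// EFinD ge0_muleDl ?mul1e//.
apply: (@le_trans _ _ (\int[pprod (unif I1) (unif I1)]_p
    (2%:E * \int[unif I2]_x (chi x)%:E))).
  apply: le_integral_rect => //.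
  - exact: measurable_ddosc_in.
  - by move=> p; exact: integral_ge0.
  - by move=> p; rewrite mule_ge0//; apply: integral_ge0 => x _; rewrite lee_fin.
by rewrite (integral_prob_cst (pprod (unif I1) (unif I1))).
Qed.

Lemma ddosc_le_cst (I1 : cube R d1) (I2 : cube R d2) (f : E -> R) (c : R) :
  measurable_fun setT f -> (0 <= c)%R ->
  (forall x1 y1 x2 y2, cube_set I1 x1 -> cube_set I1 y1 ->
     cube_set I2 x2 -> cube_set I2 y2 ->
     `|ddiff f (x1, y1) (x2, y2)| <= c)%R ->
  ddosc (unif I1) (unif I2) f <= c%:E.
Proof.
move=> mf c0 H.
apply: (@le_trans _ _ (2%:E * \int[unif I2]_x (c / 2)%:E)).
  apply: ddosc_le_fun => // [_|x1 y1 x2 y2 *]; first by rewrite divr_ge0.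
  by rewrite -splitr H.
by rewrite (integral_unif_cst I2) -EFinM lee_fin; lra.
Qed.

Lemma integral_unif_ball n (I : cube R n) (S : R) : (0 < S)%R ->
  \int[unif I]_x ((\1_[set x : 'rV[R]_n | `|x| < S]%R x)%:E : \bar R) <=
  ((2 * S / side I) ^+ n)%:E.
Proof.
move=> S0.
have mB : measurable [set x : 'rV[R]_n | (`|x| < S)%R].
  have := @measurable_rV_ball R n 0 S S0.
  by under eq_set do rewrite subr0.
have S20 : (0 < 2 * S)%R by rewrite mulr_gt0.
pose Q := @Cube R n (const_mx (- S)%R) _ S20.
rewrite integral_unif; last 2 first.
- by apply/measurable_EFinP; exact: measurable_indic.
- by move=> x; rewrite lee_fin indicE.
rewrite integral_indic//; last exact: measurable_cube.
have [mQ lQ] := lebesgue_cube Q.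
rewrite expr_div_n mulrC EFinM; apply: lee_wpmul2l.
  by rewrite lee_fin side_expV_ge0.
rewrite -lQ; apply: le_measure; rewrite ?inE//.
  by apply: measurableI => //; exact: measurable_cube.
move=> x [/(rV_norm_lt _ S0) xS _] i; have := xS i.
rewrite /= !mxE ltr_norml => /andP[? ?]; apply/andP; split; lra.
Qed.

End pointwise_to_integral.

(** * Vanishing oscillation of compactly supported Lipschitz functions *)

Section vanishing_lipschitz.
Context {R : realType}.

Lemma powR_large (a c : R) : 0 < a ->
  exists2 T, 0 < T & forall t, T <= t -> c <= t `^ a.
Proof.
move=> a0; exists ((`|c| + 1) `^ a^-1).
  by rewrite powR_gt0// ltr_wpDl.
move=> t Tt; have c0 : 0 <= `|c| + 1 by rewrite addr_ge0.
apply: (@le_trans _ _ (`|c| + 1)); first by rewrite (le_trans (ler_norm c))// lerDl.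
have -> : `|c| + 1 = ((`|c| + 1) `^ a^-1) `^ a.
  by rewrite -powRrM mulVf ?gt_eqF// powRr1.
by apply: ge0_ler_powR => //; rewrite ?ltW// nnegrE ?powR_ge0// (le_trans _ Tt)// powR_ge0.
Qed.

Lemma powR_le (a x y : R) : 0 <= a -> 0 <= x -> x <= y -> x `^ a <= y `^ a.
Proof.
by move=> a0 x0 xy; apply: ge0_ler_powR; rewrite ?nnegrE//; exact: le_trans xy.
Qed.

Lemma powR_split (x a : R) : 0 < x -> x = x `^ a * x `^ (1 - a).
Proof.
move=> x0; rewrite -powRD ?(gt_eqF x0) ?implybT//.
by rewrite addrC subrK powRr1// ltW.
Qed.

Lemma powR_small (a x T : R) : 0 <= a -> 0 < x -> x <= T^-1 -> 0 < T ->
  x `^ a * T `^ a <= 1.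
Proof.
move=> a0 x0 xT T0; rewrite -powRM; [|exact: ltW|exact: ltW].
have e1 : 1 `^ a = 1 :> R by rewrite powR1.
rewrite -[leRHS]e1; apply: ge0_ler_powR => //.
- by rewrite nnegrE mulr_ge0// ltW.
- by rewrite nnegrE.
- by rewrite -ler_pdivlMr// div1r.
Qed.

Variables (d1 d2 : nat) (alpha : R).
Hypotheses (d2_gt0 : (0 < d2)%N) (alpha01 : 0 < alpha < 1).
Local Notation E := ('rV[R]_d1 * 'rV[R]_d2)%type.

Lemma lipschitz_continuous (f : E -> R) L :
  (forall p q, `|f p - f q| <= L * `|p - q|) -> continuous f.
Proof.
move=> fL p; apply/cvgrPdist_lt => e e0.
have L1 : 0 < `|L| + 1 by rewrite ltr_wpDl.
near=> q; apply: le_lt_trans (fL p q) _.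
apply: (@le_lt_trans _ _ ((`|L| + 1) * `|p - q|)).
  by rewrite ler_wpM2r// (le_trans (ler_norm L))// lerDl.
rewrite mulrC -ltr_pdivlMr//.
near: q; apply: (@cvgr_dist_lt _ _ _ (nbhs p) _ id) => //.
by rewrite divr_gt0.
Unshelve. all: by end_near. Qed.

Lemma continuous_loc_integrable (f : E -> R) : continuous f -> loc_integrable f.
Proof.
move=> cf; split; first exact: continuous_measurable_prod.
move=> K cK.
have mK := compact_measurable_prod cK.
have [M [_ HM]] := compact_bounded cK.
have N0 : 0 < 2 * (`|M| + 1) by rewrite mulr_gt0// ltr_wpDl.
have KN p : K p -> `|p| <= `|M| + 1.
  by apply: HM; have := ler_norm M; lra.
pose I1 := @Cube R d1 (const_mx (- (`|M| + 1))) _ N0.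
pose I2 := @Cube R d2 (const_mx (- (`|M| + 1))) _ N0.
have KR : K `<=` rect I1 I2.
  move=> p /KN; rewrite prod_normE ge_max => /andP[h1 h2].
  have N1 : 0 <= `|M| + 1 by rewrite addr_ge0.
  move: h1 => /(rV_norm_le _ N1) h1; move: h2 => /(rV_norm_le _ N1) h2.
  split=> i; rewrite /= !mxE; [have := h1 i|have := h2 i]; rewrite ler_norml;
    by move=> /andP[? ?]; apply/andP; split; lra.
apply: measurable_bounded_integrable => //.
- apply: (@le_lt_trans _ _ (lebesgue_prod d1 d2 (rect I1 I2))).
    by apply: le_measure; rewrite ?inE//; exact: measurable_rect.
  by rewrite lebesgue_rect ltry.
- by apply: measurable_funTS; exact: continuous_measurable_prod.
have /compact_bounded[B [Br HB]] : compact (f @` K).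
  by apply: continuous_compact cK; exact: continuous_subspaceT.
by exists B; split=> // x Bx y Ky; apply: HB => //; exists y.
Qed.

(** Each regime has its own reason. Short sides: a Lipschitz bound gains a power 1 - alpha. Long I1:
    the factor [side I1] to the alpha outgrows the sup bound. Long I2: the support occupies a small
    fraction of I2. Otherwise the rectangle is far and of moderate size, and misses the support. *)
Lemma compact_lipschitz_vanishing (phi : E -> R) L M S :
  0 < L -> 0 < M -> 0 < S -> compact_lipschitz phi L M S ->
  vanishing alpha phi.
Proof.
move=> L0 M0 S0 [phiL phiM phiS] e e0; have [a0 a1] := andP alpha01.
have b0 : 0 < 1 - alpha by rewrite subr_gt0.
have mphi : measurable_fun setT phi.
  by apply: continuous_measurable_prod; exact: lipschitz_continuous phiL.
pose C := L + 2 * M.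
have C0 : 0 < C by rewrite addr_gt0// mulr_gt0.
have [T1 T10 HT1] := @powR_large (1 - alpha) (2 * L / e) b0.
have [T2 T20 HT2] := @powR_large alpha (4 * M / e) a0.
(* One term per regime: T1 for short sides, 4 T2 and 16 C S / e for a side of length at least T / 4,
   and 8 S for rectangles off the support. *)
pose T := T1 + 4 * T2 + 8 * S + 16 * C * S / e.
have CS0 : 0 < C * S / e by rewrite divr_gt0// mulr_gt0.
have TT : T = T1 + 4 * T2 + 8 * S + 16 * (C * S / e) by rewrite /T; ring.
have T0 : 0 < T by lra.
exists T => // I1 I2 deg; rewrite /osc_bound.
have l10 := side_gt0 I1; have l20 := side_gt0 I2.
have la := powR_gt0 alpha l10.
have ddL1 x1 y1 x2 y2 : cube_set I1 x1 -> cube_set I1 y1 ->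
    `|ddiff phi (x1, y1) (x2, y2)| <= 2 * L * side I1.
  move=> Ix Iy; rewrite /ddiff/=.
  have D z : `|phi (x1, z) - phi (y1, z)| <= L * side I1.
    apply: le_trans (phiL _ _) _; rewrite ler_pM2l// prod_normE/= subrr normr0.
    by rewrite ge_max (cube_diam Ix Iy) ltW.
  have := D x2; have := D y2; rewrite !ler_norml; lra.
have ddL2 x1 y1 x2 y2 : cube_set I2 x2 -> cube_set I2 y2 ->
    `|ddiff phi (x1, y1) (x2, y2)| <= 2 * L * side I2.
  move=> Ix Iy; rewrite /ddiff/=.
  have D z : `|phi (z, x2) - phi (z, y2)| <= L * side I2.
    apply: le_trans (phiL _ _) _; rewrite ler_pM2l// prod_normE/= subrr normr0.
    by rewrite ge_max (cube_diam Ix Iy) ltW.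
  have := D x1; have := D y1; rewrite !ler_norml; lra.
have TL : 2 * L <= e * T `^ (1 - alpha).
  by rewrite -ler_pdivrMl// mulrC; apply: HT1; lra.
have small t : 0 < t -> t < T^-1 -> 2 * L * t `^ (1 - alpha) <= e.
  move=> t0 tT; have := powR_small (ltW b0) t0 (ltW tT) T0.
  have := powR_ge0 t (1 - alpha); nra.
case: deg => [lT|lT|[p Rp pT]].
- apply: ddosc_le_cst => //; first by rewrite mulr_ge0// ltW.
  move=> x1 y1 x2 y2 ? ? ? ?; apply: le_trans (ddL1 _ _ _ _ _ _) _ => //.
  rewrite {1}(powR_split alpha l10) mulrCA mulrC ler_pM2r//.
  exact: small.
- apply: ddosc_le_cst => //; first by rewrite mulr_ge0// ltW.
  move=> x1 y1 x2 y2 ? ? ? ?.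
  (* The double difference is at most 2 L min(l1, l2), and min(l1, l2) <= l1^alpha l2^(1 - alpha):
     the factor l1^alpha is available although only l2 is known to be small. *)
  have key : `|ddiff phi (x1, y1) (x2, y2)| <=
      2 * L * (side I1 `^ alpha * side I2 `^ (1 - alpha)).
    have [l12|l21] := leP (side I1) (side I2).
      apply: le_trans (ddL1 _ _ _ _ _ _) _ => //.
      rewrite ler_pM2l ?mulr_gt0// {1}(powR_split alpha l10) ler_pM2l//.
      by apply: powR_le => //; exact: ltW.
    apply: le_trans (ddL2 _ _ _ _ _ _) _ => //.
    rewrite ler_pM2l ?mulr_gt0// {1}(powR_split alpha l20).
    rewrite ler_pM2r ?powR_gt0//.
    by apply: powR_le; exact: ltW.
  apply: le_trans key _; rewrite mulrCA mulrC ler_pM2r//.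
  exact: small.
have [l1T|l1T] := leP (T / 4) (side I1).
  apply: ddosc_le_cst => //; first by rewrite mulr_ge0// ltW.
  move=> x1 y1 x2 y2 _ _ _ _.
  apply: (@le_trans _ _ (4 * M)).
    rewrite /ddiff/=; have := phiM (x1, x2); have := phiM (x1, y2).
    have := phiM (y1, x2); have := phiM (y1, y2); rewrite !ler_norml; lra.
  rewrite -ler_pdivrMl// mulrC; apply: HT2; lra.
have [l2T|l2T] := leP (T / 4) (side I2).
  pose chi (x : 'rV[R]_d2) : R := C * side I1 `^ alpha * \1_[set x | `|x| < S] x.
  have Ca0 : 0 <= C * side I1 `^ alpha by rewrite mulr_ge0 ?ltW.
  have mind : measurable_fun setT (\1_[set x : 'rV[R]_d2 | `|x| < S] : _ -> R).
    apply: measurable_indic; have := @measurable_rV_ball R d2 0 S S0.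
    by under eq_set do rewrite subr0.
  apply: (@le_trans _ _ (2%:E * \int[unif I2]_x (chi x)%:E)%E).
    apply: ddosc_le_fun => //.
    - by apply: measurable_funM.
    - by move=> x; rewrite mulr_ge0// indicE.
    move=> x1 y1 x2 y2 Ix1 Iy1 _ _.
    have D z : `|phi (x1, z) - phi (y1, z)| <= chi z.
      rewrite /chi indicE; have [zS|zS] := boolP (z \in _); last first.
        move: zS; rewrite notin_setE/= => /negP; rewrite -leNgt => zS.
        by rewrite !phiS ?subrr ?normr0 ?mulr0// prod_normE le_max zS orbT.
      rewrite mulr1 /C; have [l11|l11] := leP (side I1) 1.
        apply: (@le_trans _ _ (L * side I1)).
          apply: le_trans (phiL _ _) _; rewrite ler_pM2l// prod_normE/= subrr normr0.
          by rewrite ge_max (cube_diam Ix1 Iy1) ltW.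
        have s1 : side I1 <= side I1 `^ alpha.
          by apply: ger1_powR; rewrite ?l10 ?l11// ltW.
        by apply: ler_pM => //; rewrite ?ltW//; lra.
      have s1 : 1 <= side I1 `^ alpha.
        by rewrite -(powRr0 (side I1)) ler_powR// ltW.
      apply: (@le_trans _ _ (2 * M)).
        by have := phiM (x1, z); have := phiM (y1, z); rewrite !ler_norml; lra.
      nra.
    rewrite /ddiff/=; have := D x2; have := D y2; rewrite !ler_norml; lra.
  have -> : (\int[unif I2]_x (chi x)%:E = (C * side I1 `^ alpha)%:E *
      \int[unif I2]_x (\1_[set x | `|x| < S] x)%:E)%E.
    rewrite -ge0_integralZl_EFin//.
    by apply/measurable_EFinP; exact: mind.
  rewrite muleA -EFinM.
  apply: (@le_trans _ _ ((2 * (C * side I1 `^ alpha))%:E * ((2 * S / side I2) ^+ d2)%:E)%E).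
    by apply: lee_wpmul2l; [rewrite lee_fin mulr_ge0|exact: integral_unif_ball].
  rewrite -EFinM lee_fin.
  have r0 : 0 <= 2 * S / side I2 by rewrite divr_ge0 ?mulr_ge0 ?ltW.
  have r1 : 2 * S / side I2 <= 1 by rewrite ler_pdivrMr//; lra.
  have rd : (2 * S / side I2) ^+ d2 <= 2 * S / side I2.
    by rewrite -[leRHS]expr1; apply: ler_wiXn2l.
  have rC : 2 * C * (2 * S / side I2) <= e.
    have -> : 2 * C * (2 * S / side I2) = 4 * (C * S) / side I2 by field; rewrite gt_eqF.
    rewrite ler_pdivrMr//.
    have -> : 4 * (C * S) = e * (4 * (C * S / e)) by field; rewrite gt_eqF.
    rewrite ler_pM2l//; lra.
  apply: (@le_trans _ _ (side I1 `^ alpha * (2 * C * (2 * S / side I2)))).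
    have -> : side I1 `^ alpha * (2 * C * (2 * S / side I2)) =
      2 * (C * side I1 `^ alpha) * (2 * S / side I2) by ring.
    by rewrite ler_wpM2l// mulr_ge0.
  by rewrite mulrC ler_pM2r.
apply: (@le_trans _ _ 0%E); last by rewrite lee_fin mulr_ge0// ltW.
apply: ddosc_le_cst => //.
have z q : rect I1 I2 q -> phi q = 0.
  move=> Rq; apply: phiS; have := rect_dist Rp Rq.
  have : Num.max (side I1) (side I2) <= T / 4 by rewrite ge_max !ltW.
  have := ler_normD (p - q) q; rewrite subrK => h1 h2 h3.
  have : `|p - q| <= T / 4 by exact: le_trans h3 h2.
  move: (le_trans pT h1); lra.
by move=> x1 y1 x2 y2 ? ? ? ?; rewrite /ddiff/= !z// !subrr add0r normr0.
Qed.

End vanishing_lipschitz.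

(** * Translations and differences of translates *)

Section translation.
Context {R : realType}.
Local Open Scope ereal_scope.

Lemma measurable_funDV d (T : measurableType d) n (f g : T -> 'rV[R]_n) :
  measurable_fun setT f -> measurable_fun setT g ->
  measurable_fun setT (fun x => f x + g x)%R.
Proof.
move=> mf mg; apply: measurable_fun_rVP => i; under eq_fun do rewrite mxE.
apply: measurable_funD.
  exact: (measurableT_comp (measurable_rV_coord i) mf).
exact: (measurableT_comp (measurable_rV_coord i) mg).
Qed.

Lemma measurable_addr_prod n m (z : 'rV[R]_n * 'rV[R]_m) :
  measurable_fun setT (fun x : 'rV[R]_n * 'rV[R]_m => (x.1 + z.1, x.2 + z.2)%R).
Proof.
by apply/measurable_fun_pair => /=; apply: measurable_funDV.
Qed.

Lemma integral_pprod_shift n m (I : cube R n) (J : cube R m)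
    (z : 'rV[R]_n) (w : 'rV[R]_m) (g : 'rV[R]_n * 'rV[R]_m -> \bar R) :
  measurable_fun setT g -> (forall x, 0 <= g x) ->
  \int[pprod (unif (shift_cube z I)) (unif (shift_cube w J))]_x g x =
  \int[pprod (unif I) (unif J)]_x g (x.1 + z, x.2 + w)%R.
Proof.
move=> mg g0.
have mgz : measurable_fun setT (fun x : 'rV[R]_n * 'rV[R]_m => g (x.1 + z, x.2 + w)%R).
  exact: (measurableT_comp mg (measurable_addr_prod (z, w))).
have mgx x : measurable_fun setT (fun y => g (x, y)).
  exact: (measurableT_comp mg (measurable_pair1 x)).
rewrite (pprod_tonelli1 _ _ mg g0).
rewrite (pprod_tonelli1 (unif I) (unif J) mgz (fun=> g0 _)) integral_unif_shift.
- by apply: eq_integral => x _; rewrite integral_unif_shift.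
- exact: (@measurable_pprod1 _ _ _ _ R (unif (shift_cube w J)) g).
- by move=> x; exact: integral_ge0.
Qed.

Variables d1 d2 : nat.
Local Notation E := ('rV[R]_d1 * 'rV[R]_d2)%type.

Definition translate (z : E) (f : E -> R) : E -> R := fun x => f (x + z)%R.

Lemma measurable_translate z f : measurable_fun setT f ->
  measurable_fun setT (translate z f).
Proof. by move=> mf; apply: (measurableT_comp mf); exact: measurable_addr_prod. Qed.

Lemma ddosc_translate z f (I1 : cube R d1) (I2 : cube R d2) :
  measurable_fun setT f ->
  ddosc (unif I1) (unif I2) (translate z f) =
  ddosc (unif (shift_cube z.1 I1)) (unif (shift_cube z.2 I2)) f.
Proof.
move=> mf.
pose g p := \int[pprod (unif (shift_cube z.2 I2)) (unif (shift_cube z.2 I2))]_q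
  `|ddiff f p q|%:E.
have -> : ddosc (unif (shift_cube z.1 I1)) (unif (shift_cube z.2 I2)) f =
    \int[pprod (unif (shift_cube z.1 I1)) (unif (shift_cube z.1 I1))]_p g p by [].
rewrite (@integral_pprod_shift _ _ I1 I1 z.1 z.1 g); last 2 first.
- exact: measurable_ddosc_in.
- by move=> p; exact: integral_ge0.
apply: eq_integral => p _.
rewrite /g (@integral_pprod_shift _ _ I2 I2 z.2 z.2
  (fun q => `|ddiff f (p.1 + z.1, p.2 + z.1)%R q|%:E))//.
exact: measurable_ddiff_p.
Qed.

End translation.

Section diagonal_shift.
Context {R : realType} {n : nat}.
Local Open Scope ereal_scope.

(** Halving a cube repeatedly brings its side into [delta, 2 delta), and [integral_unif_half] passes
    the bound back up. *)
Lemma integral_unif_covering (g : 'rV[R]_n -> \bar R) (delta : R) (M : \bar R) :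
  (0 < delta)%R -> measurable_fun setT g -> (forall x, 0 <= g x) ->
  (forall J : cube R n, (delta <= side J < 2 * delta)%R -> \int[unif J]_x g x <= M) ->
  forall I : cube R n, (delta <= side I)%R -> \int[unif I]_x g x <= M.
Proof.
move=> delta0 mg g0 H I dI.
have [k kI] : exists k, (side I < 2 ^+ k.+1 * delta)%R.
  have [k hk] : exists k : nat, (side I / delta < k%:R)%R.
    by exists (Num.bound (side I / delta)); apply: archi_boundP; rewrite divr_ge0// ltW// side_gt0.
  exists k; rewrite -ltr_pdivrMr//; apply: (lt_le_trans hk).
  by rewrite -natrX ler_nat ltnW// (leq_trans (ltn_expl k (isT : (1 < 2)%N)))// leq_exp2l.
elim: k I dI kI => [|k IH] I dI kI; first by apply: H; rewrite dI -[2%R]expr1.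
have [lI|lI] := ltP (side I) (2 * delta)%R; first by apply: H; rewrite dI.
apply: integral_unif_half => // b; apply: IH => /=; first lra.
by rewrite ltr_pdivrMr// mulrAC -exprSr.
Qed.

(* The diagonal is reached by averaging the triangle inequality
   r(x, x + z) <= r(x, w) + r(w, x + z) over w in a cube containing both points. *)
Lemma integral_unif_diagonal (r : 'rV[R]_n * 'rV[R]_n -> \bar R) (delta : R)
    (kappa : \bar R) (z : 'rV[R]_n) :
  (0 < delta)%R -> measurable_fun setT r -> (forall x, 0 <= r x) ->
  (forall x y w, r (x, y) <= r (x, w) + r (w, y)) ->
  (forall i, 0 <= z ord0 i <= delta)%R ->
  (forall K : cube R n, side K = (3 * delta)%R ->
    \int[pprod (unif K) (unif K)]_x r x <= kappa) ->
  forall I : cube R n, (delta <= side I)%R ->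
    \int[unif I]_x r (x, x + z)%R <= (2 * 3 ^+ n)%:E * kappa.
Proof.
move=> delta0 mr r0 rT zd H.
have mrz : measurable_fun setT (fun x : 'rV[R]_n => r (x, x + z)%R).
  apply: (measurableT_comp mr); apply/measurable_fun_pair => //=.
  exact: measurable_addrV.
have mrx x : measurable_fun setT (fun y => r (x, y)).
  exact: (measurableT_comp mr (measurable_pair1 x)).
have mry y : measurable_fun setT (fun x => r (x, y)).
  exact: (measurableT_comp mr (measurable_pair2 y)).
apply: (integral_unif_covering delta0 mrz) => // J /andP[dJ Jd].
have l0 := side_gt0 J.
(* The side of J is below 2 delta and the shift is at most delta, so a side of 3 delta accommodates
   J and its translate. *)
pose K := @Cube R n (corner J) (3 * delta)%R ltac:(by rewrite mulr_gt0).
have JK : cube_set J `<=` cube_set K.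
  move=> x xJ i; have /andP[? ?] := xJ i; rewrite /=; apply/andP; split; lra.
have JzK : cube_set (shift_cube z J) `<=` cube_set K.
  move=> x xJ i; have := xJ i; have := zd i; rewrite /= !mxE.
  by move=> /andP[? ?] /andP[? ?]; apply/andP; split; lra.
have k0 : 0 <= kappa by apply: le_trans (H K erefl); exact: integral_ge0.
have ratio : ((3 * delta / side J) ^+ n <= 3 ^+ n)%R.
  have r3 : (3 * delta / side J <= 3)%R by rewrite ler_pdivrMr// ler_pM2l.
  by apply: lerXn2r => //; rewrite nnegrE ?divr_ge0 ?mulr_ge0// ?(ltW l0) ?(ltW delta0).
pose gl x := \int[unif K]_w r (x, w).
pose gr y := \int[unif K]_w r (w, y).
have mgl : measurable_fun setT gl by exact: (@measurable_pprod1 _ _ _ _ R (unif K) r).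
have mgr : measurable_fun setT gr by exact: (@measurable_pprod2 _ _ _ _ R (unif K) r).
have gl0 x : 0 <= gl x by exact: integral_ge0.
have gr0 x : 0 <= gr x by exact: integral_ge0.
have sub (Q : cube R n) g : side Q = side J -> cube_set Q `<=` cube_set K ->
    measurable_fun setT g -> (forall x, 0 <= g x) ->
    \int[unif K]_x g x <= kappa -> \int[unif Q]_x g x <= (3 ^+ n)%:E * kappa.
  move=> sQ QK mg g0 gk; apply: (le_trans (integral_unif_sub mg g0 QK)).
  rewrite sQ; apply: lee_pmul => //; first by rewrite lee_fin exprn_ge0// divr_ge0 ?mulr_ge0 ?ltW.
  exact: integral_ge0.
apply: (@le_trans _ _ (\int[unif J]_x (gl x + gr (x + z)%R))).
  apply: ge0_le_integral => //.
    apply: emeasurable_funD => //; apply: (measurableT_comp mgr).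
    exact: measurable_addrV.
  move=> x _.
  rewrite -[leLHS](integral_unif_cst K) /gl /gr -ge0_integralD//.
  apply: ge0_le_integral => //.
  exact: emeasurable_funD.
rewrite ge0_integralD//; last by apply: (measurableT_comp mgr); exact: measurable_addrV.
rewrite -integral_unif_shift//.
have -> : ((2 * 3 ^+ n)%:E * kappa = (3 ^+ n)%:E * kappa + (3 ^+ n)%:E * kappa :> \bar R).
  rewrite -ge0_muleDl ?lee_fin ?exprn_ge0// -EFinD; congr (_%:E * _).
  by rewrite mulrDl mul1r.
apply: leeD; apply: sub => //.
- by rewrite -(pprod_tonelli1 (unif K) (unif K) mr r0) H.
- by rewrite -(pprod_tonelli2 (unif K) (unif K) mr r0) H.
Qed.

End diagonal_shift.

Section translation_difference.
Context {R : realType}.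
Local Open Scope ereal_scope.

(** The double difference of f - f(. + z) in the pair (x, y) is the difference of those of f in the
    pairs (x, x + z) and (y, y + z). Only pairs close to the diagonal occur, so a large I1 is
    controlled by cubes of side 3 delta, with the same I2. *)
Lemma ddosc_translate1 n m (f : 'rV[R]_n * 'rV[R]_m -> R) (I1 : cube R n)
    (I2 : cube R m) (z : 'rV[R]_n) (delta : R) (kappa : \bar R) :
  (0 < delta)%R -> measurable_fun setT f ->
  (forall i, 0 <= z ord0 i <= delta)%R ->
  (forall K : cube R n, side K = (3 * delta)%R ->
    ddosc (unif K) (unif I2) f <= kappa) ->
  (delta <= side I1)%R ->
  ddosc (unif I1) (unif I2) (f \- translate (z, 0%R) f)%R <=
    (4 * 3 ^+ n)%:E * kappa.
Proof.
move=> delta0 mf zd H dI.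
pose r (p : 'rV[R]_n * 'rV[R]_n) := \int[pprod (unif I2) (unif I2)]_q `|ddiff f p q|%:E.
have mr : measurable_fun setT r by exact: measurable_ddosc_in.
have r0 p : 0 <= r p by exact: integral_ge0.
have mdp p : measurable_fun setT (fun q => `|ddiff f p q|%:E) by exact: measurable_ddiff_p.
have rT x y w : r (x, y) <= r (x, w) + r (w, y).
  rewrite /r -ge0_integralD//; apply: ge0_le_integral => //.
    exact: emeasurable_funD.
  move=> q _; rewrite -EFinD lee_fin; apply: le_trans (ler_normD _ _).
  by rewrite /ddiff/= le_eqVlt; apply/orP; left; apply/eqP; congr `|_|%R; ring.
have Hz := integral_unif_diagonal delta0 mr r0 rT zd H dI.
have mft : measurable_fun setT (f \- translate (z, 0%R) f)%R.
  by apply: measurable_funB => //; exact: measurable_translate.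
pose g (x : 'rV[R]_n) := r (x, x + z)%R.
have mg : measurable_fun setT g.
  apply: (measurableT_comp mr); apply/measurable_fun_pair => //=.
  exact: measurable_addrV.
have mg1 : measurable_fun setT (fun p : 'rV[R]_n * 'rV[R]_n => g p.1).
  exact: (measurableT_comp mg measurable_fst).
have mg2 : measurable_fun setT (fun p : 'rV[R]_n * 'rV[R]_n => g p.2).
  exact: (measurableT_comp mg measurable_snd).
apply: (@le_trans _ _ (\int[pprod (unif I1) (unif I1)]_p (g p.1 + g p.2))).
  apply: ge0_le_integral => //.
  - by move=> p _; exact: integral_ge0.
  - exact: measurable_ddosc_in.
  - exact: emeasurable_funD.
  move=> [x y] _; rewrite /g /r -ge0_integralD//; apply: ge0_le_integral => //.
  - exact: measurable_ddiff_p.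
  - exact: emeasurable_funD.
  move=> [q1 q2] _; rewrite -EFinD lee_fin; apply: le_trans (ler_normB _ _).
  rewrite le_eqVlt; apply/orP; left; apply/eqP; congr `|_|%R.
  rewrite /ddiff/= /translate.
  have E a b : ((a, b) + (z, 0) = (a + z, b) :> 'rV[R]_n * 'rV[R]_m)%R.
    by rewrite -[in RHS](addr0 b).
  by rewrite !E; ring.
rewrite ge0_integralD//; try by move=> p _; exact: r0.
rewrite (integral_pprod_fst (unif I1) (unif I1) mg (fun=> r0 _)).
rewrite (integral_pprod_snd (unif I1) (unif I1) mg (fun=> r0 _)).
have -> : ((4 * 3 ^+ n)%:E * kappa =
    (2 * 3 ^+ n)%:E * kappa + (2 * 3 ^+ n)%:E * kappa :> \bar R).
  have k0 : 0 <= kappa.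
    have := H (@Cube R n 0%R (3 * delta)%R ltac:(by rewrite mulr_gt0)) erefl.
    by apply: le_trans; exact: ddosc_ge0.
  rewrite -ge0_muleDl ?lee_fin ?mulr_ge0 ?exprn_ge0// -EFinD; congr (_%:E * _).
  ring.
exact: leeD.
Qed.

Definition swap_arg {T1 T2 : Type} (f : T1 * T2 -> R) : T2 * T1 -> R :=
  fun x => f (x.2, x.1).

Lemma measurable_swap_arg da db (T1 : measurableType da) (T2 : measurableType db)
    (f : T1 * T2 -> R) : measurable_fun setT f -> measurable_fun setT (swap_arg f).
Proof.
by move=> mf; apply: (measurableT_comp mf); apply/measurable_fun_pair.
Qed.

Lemma ddosc_swap_arg n m (f : 'rV[R]_n * 'rV[R]_m -> R) (I1 : cube R n)
    (I2 : cube R m) : measurable_fun setT f ->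
  ddosc (unif I2) (unif I1) (swap_arg f) = ddosc (unif I1) (unif I2) f.
Proof.
move=> mf; rewrite (ddosc_swap _ _ mf) /ddosc; apply: eq_integral => q _.
apply: eq_integral => p _; congr (`|_|%:E)%R.
by rewrite /ddiff /swap_arg/=; ring.
Qed.

Variables (d1 d2 : nat) (alpha : R).
Local Notation E := ('rV[R]_d1 * 'rV[R]_d2)%type.

(** If a side is small, the triangle inequality and translation invariance give the constant 2.
    Otherwise one variable is translated at a time: with delta = (4 T)^-1 the auxiliary cubes have
    side 3 delta < T^-1 in that variable, so the hypothesis applies to them. *)
Lemma osc_bound_translate (f : E -> R) (e T : R) (z : E) :
  (0 <= alpha)%R -> (0 <= e)%R -> (0 < T)%R -> measurable_fun setT f ->
  (forall (I1 : cube R d1) (I2 : cube R d2),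
    (side I1 < T^-1 \/ side I2 < T^-1)%R -> osc_bound alpha f I1 I2 e) ->
  (forall i, 0 <= z.1 ord0 i <= (4 * T)^-1)%R ->
  (forall i, 0 <= z.2 ord0 i <= (4 * T)^-1)%R ->
  forall (I1 : cube R d1) (I2 : cube R d2),
    osc_bound alpha (f \- translate z f)%R I1 I2
      ((2 + 4 * 3 ^+ d1 + 4 * 3 ^+ d2) * e)%R.
Proof.
move=> a0 e0 T0 mf H z1 z2 I1 I2.
have T40 : (0 < (4 * T)^-1)%R by rewrite invr_gt0 mulr_gt0.
have T4 : (T^-1 = 4 * (4 * T)^-1)%R by rewrite invfM mulrA divff// mul1r.
set delta := (4 * T)^-1%R in T40 T4 z1 z2.
have la := powR_gt0 alpha (side_gt0 I1).
have c1 : (0 <= 3 ^+ d1 :> R)%R by rewrite exprn_ge0.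
have c2 : (0 <= 3 ^+ d2 :> R)%R by rewrite exprn_ge0.
have mft : measurable_fun setT (translate z f) by exact: measurable_translate.
have el : (0 <= e * side I1 `^ alpha)%R by rewrite mulr_ge0// ltW.
rewrite /osc_bound.
have neg (g : E -> R) : measurable_fun setT g ->
    ddosc (unif I1) (unif I2) (\- g)%R = ddosc (unif I1) (unif I2) g.
  move=> mg; rewrite /ddosc; apply: eq_integral => p _; apply: eq_integral => q _.
  congr (_%:E); rewrite -normrN; congr `|_|%R; rewrite /ddiff/=; ring.
have [small|large] := pselect (side I1 < T^-1 \/ side I2 < T^-1)%R.
  apply: (@le_trans _ _ (2 * (e * side I1 `^ alpha))%:E); last first.
    by rewrite lee_fin -mulrA; apply: ler_wpM2r => //; lra.
  apply: (le_trans (ddoscD _ _ mf (_ : measurable_fun setT (\- translate z f)%R))).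
    exact: measurableT_comp.
  rewrite neg// ddosc_translate// mulrDl mul1r EFinD.
  by apply: leeD; [exact: H|apply: (H (shift_cube z.1 I1) (shift_cube z.2 I2))].
have [l1 l2] : (T^-1 <= side I1 /\ T^-1 <= side I2)%R.
  by split; rewrite leNgt; apply/negP => ?; apply: large; [left|right].
pose f1 := translate (z.1, 0%R) f.
have mf1 : measurable_fun setT f1 by exact: measurable_translate.
pose f2 := translate (0%R, z.2) f1.
have mf2 : measurable_fun setT f2 by exact: measurable_translate.
have tE : translate z f = f2.
  apply/funext => -[a b]; rewrite /f2 /f1 /translate; congr f.
  case: z {z1 z2 mft f1 mf1 f2 mf2} => z1 z2 /=.
  by change ((a + z1, b + z2) = (a + 0 + z1, b + z2 + 0))%R; rewrite !addr0.
have -> : (f \- translate z f = (f \- f1) \+ (f1 \- f2))%R.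
  by rewrite tE; apply/funext => x /=; ring.
apply: (@le_trans _ _ ((4 * 3 ^+ d1)%:E * (e * side I1 `^ alpha)%:E +
    (4 * 3 ^+ d2)%:E * (e * side I1 `^ alpha)%:E)); last first.
  by rewrite -!EFinM -EFinD lee_fin -mulrDl -mulrA; apply: ler_wpM2r => //; lra.
apply: le_trans (ddoscD _ _ _ _) _.
- exact: measurable_funB.
- exact: measurable_funB.
apply: leeD.
  apply: (ddosc_translate1 T40) => //; last lra.
  move=> K sK; apply: le_trans (H K I2 _) _; first by left; lra.
  by rewrite lee_fin ler_wpM2l// powR_le// sK; lra.
rewrite -ddosc_swap_arg; last exact: measurable_funB.
have -> : swap_arg (f1 \- f2)%R =
    (swap_arg f1 \- translate (z.2, 0%R) (swap_arg f1))%R by [].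
apply: (ddosc_translate1 T40) => //; last lra.
  exact: measurable_swap_arg.
move=> K sK; rewrite ddosc_swap_arg// ddosc_translate//.
apply: (H (shift_cube z.1 I1) (shift_cube 0%R K)).
by right => /=; lra.
Qed.

End translation_difference.

(** * Mollification by a Lipschitz bump *)

Section locally_lipschitz.
Context {R : realType} {d1 d2 : nat}.
Local Notation E := ('rV[R]_d1 * 'rV[R]_d2)%type.

Definition locally_lipschitz (u : E -> R) : Prop :=
  forall r, exists L, forall p q, `|p| <= r -> `|q| <= r ->
    `|u p - u q| <= L * `|p - q|.

Lemma locally_lipschitz_continuous u : locally_lipschitz u -> continuous u.
Proof.
move=> lu p; have [L HL] := lu (`|p| + 1).
apply/cvgrPdist_lt => e e0.
have L1 : 0 < `|L| + 1 by rewrite ltr_wpDl.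
near=> q.
have pq1 : `|p - q| < 1.
  by near: q; apply: (@cvgr_dist_lt _ _ _ (nbhs p) _ id).
have qp : `|q| <= `|p| + 1.
  have := ler_normD (q - p) p; rewrite subrK distrC => h.
  by apply: le_trans h _; rewrite addrC lerD2l ltW.
apply: le_lt_trans (HL p q _ qp) _; first by rewrite lerDl.
apply: (@le_lt_trans _ _ ((`|L| + 1) * `|p - q|)).
  by rewrite ler_wpM2r// (le_trans (ler_norm L))// lerDl.
rewrite mulrC -ltr_pdivlMr//.
near: q; apply: (@cvgr_dist_lt _ _ _ (nbhs p) _ id) => //.
by rewrite divr_gt0.
Unshelve. all: by end_near. Qed.

End locally_lipschitz.

Section tent.
Context {R : realType} {d1 d2 : nat} (delta : R) (delta0 : 0 < delta).
Local Notation E := ('rV[R]_d1 * 'rV[R]_d2)%type.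

(** Centred so that the bump lives in [0, delta] in each coordinate: only translations with
    nonnegative coordinates occur, as in [osc_bound_translate]. *)
Definition tent_center : E := (const_mx (delta / 2), const_mx (delta / 2)).

(** A Lipschitz weight is used because the unweighted average of a locally integrable function need
    not be locally Lipschitz. *)
Definition tent (z : E) : R := Num.max 0 (1 - `|z - tent_center| * (2 / delta)).

Lemma tent_ge0 z : 0 <= tent z.
Proof. by rewrite /tent le_max lexx. Qed.

Lemma tent_le1 z : tent z <= 1.
Proof. by rewrite /tent ge_max ler01/= gerBl mulr_ge0// divr_ge0// ltW. Qed.

Lemma max0_lipschitz (a b : R) : `|Num.max 0 a - Num.max 0 b| <= `|a - b|.
Proof.
have h := ler_norm (a - b); have h' := ler_norm (b - a).
have h0 := normr_ge0 (a - b); rewrite distrC in h'.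
by case: (leP 0 a) => ?; case: (leP 0 b) => ?; rewrite ler_norml; apply/andP; split; lra.
Qed.

Lemma tent_lipschitz x y : `|tent x - tent y| <= 2 / delta * `|x - y|.
Proof.
apply: (le_trans (max0_lipschitz _ _)).
have -> : 1 - `|x - tent_center| * (2 / delta) - (1 - `|y - tent_center| * (2 / delta))
    = 2 / delta * (`|y - tent_center| - `|x - tent_center|) by ring.
have d20 : 0 <= 2 / delta by rewrite divr_ge0// ltW.
rewrite normrM (ger0_norm d20) ler_wpM2l//.
apply: (le_trans (ler_dist_dist _ _)).
by rewrite opprB addrA subrK distrC.
Qed.

Lemma measurable_tent : measurable_fun setT tent.
Proof.
apply: continuous_measurable_prod; apply: (@lipschitz_continuous _ _ _ _ (2 / delta)).
exact: tent_lipschitz.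
Qed.

Definition origin_cube n : cube R n := Cube 0 delta0.

Local Notation D1 := (origin_cube d1).
Local Notation D2 := (origin_cube d2).

Lemma tent_support z : ~ rect D1 D2 z -> tent z = 0.
Proof.
move=> zD; apply/eqP; rewrite eq_le tent_ge0 andbT /tent ge_max lexx/= subr_le0.
rewrite mulrA ler_pdivlMr// mul1r leNgt; apply/negP => zlt.
apply: zD.
have d20 : 0 < delta / 2 by rewrite divr_gt0.
have : `|z - tent_center| < delta / 2 by rewrite ltr_pdivlMr.
rewrite prod_normE gt_max => /andP[/(rV_norm_lt _ d20) h1 /(rV_norm_lt _ d20) h2].
split=> i; rewrite /= !mxE add0r; [have := h1 i|have := h2 i]; rewrite !mxE ltr_norml;
  by move=> /andP[? ?]; apply/andP; split; lra.
Qed.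

Local Notation muD := (pprod (unif D1) (unif D2)).

Lemma integrable_tent : muD.-integrable setT (EFin \o tent).
Proof.
apply/integrableP; split; first by apply/measurable_EFinP; exact: measurable_tent.
apply: (@le_lt_trans _ _ 1%:E); last exact: ltry.
rewrite -[leRHS](integral_prob_cst muD); apply: ge0_le_integral => //.
  apply: measurableT_comp => //; apply/measurable_EFinP; exact: measurable_tent.
by move=> z _ /=; rewrite lee_fin ger0_norm ?tent_ge0// tent_le1.
Qed.

Definition tent_mass : R := \int[muD]_z tent z.

Lemma tent_massE : (tent_mass%:E = \int[muD]_z (tent z)%:E)%E.
Proof.
rewrite /tent_mass /Rintegral fineK//.
exact: (integrable_fin_num measurableT integrable_tent).
Qed.

Lemma tent_mass_gt0 : 0 < tent_mass.
Proof.
have d40 : 0 < delta / 2 by rewrite divr_gt0.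
(* On the concentric cubes of half the side the bump is at least 1/2; enlarging the cubes costs only
   a volume ratio. *)
pose Q n : cube R n := @Cube R n (const_mx (delta / 4)) _ d40.
have mK : measurable_fun setT (fun z => (tent z)%:E).
  by apply/measurable_EFinP; exact: measurable_tent.
have K0 z : (0 <= (tent z)%:E)%E by rewrite lee_fin tent_ge0.
have h1 : (2^-1%:E <= \int[pprod (unif (Q d1)) (unif (Q d2))]_z (tent z)%:E)%E.
  rewrite -[leLHS](integral_prob_cst (pprod (unif (Q d1)) (unif (Q d2)))).
  apply: le_integral_rect => // -[z1 z2] [z1Q z2Q].
  rewrite lee_fin /tent le_max; apply/orP; right.
  have : `|(z1, z2) - tent_center| <= delta / 4.
    have q n (z : 'rV[R]_n) : cube_set (Q n) z -> `|z - const_mx (delta / 2)| <= delta / 4.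
      move=> zQ; apply/rV_norm_le => [|i]; first by rewrite divr_ge0// ltW.
      have := zQ i; rewrite /= !mxE ler_norml => /andP[? ?]; apply/andP; split; lra.
    by rewrite prod_normE ge_max; apply/andP; split; exact: q.
  move=> h; have : `|(z1, z2) - tent_center| * (2 / delta) <= delta / 4 * (2 / delta).
    by rewrite ler_wpM2r// divr_ge0// ltW.
  have -> : delta / 4 * (2 / delta) = 2^-1 by field; rewrite gt_eqF.
  lra.
have sub n : cube_set (Q n) `<=` cube_set (origin_cube n).
  move=> x xQ i; have := xQ i; rewrite /= !mxE => /andP[? ?]; apply/andP; split; lra.
have pos (a b : R) (x : \bar R) : (a%:E <= b%:E * x)%E -> (0 < a)%R -> (0 < b)%R -> (0 < x)%E.
  move=> ax a0 b0; have : (0 < b%:E * x)%E by apply: lt_le_trans ax; rewrite lte_fin.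
  by rewrite pmule_rgt0// lte_fin.
rewrite -lte_fin tent_massE (pprod_tonelli1 _ _ mK K0).
have mi1 J : measurable_fun setT (fun x => \int[unif J]_y (tent (x, y))%:E)%E.
  exact: (@measurable_pprod1 _ _ _ _ R (unif J) (fun z => (tent z)%:E) mK K0).
have i0 J x : (0 <= \int[unif J]_y (tent (x, y))%:E)%E by exact: integral_ge0.
have mKx x : measurable_fun setT (fun y => (tent (x, y))%:E).
  exact: (measurableT_comp mK (measurable_pair1 x)).
pose c2 := ((delta / (delta / 2)) ^+ d2)%R.
have c20 : (0 < c2)%R by rewrite exprn_gt0// divr_gt0.
have h2 : (2^-1%:E <= c2%:E * \int[unif (Q d1)]_x \int[unif D2]_y (tent (x, y))%:E)%E.
  apply: (le_trans h1); rewrite (pprod_tonelli1 _ _ mK K0).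
  rewrite -ge0_integralZl//; last by rewrite lee_fin ltW.
  apply: ge0_le_integral => //.
  - by move=> x _; exact: i0.
  - exact: mi1.
  - by apply: measurable_funeM; exact: mi1.
  by move=> x _; apply: integral_unif_sub => //; exact: sub.
pose c1 := ((delta / (delta / 2)) ^+ d1)%R.
have c10 : (0 < c1)%R by rewrite exprn_gt0// divr_gt0.
apply: (pos 2^-1 (c2 * c1)%R); [|by rewrite invr_gt0|by rewrite mulr_gt0].
apply: (le_trans h2); rewrite EFinM -muleA; apply: lee_wpmul2l.
  by rewrite lee_fin ltW.
by apply: integral_unif_sub => //; exact: sub.
Qed.

End tent.

Section mollification.
Context {R : realType} {d1 d2 : nat} (delta : R) (delta0 : 0 < delta).
Local Notation E := ('rV[R]_d1 * 'rV[R]_d2)%type.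
Local Notation D1 := (origin_cube delta0 d1).
Local Notation D2 := (origin_cube delta0 d2).
Local Notation muD := (pprod (unif D1) (unif D2)).
Local Notation tent := (@tent R d1 d2 delta).
Local Notation c := (@tent_mass R d1 d2 delta delta0).

Variable f : E -> R.
Hypothesis lf : loc_integrable f.
Let mf : measurable_fun setT f := lf.1.

Definition mollify (x : E) : R :=
  c^-1 * \int[muD]_z (f (z.1 + x.1, z.2 + x.2) * tent z).

Let mK : measurable_fun setT tent := measurable_tent delta0.

Lemma integrable_mollify (x : E) :
  muD.-integrable setT (EFin \o (fun z : E => f (z.1 + x.1, z.2 + x.2) * tent z)).
Proof.
have mg : measurable_fun setT (fun z : E => f (z.1 + x.1, z.2 + x.2)).
  exact: (measurableT_comp mf (measurable_addr_prod x)).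
have /integrableP[_ fin] := loc_integrable_unif (shift_cube x.1 D1) (shift_cube x.2 D2) lf.
apply: (@le_integrable _ _ _ _ _ measurableT _ (EFin \o (fun z : E => f (z.1 + x.1, z.2 + x.2)))).
- by apply/measurable_EFinP; apply: measurable_funM.
- move=> z _ /=; rewrite lee_fin normrM ler_piMr//.
  by rewrite ger0_norm ?tent_ge0// tent_le1.
apply/integrableP; split; first exact/measurable_EFinP.
apply: le_lt_trans fin.
rewrite (@integral_pprod_shift _ _ _ D1 D2 x.1 x.2 (abse \o (EFin \o f)))//.
  by apply: measurableT_comp => //; exact/measurable_EFinP.
by move=> z; exact: abse_ge0.
Qed.

Lemma sub_mollifyE (x : E) :
  f x - mollify x = c^-1 * \int[muD]_z ((f x - translate z f x) * tent z).
Proof.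
have iK := @integrable_tent R d1 d2 delta delta0.
have c0 := @tent_mass_gt0 R d1 d2 delta delta0.
have eT : (fun z : E => (f x - translate z f x) * tent z) =
    (fun z : E => f x * tent z - f (z.1 + x.1, z.2 + x.2) * tent z).
  apply/funext => z; rewrite mulrBl /translate; congr (_ - f _ * _).
  by rewrite addrC.
rewrite eT RintegralB//; last 2 first.
- by apply: integrableZl iK.
- exact: integrable_mollify.
rewrite RintegralZl// mulrBr; congr (_ - _).
by rewrite mulrCA mulVf ?mulr1// gt_eqF.
Qed.

(** After the substitution w = z + x the point x occurs only in the kernel tent(w - x), whose
    Lipschitz bound is integrated against |f| over a fixed rectangle. *)
Lemma mollify_locally_lipschitz : locally_lipschitz mollify.
Proof.
move=> r0; have [r [r00 r0r]] : exists r, 0 <= r /\ r0 <= r.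
  by exists `|r0|; split=> //; exact: ler_norm.
have c0 := @tent_mass_gt0 R d1 d2 delta delta0.

have s0 : 0 < 2 * r + delta by rewrite ltr_wpDl// mulr_ge0.
(* One rectangle containing the support of the kernel for every |x| <= r, so that the integrals for
   two points can be subtracted. *)
pose B1 := @Cube R d1 (const_mx (- r)) _ s0; pose B2 := @Cube R d2 (const_mx (- r)) _ s0.
pose B := rect B1 B2.
have mB : measurable B by exact: measurable_rect.
pose lam := lebesgue_prod (R := R) d1 d2.
have ifB : lam.-integrable B (EFin \o f) by apply: lf.2; exact: compact_rect.
have mKx (x : E) : measurable_fun setT (fun w : E => tent (w - x)).
  have -> : (fun w : E => tent (w - x)) = translate (- x) tent by [].
  exact: measurable_translate.
have iK (x : E) : lam.-integrable B (EFin \o (fun w => f w * tent (w - x))).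
  apply: (le_integrable mB _ _ ifB).
  - by apply/measurable_EFinP; apply: measurable_funTS; apply: measurable_funM.
  - move=> z _ /=; rewrite lee_fin normrM ler_piMr//.
    by rewrite ger0_norm ?tent_ge0// tent_le1.
pose kap := c^-1 * (delta ^+ d1 * delta ^+ d2)^-1.
have kap0 : 0 <= kap.
  by rewrite mulr_ge0// invr_ge0 ?ltW// mulr_gt0// exprn_gt0.
have uE (x : E) : `|x| <= r -> mollify x = kap * \int[lam]_(w in B) (f w * tent (w - x)).
  move=> xr; rewrite /mollify -mulrA; congr (_ * _).
  pose g (w : E) := f w * tent (w - x).
  have mg : measurable_fun setT g by apply: measurable_funM.
  pose Dx := rect (shift_cube x.1 D1) (shift_cube x.2 D2).
  transitivity (\int[pprod (unif (shift_cube x.1 D1)) (unif (shift_cube x.2 D2))]_w g w).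
    rewrite /Rintegral; apply: (congr1 fine).
    rewrite integralE [RHS]integralE.
    have eg : (fun z : E => f (z.1 + x.1, z.2 + x.2) * tent z) =
        (fun z : E => g (z.1 + x.1, z.2 + x.2)).
      apply/funext => z; rewrite /g; congr (_ * tent _).
      rewrite [RHS](_ : _ = (z.1 + x.1 - x.1, z.2 + x.2 - x.2))//.
      by rewrite !addrK -surjective_pairing.
    have mEg : measurable_fun setT (EFin \o g) by exact/measurable_EFinP.
    apply: (congr2 (fun a b => a - b)%E).
      rewrite (@integral_pprod_shift _ _ _ D1 D2 x.1 x.2 (EFin \o g)^\+)%E//.
        by apply: eq_integral => z _; rewrite funepos.unlock/= -[f _ * _]/((fun z : E => f (z.1 + x.1, z.2 + x.2) * tent z) z) eg.
      exact: measurable_funepos.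
    rewrite (@integral_pprod_shift _ _ _ D1 D2 x.1 x.2 (EFin \o g)^\-)%E//.
      by apply: eq_integral => z _; rewrite funeneg.unlock/= -[f _ * _]/((fun z : E => f (z.1 + x.1, z.2 + x.2) * tent z) z) eg.
    exact: measurable_funeneg.
  rewrite -average_rect// /average lebesgue_rect/=; congr (_ * _).
  rewrite Rintegral_mkcond [RHS]Rintegral_mkcond; congr Rintegral.
  apply/funext => w; rewrite !patchE.
  have DB : Dx `<=` B.
    have xr1 : `|x.1| <= r by apply: le_trans xr; rewrite prod_normE le_max lexx.
    have xr2 : `|x.2| <= r by apply: le_trans xr; rewrite prod_normE le_max lexx orbT.
    move=> z [z1 z2]; split=> i.
      have := z1 i; have := le_trans (coord_le_norm x.1 i) xr1.
      by rewrite /= !mxE add0r ler_norml => /andP[? ?] /andP[? ?]; apply/andP; split; lra.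
    have := z2 i; have := le_trans (coord_le_norm x.2 i) xr2.
    by rewrite /= !mxE add0r ler_norml => /andP[? ?] /andP[? ?]; apply/andP; split; lra.
  have [wD|wD] := pselect (Dx w); first by rewrite !mem_set//; exact: DB.
  rewrite memNset//; case: ifP => // _.
  rewrite /g (tent_support (delta0 := delta0)) ?mulr0// => -[w1 w2]; apply: wD.
  by split; [rewrite -(shift_cubeE x.1) subrK in w1|rewrite -(shift_cubeE x.2) subrK in w2].
pose N := \int[lam]_(w in B) `|f w|.
exists (kap * (2 / delta * N)) => x y xr yr.
have hr a : a <= r0 -> a <= r by move=> ar; exact: le_trans ar r0r.
rewrite !uE ?hr// -mulrBr normrM (ger0_norm kap0) -[leRHS]mulrA ler_wpM2l//.
rewrite -RintegralB//.
have inf : lam.-integrable B (EFin \o (fun w => `|f w|)) by exact: integrable_norm.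
have iD : lam.-integrable B (EFin \o (fun w => f w * tent (w - x) - f w * tent (w - y))).
  exact: (integrableB mB (iK x) (iK y)).
apply: (le_trans (le_normr_Rintegral mB iD)).
rewrite mulrAC /N -RintegralZl//.
apply: le_Rintegral => //.
- exact: (integrable_norm iD).
- by apply: integrableZl inf.
move=> w _; rewrite -mulrBr normrM mulrC ler_wpM2r//.
apply: (le_trans (tent_lipschitz delta0 _ _)).
by rewrite opprB addrCA addrAC subrr add0r distrC.
Qed.

End mollification.

Section mollification_error.
Context {R : realType} {d1 d2 : nat} (delta : R) (delta0 : 0 < delta).
Local Notation E := ('rV[R]_d1 * 'rV[R]_d2)%type.
Local Notation D1 := (origin_cube delta0 d1).
Local Notation D2 := (origin_cube delta0 d2).
Local Notation muD := (pprod (unif D1) (unif D2)).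
Local Notation tent := (@tent R d1 d2 delta).
Local Notation c := (@tent_mass R d1 d2 delta delta0).
Variable f : E -> R.
Hypothesis lf : loc_integrable f.
Let mf : measurable_fun setT f := lf.1.
Local Notation u := (mollify delta0 f).
Local Notation P2 := (('rV[R]_d1 * 'rV[R]_d1) * ('rV[R]_d2 * 'rV[R]_d2))%type.

Let tau (z : E) := (f \- translate z f)%R.

Lemma integrable_sub_translate x :
  muD.-integrable setT (EFin \o (fun z : E => tau z x * tent z)).
Proof.
have iK := @integrable_tent R d1 d2 delta delta0.
have -> : (fun z => tau z x * tent z) =
    (fun z : E => f x * tent z - f (z.1 + x.1, z.2 + x.2) * tent z).
  apply/funext => z; rewrite mulrBl /translate; congr (_ - f _ * _).
  by rewrite addrC.
have h1 : muD.-integrable setT (EFin \o (fun z : E => f x * tent z)).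
  by apply: integrableZl iK.
exact: (integrableB measurableT h1 (integrable_mollify delta0 lf x)).
Qed.

Lemma ddiff_mollify p q :
  ddiff (f \- u) p q = c^-1 * \int[muD]_z (ddiff (tau z) p q * tent z).
Proof.
have i x := integrable_sub_translate x.
have i1 : muD.-integrable setT (EFin \o (fun z : E =>
    tau z (p.1, q.1) * tent z - tau z (p.2, q.1) * tent z)).
  exact: (integrableB measurableT (i (p.1, q.1)) (i (p.2, q.1))).
have i2 : muD.-integrable setT (EFin \o (fun z : E =>
    tau z (p.1, q.1) * tent z - tau z (p.2, q.1) * tent z - tau z (p.1, q.2) * tent z)).
  exact: (integrableB measurableT i1 (i (p.1, q.2))).
rewrite {1}/ddiff/= !sub_mollifyE// -!mulrBr -mulrDr; congr (_ * _).
rewrite -RintegralB//; [|exact: i|exact: i].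
rewrite -RintegralB//; last exact: i.
rewrite -RintegralD//; last exact: i.
by apply: eq_Rintegral => z _; rewrite /ddiff /tau/=; ring.
Qed.

Let G (w : P2 * E) : \bar R := (`|ddiff (tau w.2) w.1.1 w.1.2| * tent w.2)%:E.

Let mG : measurable_fun setT G.
Proof.
apply/measurable_EFinP; apply: measurable_funM; last first.
  exact: (measurableT_comp (measurable_tent delta0) measurable_snd).
apply: measurableT_comp => //.
have -> : (fun w : P2 * E => ddiff (tau w.2) w.1.1 w.1.2) = (fun w : P2 * E =>
    ddiff f w.1.1 w.1.2 -
    ddiff f (w.1.1.1 + w.2.1, w.1.1.2 + w.2.1) (w.1.2.1 + w.2.2, w.1.2.2 + w.2.2)).
  by apply/funext => w; rewrite /ddiff /tau /translate/=; ring.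
have md := measurable_ddiff mf.
apply: measurable_funB; first exact: (measurableT_comp md measurable_fst).
have m1 : measurable_fun setT (fun w : P2 * E => w.1.1).
  exact: (measurableT_comp measurable_fst measurable_fst).
have m2 : measurable_fun setT (fun w : P2 * E => w.1.2).
  exact: (measurableT_comp measurable_snd measurable_fst).
have z1 : measurable_fun setT (fun w : P2 * E => w.2.1).
  exact: (measurableT_comp measurable_fst measurable_snd).
have z2 : measurable_fun setT (fun w : P2 * E => w.2.2).
  exact: (measurableT_comp measurable_snd measurable_snd).
have m11 := measurableT_comp measurable_fst m1.
have m12 := measurableT_comp measurable_snd m1.
have m21 := measurableT_comp measurable_fst m2.
have m22 := measurableT_comp measurable_snd m2.
apply: (measurableT_comp md (g := fun w : P2 * E =>
  ((w.1.1.1 + w.2.1, w.1.1.2 + w.2.1), (w.1.2.1 + w.2.2, w.1.2.2 + w.2.2)))).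
by apply/measurable_fun_pair => /=; apply/measurable_fun_pair => /=;
  apply: measurable_funDV.
Qed.

Let G0 w : (0 <= G w)%E.
Proof. by rewrite lee_fin mulr_ge0// tent_ge0. Qed.

Lemma measurable_mollify : measurable_fun setT u.
Proof.
apply: continuous_measurable_prod; apply: locally_lipschitz_continuous.
exact: mollify_locally_lipschitz.
Qed.

Local Open Scope ereal_scope.

(** The double difference of f - u is the bump-weighted mean over z of those of f - f(. + z); the
    absolute value goes inside and Tonelli exchanges the integrals, so a bound uniform in z survives
    with the same constant. *)
Lemma ddosc_mollify (I1 : cube R d1) (I2 : cube R d2) (B : \bar R) :
  0 <= B ->
  (forall z, rect D1 D2 z -> ddosc (unif I1) (unif I2) (tau z) <= B) ->
  ddosc (unif I1) (unif I2) (f \- u)%R <= B.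
Proof.
move=> B0 H.
have mu0 := measurable_mollify.
have mfu : measurable_fun setT (f \- u)%R by exact: measurable_funB.
have c0 := @tent_mass_gt0 R d1 d2 delta delta0.
pose W : probability P2 R := pprod (pprod (unif I1) (unif I1)) (pprod (unif I2) (unif I2)).
have mL := measurable_abs_ddiff mfu.
have L0 (w : P2) : 0 <= `|ddiff (f \- u)%R w.1 w.2|%:E by rewrite lee_fin.
have mGz z : measurable_fun setT (fun w => G (w, z)).
  exact: (measurableT_comp mG (measurable_pair2 z)).
have mGw w : measurable_fun setT (fun z => G (w, z)).
  exact: (measurableT_comp mG (measurable_pair1 w)).
have mGi : measurable_fun setT (fun w => \int[muD]_z G (w, z)).
  exact: (@measurable_pprod1 _ _ _ _ R muD G).
have -> : ddosc (unif I1) (unif I2) (f \- u)%R =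
    \int[W]_w `|ddiff (f \- u)%R w.1 w.2|%:E.
  by rewrite (pprod_tonelli1 _ _ mL L0).
apply: (@le_trans _ _ (\int[W]_w ((c^-1)%R%:E * \int[muD]_z G (w, z)))).
  apply: ge0_le_integral => //; first exact: measurable_funeM.
  move=> w _; rewrite ddiff_mollify normrM (@ger0_norm _ c^-1%R) ?invr_ge0 ?(ltW c0)// EFinM.
  apply: lee_wpmul2l; first by rewrite lee_fin invr_ge0 ltW.
  have iw : muD.-integrable setT (EFin \o (fun z : E => (ddiff (tau z) w.1 w.2 * tent z)%R)).
    have i x := integrable_sub_translate x.
    have i1 := integrableB measurableT (i (w.1.1, w.2.1)) (i (w.1.2, w.2.1)).
    have i2 := integrableB measurableT i1 (i (w.1.1, w.2.2)).
    have i3 := integrableD measurableT i2 (i (w.1.2, w.2.2)).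
    apply: eq_integrable i3 => // z _ /=.
    by rewrite /ddiff/= -!EFinB -EFinD; congr (_%:E); ring.
  rewrite EFin_normr_Rintegral//; apply: le_trans.
    by apply: le_abse_integral => //; exact: measurable_int iw.
  apply: ge0_le_integral => //.
    by apply: measurableT_comp => //; exact: measurable_int iw.
  by move=> z _; rewrite lee_fin normrM (ger0_norm (tent_ge0 _ z)).
rewrite ge0_integralZl//; [|by move=> w _; exact: integral_ge0|by rewrite lee_fin invr_ge0 ltW].
rewrite (@pprod_tonelli _ _ _ _ R W muD G)//.
have key : \int[muD]_z \int[W]_w G (w, z) <= \int[muD]_z ((tent z)%:E * B).
  apply: le_integral_rect.
  - exact: (@measurable_pprod2 _ _ _ _ R W G).
  - apply: emeasurable_funM => //; apply/measurable_EFinP; exact: measurable_tent.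
  - by move=> z; exact: integral_ge0.
  - by move=> z; rewrite mule_ge0// lee_fin tent_ge0.
  move=> z zD.
  have mt : measurable_fun setT (tau z).
    by apply: measurable_funB => //; exact: measurable_translate.
  have mtd := measurable_abs_ddiff mt.
  under eq_integral => w _ do rewrite /G/= mulrC EFinM.
  rewrite ge0_integralZl//; last by rewrite lee_fin tent_ge0.
  apply: lee_wpmul2l; first by rewrite lee_fin tent_ge0.
  by rewrite (pprod_tonelli1 _ _ mtd (fun=> ltac:(by rewrite lee_fin))); exact: H.
have c0' : 0 <= (c^-1)%R%:E by rewrite lee_fin invr_ge0 ltW.
apply: (le_trans (lee_wpmul2l c0' key)).
under eq_integral do rewrite muleC.
rewrite ge0_integralZl//; last 2 first.
- by apply/measurable_EFinP; exact: measurable_tent.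
- by move=> z _; rewrite lee_fin tent_ge0.
by rewrite -tent_massE muleCA -EFinM mulVf ?mule1// gt_eqF.
Qed.

End mollification_error.

Section mollification_theorem.
Context {R : realType} {d1 d2 : nat} (alpha : R) (alpha0 : 0 <= alpha).
Local Notation E := ('rV[R]_d1 * 'rV[R]_d2)%type.

Lemma vanishing_mollification (f : E -> R) :
  loc_integrable f -> vanishing alpha f -> forall e, 0 < e ->
  exists2 u, locally_lipschitz u & forall (I1 : cube R d1) (I2 : cube R d2),
    osc_bound alpha (f \- u) I1 I2 e.
Proof.
move=> lf vf e e0; pose C : R := 2 + 4 * 3 ^+ d1 + 4 * 3 ^+ d2.
have C0 : 0 < C.
  by rewrite /C addr_gt0 ?addr_gt0 ?mulr_gt0 ?exprn_gt0.
have eC0 : 0 < e / C by rewrite divr_gt0.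
have [T T0 HT] := vf _ eC0.
have delta0 : 0 < (4 * T)^-1 by rewrite invr_gt0 mulr_gt0.
exists (mollify delta0 f); first exact: mollify_locally_lipschitz.
move=> I1 I2; apply: ddosc_mollify => //.
  by rewrite lee_fin mulr_ge0 ?powR_ge0// ltW.
move=> z [z1 z2].
have -> : e = C * (e / C) by rewrite mulrCA divff ?mulr1// gt_eqF.
apply: (osc_bound_translate alpha0 (ltW eC0) T0 lf.1).
- by move=> J1 J2 [h|h]; apply: HT; [constructor 1|constructor 2].
- by move=> i; have := z1 i; rewrite /= mxE add0r.
- by move=> i; have := z2 i; rewrite /= mxE add0r.
Qed.

End mollification_theorem.

(** * Campanato's theorem for a pseudometric *)

Section campanato.
Context {R : realType} {n : nat}.
Local Notation V := 'rV[R]_n.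
Local Open Scope ereal_scope.

Lemma integral_pprod_sub (I I' J J' : cube R n) (g : V * V -> \bar R) :
  measurable_fun setT g -> (forall x, 0 <= g x) ->
  cube_set J `<=` cube_set I -> cube_set J' `<=` cube_set I' ->
  \int[pprod (unif J) (unif J')]_x g x <=
  ((side I / side J) ^+ n * (side I' / side J') ^+ n)%:E *
    \int[pprod (unif I) (unif I')]_x g x.
Proof.
move=> mg g0 JI JI'.
have mi (K : cube R n) : measurable_fun setT (fun x => \int[unif K]_y g (x, y)).
  exact: (@measurable_pprod1 _ _ _ _ R (unif K) g).
have i0 (K : cube R n) x : 0 <= \int[unif K]_y g (x, y) by exact: integral_ge0.
have c0 (K L : cube R n) : 0 <= ((side K / side L) ^+ n)%:E :> \bar R.
  by rewrite lee_fin exprn_ge0// divr_ge0// ltW// side_gt0.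
rewrite !(pprod_tonelli1 _ _ mg g0).
apply: (le_trans (integral_unif_sub (mi _) (i0 _) JI)).
rewrite EFinM -muleA; apply: lee_wpmul2l => //.
rewrite -ge0_integralZl//; try exact: mi; try (by move=> x _; exact: i0).
apply: ge0_le_integral => //.

- by apply: measurable_funeM; exact: mi.
- move=> x _; apply: integral_unif_sub => //.
  exact: (measurableT_comp mg (measurable_pair1 x)).
Qed.

Definition centered_cube (x : V) (s : R) (s0 : (0 < s)%R) : cube R n :=
  Cube (x - const_mx (s / 2))%R s0.

Lemma centered_cubeP x s (s0 : (0 < s)%R) z :
  cube_set (centered_cube x s0) z <-> (`|z - x| <= s / 2)%R.
Proof.
have s20 : (0 <= s / 2)%R by rewrite divr_ge0// ltW.
split=> [H|/(rV_norm_le _ s20) H].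
  apply/rV_norm_le => // i; have := H i; rewrite /= !mxE ler_norml.
  by move=> /andP[? ?]; apply/andP; split; lra.
by move=> i; have := H i; rewrite /= !mxE ler_norml => /andP[? ?]; apply/andP; split; lra.
Qed.

Lemma centered_cube_sub x y s t (s0 : (0 < s)%R) (t0 : (0 < t)%R) :
  (`|x - y| + s / 2 <= t / 2)%R ->
  cube_set (centered_cube x s0) `<=` cube_set (centered_cube y t0).
Proof.
move=> h z /centered_cubeP zx; apply/centered_cubeP.
by have := ler_distD x z y; lra.
Qed.

Variables (r : V * V -> R) (a : R).
Hypotheses (mr : measurable_fun setT r) (r0 : forall x, (0 <= r x)%R)
  (rT : forall x y z, (r (x, z) <= r (x, y) + r (y, z))%R)
  (rC : forall x y, r (x, y) = r (y, x))
  (r_diag : forall x eta, (0 < eta)%R -> exists2 s, (0 < s)%R &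
     forall z, (`|z - x| <= s)%R -> (r (x, z) <= eta)%R)
  (a0 : (0 < a)%R).

Let rE z := (r z)%:E.
Let mrE : measurable_fun setT rE. Proof. exact/measurable_EFinP. Qed.
Let rE0 z : 0 <= rE z. Proof. by rewrite lee_fin. Qed.
Let mrx x : measurable_fun setT (fun y => rE (x, y)).
Proof. exact: (measurableT_comp mrE (measurable_pair1 x)). Qed.

Let b x (I : cube R n) := \int[unif I]_z rE (x, z).

Let b_split x (I J : cube R n) :
  b x I <= b x J + \int[pprod (unif J) (unif I)]_z rE z.
Proof.
have mi : measurable_fun setT (fun w => \int[unif I]_z rE (w, z)).
  exact: (@measurable_pprod1 _ _ _ _ R (unif I) rE).
have i0 w : 0 <= \int[unif I]_z rE (w, z) by exact: integral_ge0.
rewrite (pprod_tonelli1 _ _ mrE rE0) /b -ge0_integralD//.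
rewrite -[leLHS](integral_unif_cst J); apply: ge0_le_integral => //.
  exact: emeasurable_funD.
move=> w _; rewrite -[X in X + _](integral_unif_cst I) -ge0_integralD//.
apply: ge0_le_integral => //; first exact: emeasurable_funD.
by move=> z _; rewrite /rE -EFinD lee_fin.
Qed.

Let q : R := (2^-1 `^ a)%R.

Let q_gt0 : (0 < q)%R. Proof. by rewrite powR_gt0// invr_gt0. Qed.

Let q_lt1 : (q < 1)%R.
Proof.
have e1 : (1 `^ a = 1 :> R)%R by rewrite powR1.
rewrite -[ltRHS]e1; apply: gt0_ltr_powR => //; rewrite ?nnegrE ?invr_ge0//.
by rewrite invf_lt1// ltr1n.
Qed.

(** The first summand is a geometric series at each of the two points, over cubes of side twice
    their distance; the second comes from enclosing both cubes in one of side four times the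
    distance. *)
Definition campanato_constant : R :=
  (2 * (2 ^+ n * (2 `^ a / (1 - 2^-1 `^ a))) + 4 ^+ n * 4 `^ a)%R.

Lemma campanato_constant_gt0 : (0 < campanato_constant)%R.
Proof.
by rewrite addr_gt0// ?mulr_gt0 ?exprn_gt0 ?powR_gt0 ?invr_gt0// subr_gt0.
Qed.

(** Passing from a centred cube of side t to its half costs at most 2^n k t^a in the mean of r(x,
    .). These costs form a geometric series of ratio q, and the mean itself tends to 0 under halving
    by continuity at the diagonal. *)
Let b_bound x k (s : R) (s0 : (0 < s)%R) : (0 <= k)%R ->
  (forall t (t0 : (0 < t)%R),
    \int[pprod (unif (centered_cube x t0)) (unif (centered_cube x t0))]_z rE z <=
    (k * t `^ a)%:E) ->
  b x (centered_cube x s0) <= (2 ^+ n * k / (1 - q) * s `^ a)%:E.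
Proof.
move=> k0 H.
have q1 : (0 < 1 - q)%R by rewrite subr_gt0.
pose C : R := (2 ^+ n * k / (1 - q))%R.
have C0 : (0 <= C)%R by rewrite divr_ge0 ?mulr_ge0 ?exprn_ge0// ltW.
have step t (t0 : (0 < t)%R) (t20 : (0 < t / 2)%R) :
    b x (centered_cube x t0) <= b x (centered_cube x t20) + (2 ^+ n * k * t `^ a)%:E.
  apply: (le_trans (b_split x _ (centered_cube x t20))); apply: leeD => //.
  apply: (le_trans (@integral_pprod_sub (centered_cube x t0) (centered_cube x t0)
    (centered_cube x t20) (centered_cube x t0) _ mrE rE0 _ _)) => //.
    by apply: centered_cube_sub; rewrite subrr normr0 add0r; lra.
  rewrite /= divff ?gt_eqF// expr1n mulr1.
  have -> : (t / (t / 2) = 2)%R by field; rewrite gt_eqF.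
  rewrite -mulrA [leRHS]EFinM; apply: lee_wpmul2l; first by rewrite lee_fin exprn_ge0.
  exact: H.
have iter m : forall t t' (t0 : (0 < t)%R) (t'0 : (0 < t')%R), (t' = t / 2 ^+ m)%R ->
    b x (centered_cube x t0) <=
    b x (centered_cube x t'0) + (C * t `^ a * (1 - q ^+ m))%:E.
  elim: m => [|m IH] t t' t0 t'0 t'E.
    rewrite (_ : centered_cube x t'0 = centered_cube x t0).
      by rewrite expr0 subrr mulr0 adde0.
    rewrite expr0 divr1 in t'E; rewrite t'E in t'0 *.
    by congr centered_cube; exact: bool_irrelevance.
  have t20 : (0 < t / 2)%R by rewrite divr_gt0.
  apply: (le_trans (step t t0 t20)).
  have t'E2 : (t' = t / 2 / 2 ^+ m)%R by rewrite t'E exprS invfM mulrA.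
  apply: (le_trans (leeD (IH _ _ t20 t'0 t'E2) (lexx _))).
  rewrite -addeA -EFinD; apply: leeD => //.
  rewrite lee_fin powRM ?invr_ge0//; last exact: ltW.
  rewrite -/q exprS le_eqVlt; apply/orP; left; apply/eqP.
  have -> : (2 ^+ n * k * t `^ a = C * (1 - q) * t `^ a)%R.
    by rewrite /C divfK// gt_eqF.
  ring.
apply/lee_addgt0Pr => eta eta0.
have [s1 s10 Hs1] := r_diag x eta0.
have [m hm] : exists m : nat, (s / s1 <= 2 ^+ m)%R.
  exists (Num.bound (s / s1)); apply: ltW.
  have := archi_boundP (_ : 0 <= s / s1)%R; rewrite divr_ge0 ?ltW// => /(_ isT) h.
  apply: (lt_le_trans h); rewrite -natrX ler_nat ltnW//.
  exact: ltn_expl.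
have sm : (0 < s / 2 ^+ m)%R by rewrite divr_gt0// exprn_gt0.
apply: (le_trans (iter m s _ s0 sm erefl)); rewrite addeC; apply: leeD.
  rewrite lee_fin; apply: ler_piMr; first by rewrite mulr_ge0 ?powR_ge0.
  by rewrite gerBl exprn_ge0// ltW.
rewrite -[leRHS](integral_unif_cst (centered_cube x sm)).
apply: le_integral_unif => //; first by move=> _; rewrite lee_fin ltW.
move=> z /centered_cubeP zx; rewrite lee_fin; apply: Hs1; apply: (le_trans zx).
have h2 : (s / 2 ^+ m <= s1)%R.
  by rewrite ler_pdivrMr ?exprn_gt0// mulrC -ler_pdivrMr.
have := ltW sm; lra.
Qed.

(** A chain from x to y through points of the cubes of side 2 |x - y| centred at them, both
    contained in the cube of side 4 |x - y| centred at x. Growth is demanded only on cubes centred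
    at x or y; this later gives far points a smaller constant. *)
Lemma campanato x y k : (0 <= k)%R ->
  (forall t (t0 : (0 < t)%R),
    \int[pprod (unif (centered_cube x t0)) (unif (centered_cube x t0))]_z (r z)%:E <=
    (k * t `^ a)%:E) ->
  (forall t (t0 : (0 < t)%R),
    \int[pprod (unif (centered_cube y t0)) (unif (centered_cube y t0))]_z (r z)%:E <=
    (k * t `^ a)%:E) ->
  (r (x, y) <= campanato_constant * k * `|x - y| `^ a)%R.
Proof.
move=> k0 Hx Hy.
have [->|xy] := eqVneq x y.
  rewrite subrr normr0 powR0 ?gt_eqF// mulr0.
  apply/ler_addgt0Pr => eta eta0; have [s s0 h] := r_diag y eta0.
  by rewrite add0r; apply: h; rewrite subrr normr0 ltW.
have l0 : (0 < `|x - y|)%R by rewrite normr_gt0 subr_eq0.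
set l := `|x - y|%R in l0 *.
have l2 : (0 < 2 * l)%R by rewrite mulr_gt0.
have l4 : (0 < 4 * l)%R by rewrite mulr_gt0.
have bx := b_bound l2 k0 Hx; have by_ := b_bound l2 k0 Hy.
set Ix := centered_cube x l2 in bx; set Iy := centered_cube y l2 in by_.
have mid : \int[pprod (unif Ix) (unif Iy)]_z rE z <= (4 ^+ n * (k * (4 * l) `^ a))%:E.
  apply: (le_trans (@integral_pprod_sub (centered_cube x l4) (centered_cube x l4)
    Ix Iy _ mrE rE0 _ _)).
  - by apply: centered_cube_sub; rewrite subrr normr0 add0r; lra.
  - by apply: centered_cube_sub; rewrite distrC -/l; lra.
  rewrite /= -exprMn.
  have -> : (4 * l / (2 * l) * (4 * l / (2 * l)) = 4)%R by field; rewrite gt_eqF.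
  rewrite [leRHS]EFinM; apply: lee_wpmul2l; first by rewrite lee_fin exprn_ge0.
  exact: Hx.
have : (r (x, y))%:E <= b x Ix + \int[pprod (unif Ix) (unif Iy)]_z rE z + b y Iy.
  have h1 : (r (x, y))%:E <= b x Iy + b y Iy.
    rewrite /b -ge0_integralD// -[leLHS](integral_unif_cst Iy).
    apply: ge0_le_integral => //.
    - by move=> z _; rewrite lee_fin.
    - exact: emeasurable_funD.
    by move=> z _; rewrite /rE -EFinD lee_fin (rC y z).
  by apply: (le_trans h1); apply: leeD => //; exact: b_split.
move=> /le_trans /(_ (leeD (leeD bx mid) by_)).
rewrite -!EFinD lee_fin => /le_trans; apply.
rewrite !powRM ?(ltW l0)// /campanato_constant -/q le_eqVlt; apply/orP; left; apply/eqP.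
ring.
Qed.

End campanato.

(** * Means and mean oscillation of continuous functions *)

Section continuous_real.
Context {R : realType} {T : topologicalType}.
Implicit Types h g : T -> R.

Lemma continuous_cst (c : R) : continuous (fun _ : T => c).
Proof. exact: cst_continuous. Qed.

Lemma continuous_sub h g : continuous h -> continuous g -> continuous (fun x => h x - g x).
Proof.
by move=> ch cg x; apply: (@continuousB R R^o T h g x); [apply: ch|apply: cg].
Qed.

Lemma continuous_add h g : continuous h -> continuous g -> continuous (fun x => h x + g x).
Proof.
by move=> ch cg x; apply: (@continuousD R R^o T h g x); [apply: ch|apply: cg].
Qed.

Lemma continuous_opp h : continuous h -> continuous (fun x => - h x).
Proof. by move=> ch x; apply: (@continuousN R R^o T h x); apply: ch. Qed.

Lemma continuous_mul h g : continuous h -> continuous g -> continuous (fun x => h x * g x).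
Proof.
by move=> ch cg x; apply: (@continuousM R T h g x); [apply: ch|apply: cg].
Qed.

Lemma continuous_abs h : continuous h -> continuous (fun x => `|h x|).
Proof.
move=> ch x; apply: (@continuous_comp _ _ _ h (fun y : R => `|y|) x).
  by apply: ch.
exact: norm_continuous.
Qed.

End continuous_real.

Section mean_oscillation.
Context {R : realType} {n : nat}.
Local Notation V := 'rV[R]_n.
Implicit Types (I J : cube R n) (h g : V -> R).

Definition mean I h : R := \int[unif I]_x h x.

Definition mosc I h : R := mean I (fun x => `|h x - mean I h|).

Lemma mean_cst I c : mean I (fun=> c) = c.
Proof. by rewrite /mean /Rintegral (integral_unif_cst I). Qed.

Lemma meanD I h g : continuous h -> continuous g ->
  mean I (fun x => h x + g x) = mean I h + mean I g.
Proof.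
by move=> ch cg; rewrite /mean RintegralD//; exact: integrable_unif_continuous.
Qed.

Lemma meanB I h g : continuous h -> continuous g ->
  mean I (fun x => h x - g x) = mean I h - mean I g.
Proof.
by move=> ch cg; rewrite /mean RintegralB//; exact: integrable_unif_continuous.
Qed.

Lemma meanZ I c h : continuous h -> mean I (fun x => c * h x) = c * mean I h.
Proof.
by move=> ch; rewrite /mean RintegralZl//; exact: integrable_unif_continuous.
Qed.

Lemma mean_ge0 I h : continuous h -> (forall x, cube_set I x -> 0 <= h x) ->
  0 <= mean I h.
Proof.
move=> ch h0; have mh : measurable_fun setT (EFin \o h).
  by apply/measurable_EFinP; exact: continuous_measurable_rV.
rewrite /mean /Rintegral fine_ge0// integralE.
have -> : (\int[unif I]_x (fun x => (h x)%:E)^\- x = 0)%E.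
  apply/eqP; rewrite eq_le; apply/andP; split; last first.
    by apply: integral_ge0 => x _; exact: funeneg_ge0.
  rewrite -[leRHS](integral_unif_cst I); apply: le_integral_unif => //.
  - exact: measurable_funeneg.
  - by move=> x Ix; rewrite funeneg.unlock ge_max lexx andbT -EFinN lee_fin oppr_le0 h0.
by rewrite sube0; apply: integral_ge0 => x _; exact: funepos_ge0.
Qed.

Lemma le_mean I h g : continuous h -> continuous g ->
  (forall x, cube_set I x -> h x <= g x) -> mean I h <= mean I g.
Proof.
move=> ch cg hg; rewrite -subr_ge0 -meanB//; apply: mean_ge0.
  exact: continuous_sub.
by move=> x Ix; rewrite subr_ge0 hg.
Qed.

Lemma mean_le_cst I h c : continuous h ->
  (forall x, cube_set I x -> h x <= c) -> mean I h <= c.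
Proof.
by move=> ch hc; rewrite -[leRHS](mean_cst I); apply: le_mean => //; exact: continuous_cst.
Qed.

Lemma mean_abs I h : continuous h -> `|mean I h| <= mean I (fun x => `|h x|).
Proof.
move=> ch; apply: le_normr_Rintegral => //.
exact: integrable_unif_continuous.
Qed.

Lemma mean_subcube I J h : continuous h -> (forall x, 0 <= h x) ->
  cube_set J `<=` cube_set I -> mean J h <= (side I / side J) ^+ n * mean I h.
Proof.
move=> ch h0 JI.
have fin K : (\int[unif K]_x (h x)%:E)%E \is a fin_num.
  apply: integrable_fin_num => //; exact: integrable_unif_continuous.
rewrite -lee_fin EFinM /mean /Rintegral !fineK; [|exact: fin|exact: fin].
apply: integral_unif_sub => //.
by apply/measurable_EFinP; exact: continuous_measurable_rV.
Qed.

Lemma continuous_dev h c : continuous h -> continuous (fun x => `|h x - c|).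
Proof.
by move=> ch; apply: continuous_abs; apply: continuous_sub => //; exact: continuous_cst.
Qed.

Lemma mean_dev I h c : continuous h -> `|mean I h - c| <= mean I (fun x => `|h x - c|).
Proof.
move=> ch; rewrite -{1}(mean_cst I c) -meanB//; last exact: continuous_cst.
by apply: mean_abs; apply: continuous_sub => //; exact: continuous_cst.
Qed.

Lemma mosc_ge0 I h : continuous h -> 0 <= mosc I h.
Proof. by move=> ch; apply: mean_ge0 => //; exact: continuous_dev. Qed.

(** Replacing the mean by c costs |mean - c|, itself at most the mean of |h - c|; hence the factor
    2. *)
Lemma mosc_le I h c : continuous h -> mosc I h <= 2 * mean I (fun x => `|h x - c|).
Proof.
move=> ch; have cd := continuous_dev (c := c) ch.
apply: (@le_trans _ _ (mean I (fun x => `|h x - c| + `|mean I h - c|))).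
  apply: le_mean.
  - exact: continuous_dev.
  - by apply: continuous_add => //; exact: continuous_cst.
  by move=> x _; rewrite (distrC (mean I h)); exact: ler_distD.
rewrite meanD//; last exact: continuous_cst.
by rewrite mean_cst mulrDl mul1r lerD2l; exact: mean_dev.
Qed.

Lemma mosc_le_sup I h c M : continuous h ->
  (forall x, cube_set I x -> `|h x - c| <= M) -> mosc I h <= 2 * M.
Proof.
move=> ch hM; apply: (le_trans (mosc_le I c ch)).
by rewrite ler_pM2l//; apply: mean_le_cst => //; exact: continuous_dev.
Qed.

Lemma moscD I h g : continuous h -> continuous g ->
  mosc I (fun x => h x + g x) <= mosc I h + mosc I g.
Proof.
move=> ch cg; rewrite /mosc meanD//.
rewrite -[leRHS]meanD; [|exact: continuous_dev|exact: continuous_dev].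
apply: le_mean.
- by apply: continuous_dev; exact: continuous_add.
- by apply: continuous_add; exact: continuous_dev.
move=> x _; rewrite opprD addrACA; exact: ler_normD.
Qed.

Lemma moscZ I c h : continuous h -> mosc I (fun x => c * h x) = `|c| * mosc I h.
Proof.
move=> ch; rewrite /mosc meanZ//; rewrite -[RHS]meanZ; last exact: continuous_dev.
by congr mean; apply/funext => x; rewrite -mulrBr normrM.
Qed.

Lemma moscN I h : continuous h -> mosc I (fun x => - h x) = mosc I h.
Proof.
move=> ch; have -> : (fun x => - h x) = (fun x => -1 * h x).
  by apply/funext => x; rewrite mulN1r.
by rewrite moscZ// normrN1 mul1r.
Qed.

Lemma moscB I h g : continuous h -> continuous g ->
  mosc I (fun x => h x - g x) <= mosc I h + mosc I g.
Proof.
move=> ch cg; rewrite -(moscN I cg); apply: moscD => //.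
exact: continuous_opp.
Qed.

Lemma mosc_cst I c : mosc I (fun=> c) = 0.
Proof. by rewrite /mosc !mean_cst subrr normr0. Qed.

Lemma mosc_shift I h c : continuous h -> mosc I (fun x => h x - c) = mosc I h.
Proof.
move=> ch; rewrite /mosc meanB//; last exact: continuous_cst.
by rewrite mean_cst; congr mean; apply/funext => x; rewrite opprB addrA subrK.
Qed.

Lemma mean_subcube_dist I J h : continuous h -> cube_set J `<=` cube_set I ->
  `|mean J h - mean I h| <= (side I / side J) ^+ n * mosc I h.
Proof.
move=> ch JI; apply: (le_trans (mean_dev J _ ch)).
by apply: mean_subcube => //; exact: continuous_dev.
Qed.

(** Together with [pairs_le_mosc] it translates between mean oscillation and the inner integral of
    [ddosc], which runs over pairs. *)
Lemma mosc_le_pairs I h : continuous h ->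
  ((mosc I h)%:E <= \int[pprod (unif I) (unif I)]_q `|h q.1 - h q.2|%:E)%E.
Proof.
move=> ch; have mh := continuous_measurable_rV ch.
have mq : measurable_fun setT (fun q : V * V => `|h q.1 - h q.2|%:E).
  apply/measurable_EFinP; apply: measurableT_comp => //; apply: measurable_funB.
    exact: (measurableT_comp mh measurable_fst).
  exact: (measurableT_comp mh measurable_snd).
have q0 (q : V * V) : (0 <= `|h q.1 - h q.2|%:E)%E by rewrite lee_fin.
have fin g : continuous g -> (\int[unif I]_x (g x)%:E)%E \is a fin_num.
  by move=> cg; apply: integrable_fin_num => //; exact: integrable_unif_continuous.
rewrite (pprod_tonelli1 _ _ mq q0) /mosc {1}/mean /Rintegral fineK; last first.
  exact: (fin _ (continuous_dev ch)).
apply: ge0_le_integral => //.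
- by apply/measurable_EFinP; apply: continuous_measurable_rV; exact: continuous_dev.
- exact: (@measurable_pprod1 _ _ _ _ R (unif I) (fun q => `|h q.1 - h q.2|%:E)).
move=> x _ /=.
have := mean_dev I (h x) ch; rewrite distrC => hx.
rewrite (@le_trans _ _ (mean I (fun y => `|h y - h x|))%:E) ?lee_fin//.
rewrite /mean /Rintegral fineK; last exact: (fin _ (continuous_dev ch)).
apply: ge0_le_integral => //.
- by apply/measurable_EFinP; apply: continuous_measurable_rV; exact: continuous_dev.
- apply/measurable_EFinP; apply: measurableT_comp => //.
  exact: measurable_funB.
- by move=> y _; rewrite lee_fin distrC.
Qed.

Lemma pairs_le_mosc I h : continuous h ->
  (\int[pprod (unif I) (unif I)]_q `|h q.1 - h q.2|%:E <= (2 * mosc I h)%:E)%E.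
Proof.
move=> ch; have mh := continuous_measurable_rV ch.
pose d x := `|h x - mean I h|.
have cd : continuous d by exact: continuous_dev.
have md : measurable_fun setT (EFin \o d).
  by apply/measurable_EFinP; exact: continuous_measurable_rV.
have md1 : measurable_fun setT (fun q : V * V => (d q.1)%:E).
  exact: (measurableT_comp md measurable_fst).
have md2 : measurable_fun setT (fun q : V * V => (d q.2)%:E).
  exact: (measurableT_comp md measurable_snd).
have d0 x : (0 <= (EFin \o d) x)%E by rewrite lee_fin normr_ge0.
have dE : (\int[unif I]_x (d x)%:E = (mosc I h)%:E)%E.
  rewrite /mosc /mean /Rintegral fineK//.
  by apply: integrable_fin_num => //; exact: integrable_unif_continuous.
apply: (@le_trans _ _ (\int[pprod (unif I) (unif I)]_q ((d q.1)%:E + (d q.2)%:E))%E).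
  apply: ge0_le_integral => //.
  - apply/measurable_EFinP; apply: measurableT_comp => //; apply: measurable_funB.
      exact: (measurableT_comp mh measurable_fst).
    exact: (measurableT_comp mh measurable_snd).
  - exact: emeasurable_funD.
  move=> q _; rewrite -EFinD lee_fin /d (distrC (h q.2)); exact: ler_distD.
rewrite ge0_integralD//; try by move=> q _; exact: d0.
rewrite (integral_pprod_fst (unif I) (unif I) md d0).
rewrite (integral_pprod_snd (unif I) (unif I) md d0)/= dE -EFinD lee_fin.
by rewrite mulrDl mul1r.
Qed.

End mean_oscillation.

(** The quadrangle inequality of a pseudometric: P and Q are distances between two pairs of points,
    m1 and m2 the mixed distances, a and b the displacements. *)
Lemma quadrangle_bound (R : realFieldType) (P Q a b m1 m2 w : R) :
  a <= w -> b <= w -> P <= a + m1 -> m1 <= Q + b ->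
  Q <= a + m2 -> m2 <= P + b -> `|P - Q| <= 2 * w.
Proof. by move=> *; rewrite ler_norml; apply/andP; split; lra. Qed.

(** * Hoelder continuity of slices *)

Section slice_distance.
Context {R : realType} {d1 d2 : nat}.
Local Notation E := ('rV[R]_d1 * 'rV[R]_d2)%type.
Variable u : E -> R.
Hypothesis lu : locally_lipschitz u.

Lemma continuous_slice x : continuous (fun z => u (x, z)).
Proof.
have cp : continuous (fun z : 'rV[R]_d2 => ((x, z) : E)).
  move=> z; apply/(@cvgrPdist_lt R E 'rV[R]_d2 (nbhs z) (nbhs_filter z)) => e e0.
  apply/nbhs_ballP; exists e => //= t; rewrite -ball_normE/= => zt.
  by rewrite prod_normE/= subrr normr0 gt_max e0.
move=> z; apply: (@continuous_comp _ _ _ (fun z : 'rV[R]_d2 => ((x, z) : E)) u).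
  exact: cp.
exact: locally_lipschitz_continuous.
Qed.

Lemma continuous_slice_sub x y : continuous (fun z => u (x, z) - u (y, z)).
Proof. by apply: continuous_sub; exact: continuous_slice. Qed.

(** For fixed J a pseudometric in x and y, and a locally Lipschitz one: Campanato's theorem applies
    to it and yields pointwise bounds. *)
Definition slice_dist (J : cube R d2) (x y : 'rV[R]_d1) : R :=
  mosc J (fun z => u (x, z) - u (y, z)).

Lemma slice_dist_ge0 J x y : 0 <= slice_dist J x y.
Proof. by apply: mosc_ge0; exact: continuous_slice_sub. Qed.

Lemma slice_distC J x y : slice_dist J x y = slice_dist J y x.
Proof.
rewrite /slice_dist -(moscN J (@continuous_slice_sub y x)).
by congr mosc; apply/funext => z; rewrite opprB.
Qed.

Lemma slice_dist_triangle J x y z :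
  slice_dist J x z <= slice_dist J x y + slice_dist J y z.
Proof.
rewrite /slice_dist; have := moscD J (@continuous_slice_sub x y) (@continuous_slice_sub y z).
suff -> : (fun z0 => u (x, z0) - u (y, z0) + (u (y, z0) - u (z, z0))) =
  (fun z0 => u (x, z0) - u (z, z0)) by [].
by apply/funext => w; rewrite addrA subrK.
Qed.

Lemma slice_dist_lipschitz J r : exists2 L, 0 <= L & forall x y,
  `|x| <= r -> `|y| <= r -> slice_dist J x y <= L * `|x - y|.
Proof.
have [M JM] : exists M, forall z, cube_set J z -> `|z| <= M.
  have [M [_ HM]] := compact_bounded (@compact_cube _ _ J).
  by exists (M + 1) => z Jz; apply: HM => //; rewrite ltrDl.
have [L HL] := lu (Num.max r M).
exists (2 * `|L|) => [|x y xr yr]; first by rewrite mulr_ge0.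
rewrite -mulrA; apply: (@mosc_le_sup _ _ _ _ 0).
  exact: continuous_slice_sub.
move=> z /JM zM; rewrite subr0.
have n1 : `|(x, z)| <= Num.max r M.
  by rewrite prod_normE ge_max !le_max xr zM orbT.
have n2 : `|(y, z)| <= Num.max r M.
  by rewrite prod_normE ge_max !le_max yr zM orbT.
apply: (le_trans (HL _ _ n1 n2)).
have -> : `|(x, z) - (y, z)| = `|x - y|.
  by rewrite prod_normE/= subrr normr0; apply/max_idPl.
by rewrite ler_wpM2r// ler_norm.
Qed.

Lemma measurable_slice_dist J :
  measurable_fun setT (fun p : 'rV[R]_d1 * 'rV[R]_d1 => slice_dist J p.1 p.2).
Proof.
apply: continuous_measurable_prod; apply: locally_lipschitz_continuous => r.
have [L L0 HL] := slice_dist_lipschitz J r.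
exists (2 * L) => p q pr qr.
have [p1 p2] : `|p.1| <= r /\ `|p.2| <= r.
  by move: pr; rewrite prod_normE ge_max => /andP.
have [q1 q2] : `|q.1| <= r /\ `|q.2| <= r.
  by move: qr; rewrite prod_normE ge_max => /andP.
have n1 : `|p.1 - q.1| <= `|p - q| by rewrite prod_normE le_max lexx.
have n2 : `|p.2 - q.2| <= `|p - q| by rewrite prod_normE le_max lexx orbT.
have h1 := le_trans (HL _ _ p1 q1) (ler_wpM2l L0 n1).
have h2 := le_trans (HL _ _ p2 q2) (ler_wpM2l L0 n2).
have t1 := slice_dist_triangle J p.1 q.1 p.2.
have t2 := slice_dist_triangle J q.1 q.2 p.2.
have t3 := slice_dist_triangle J q.1 p.1 q.2.
have t4 := slice_dist_triangle J p.1 p.2 q.2.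
rewrite (slice_distC J q.2 p.2) in t2; rewrite (slice_distC J q.1 p.1) in t3.
rewrite -mulrA; exact: quadrangle_bound h1 h2 t1 t2 t3 t4.
Qed.

Lemma integral_slice_dist (I : cube R d1) (J : cube R d2) :
  (\int[pprod (unif I) (unif I)]_p (slice_dist J p.1 p.2)%:E <=
   ddosc (unif I) (unif J) u)%E.
Proof.
have mu : measurable_fun setT u.
  by apply: continuous_measurable_prod; exact: locally_lipschitz_continuous.
apply: ge0_le_integral => //.
- by move=> p _; rewrite lee_fin slice_dist_ge0.
- by apply/measurable_EFinP; exact: measurable_slice_dist.
- exact: measurable_ddosc_in.
move=> p _; apply: (le_trans (mosc_le_pairs J (@continuous_slice_sub p.1 p.2))).
rewrite le_eqVlt; apply/orP; left; apply/eqP; apply: eq_integral => q _.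
by congr (_%:E); rewrite /ddiff; congr `|_|; ring.
Qed.

Variable alpha : R.
Hypothesis alpha0 : 0 < alpha.
Local Notation C := (@campanato_constant R d1 alpha).

Lemma slice_dist_campanato J x y k : 0 <= k ->
  (forall t (t0 : 0 < t), osc_bound alpha u (centered_cube x t0) J k) ->
  (forall t (t0 : 0 < t), osc_bound alpha u (centered_cube y t0) J k) ->
  slice_dist J x y <= C * k * `|x - y| `^ alpha.
Proof.
move=> k0 Hx Hy.
pose r (p : 'rV[R]_d1 * 'rV[R]_d1) := slice_dist J p.1 p.2.
have mr : measurable_fun setT r by exact: measurable_slice_dist.
have r0 p : 0 <= r p by exact: slice_dist_ge0.
have rT a b c : r (a, c) <= r (a, b) + r (b, c) by exact: slice_dist_triangle.
have rC a b : r (a, b) = r (b, a) by exact: slice_distC.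
have rd a eta : 0 < eta -> exists2 s, 0 < s & forall z, `|z - a| <= s -> r (a, z) <= eta.
  move=> eta0; have [L L0 HL] := slice_dist_lipschitz J (`|a| + 1).
  have L1 : 0 < L + 1 by rewrite ltr_wpDl.
  exists (Num.min 1 (eta / (L + 1))); first by rewrite lt_min ltr01 divr_gt0.
  move=> z; rewrite le_min => /andP[z1 zeta].
  have az : `|z| <= `|a| + 1.
    have := ler_normD (z - a) a; rewrite subrK => h; apply: (le_trans h).
    by rewrite addrC lerD2l.
  have aa : `|a| <= `|a| + 1 by rewrite lerDl.
  apply: (le_trans (HL _ _ aa az)); rewrite distrC.
  apply: (@le_trans _ _ ((L + 1) * (eta / (L + 1)))).
    by apply: ler_pM => //; rewrite lerDl.
  by rewrite mulrCA divff ?mulr1// gt_eqF.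
have h1 t (t0 : 0 < t) := le_trans (integral_slice_dist _ _) (Hx t t0).
have h2 t (t0 : 0 < t) := le_trans (integral_slice_dist _ _) (Hy t t0).
exact: (@campanato R d1 r alpha mr r0 rT rC rd alpha0 x y k k0 h1 h2).
Qed.

End slice_distance.

(** Uniformity in J makes this Hoelder continuity of x -> u(x, .) with values in BMO modulo
    constants; e is its constant at infinity. *)
Definition slice_holder (R : realType) (d1 d2 : nat) (alpha : R)
    (u : 'rV[R]_d1 * 'rV[R]_d2 -> R) (A e N : R) : Prop :=
  forall J x y,
    slice_dist u J x y <= A * `|x - y| `^ alpha /\
    ([\/ N <= `|x|, N <= `|y|, N <= `|x - y| | exists2 z, cube_set J z & N <= `|z|] ->
     slice_dist u J x y <= e * `|x - y| `^ alpha).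

Lemma center_in (R : realType) n (x : 'rV[R]_n) t (t0 : 0 < t) : cube_set (centered_cube x t0) x.
Proof. by apply/centered_cubeP; rewrite subrr normr0 divr_ge0// ltW. Qed.

Lemma powR2_le (R : realType) (alpha x : R) : alpha < 1 -> 0 <= x ->
  (2 * x) `^ alpha <= 2 * x `^ alpha.
Proof.
move=> a1 x0.
rewrite powRM// ler_wpM2r ?powR_ge0//; apply: ler1_powR; last exact: ltW.
by rewrite ler1n.
Qed.

Lemma rV_normB (R : realType) n (x y : 'rV[R]_n) : `|x - y| <= `|x| + `|y|.
Proof. exact: ler_normB. Qed.

Lemma rV_normD (R : realType) n (x y : 'rV[R]_n) : `|x + y| <= `|x| + `|y|.
Proof. exact: ler_normD. Qed.

Lemma rV_distD (R : realType) n (y x z : 'rV[R]_n) :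
  `|x - z| <= `|x - y| + `|y - z|.
Proof. exact: ler_distD. Qed.

(* The norms of vectors are abstracted because [lra] would otherwise compare
   them up to conversion. *)
Ltac norm_lra :=
  clear; repeat match goal with
  | |- context [@Num.norm ?K ?V ?x] =>
      let a := fresh in set a := (@Num.norm K V x); clearbody a
  end; lra.

(** Campanato's theorem looks only at rectangles whose first side is centred at x or y, so it yields
    the constant C e when J reaches beyond T or when both x and y lie there. A far point paired with
    a near one is a pair at large distance, treated through an intermediate point. *)
Lemma osc_bound_slice_holder (R : realType) (d1 d2 : nat) (alpha : R)
    (u : 'rV[R]_d1 * 'rV[R]_d2 -> R) A e T (C := @campanato_constant R d1 alpha) :
  (0 < d1)%N -> 0 < alpha < 1 -> locally_lipschitz u -> 0 <= A -> 0 < e -> 0 < T ->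
  (forall I1 I2, osc_bound alpha u I1 I2 A) ->
  (forall (I1 : cube R d1) (I2 : cube R d2) p, rect I1 I2 p -> T <= `|p| ->
     osc_bound alpha u I1 I2 e) ->
  exists2 N, 0 < N & slice_holder alpha u (C * A) (3 * (C * e)) N.
Proof.
move=> d1_gt0 alpha01 lu A0 e0 T0 HA HT; have /andP[a0 a1] := alpha01.
have [c [c0 cE]] : exists c, 0 < c /\ c = C.
  by exists C; split=> //; exact: campanato_constant_gt0.
rewrite -/C -cE.
have Ce0 : 0 < c * e by rewrite mulr_gt0.
have Ce3 : c * e <= 3 * (c * e) by rewrite ler_peMl ?ler1n// ltW.
have allA J x y : slice_dist u J x y <= c * A * `|x - y| `^ alpha.
  by rewrite cE; exact: slice_dist_campanato.
have farI J x y z : cube_set J z -> T <= `|z| ->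
    slice_dist u J x y <= c * e * `|x - y| `^ alpha.
  move=> Jz zT; rewrite cE; apply: slice_dist_campanato => //; first exact: ltW.
    move=> t t0; apply: (HT _ _ (x, z)); first by split=> //; exact: center_in.
    by rewrite prod_normE le_max zT orbT.
  move=> t t0; apply: (HT _ _ (y, z)); first by split=> //; exact: center_in.
  by rewrite prod_normE le_max zT orbT.
have far2 J x y : T <= `|x| -> T <= `|y| ->
    slice_dist u J x y <= c * e * `|x - y| `^ alpha.
  move=> xT yT; rewrite cE; apply: slice_dist_campanato => //; first exact: ltW.
    move=> t t0; apply: (HT _ _ (x, corner J)).
      by split; [exact: center_in|exact: corner_in].
    by rewrite prod_normE le_max xT.
  move=> t t0; apply: (HT _ _ (y, corner J)).
    by split; [exact: center_in|exact: corner_in].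
  by rewrite prod_normE le_max yT.
have [D0 D00 HD0] := @powR_large _ alpha (A * (2 * T) `^ alpha / e) a0.
pose D := D0 + 2 * T.
have dist1 J x y : D <= `|x - y| -> `|y| < T ->
    slice_dist u J x y <= 3 * (c * e) * `|x - y| `^ alpha.
  move=> xyD yT.
  have xT : T <= `|x|.
    by move: xyD yT D00 (rV_normB x y); rewrite /D; norm_lra.
  (* The intermediate point has norm T. Both x and w are far, which gives the small constant, with
     |x - w| <= 2 |x - y|; w and y are within 2 T, where the constant A is absorbed since |x -
     y|^alpha >= A (2 T)^alpha / e. The factor 3 is 2 + 1. *)
  pose w : 'rV[R]_d1 := const_mx T.
  have wT : `|w| <= T.
    by apply/rV_norm_le => [|i]; [exact: ltW|rewrite mxE ger0_norm// ltW].
  have wT' : T <= `|w|.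
    by have := coord_le_norm w (Ordinal d1_gt0); rewrite mxE ger0_norm//; exact: ltW.
  have h1 := far2 J x w xT wT'; have h2 := allA J w y.
  have xw : `|x - w| <= 2 * `|x - y|.
    by move: xyD yT D00 T0 wT (rV_distD y x w) (rV_normB y w); rewrite /D; norm_lra.
  have wy : `|w - y| <= 2 * T by move: yT wT (rV_normB w y); norm_lra.
  have p1 : `|x - w| `^ alpha <= 2 * `|x - y| `^ alpha.
    by apply: le_trans (powR2_le a1 _) => //; apply: powR_le => //; exact: ltW.
  have p2 : c * A * `|w - y| `^ alpha <= c * e * `|x - y| `^ alpha.
    apply: (@le_trans _ _ (c * A * (2 * T) `^ alpha)).
      apply: ler_wpM2l; first by rewrite mulr_ge0// ltW.
      by apply: powR_le => //; exact: ltW.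
    have xyD0 : D0 <= `|x - y| by move: xyD T0; rewrite /D; norm_lra.
    have h := HD0 _ xyD0; rewrite (ler_pdivrMr _ _ e0) in h.
    rewrite -[leLHS]mulrA -[leRHS]mulrA; apply: ler_wpM2l; first exact: ltW.
    by rewrite [leRHS]mulrC.
  have t := slice_dist_triangle lu J x w y.
  have p3 : c * e * `|x - w| `^ alpha <= c * e * (2 * `|x - y| `^ alpha).
    by rewrite ler_pM2l.
  rewrite -mulrA in p3.
  move: (mulr_ge0 (ltW Ce0) (powR_ge0 `|x - y| alpha)) h1 h2 t p2 p3.
  set r1 := slice_dist u J x y; set r2 := slice_dist u J x w; set r3 := slice_dist u J w y.
  set q1 := `|x - y| `^ alpha; set q2 := `|x - w| `^ alpha; set q3 := `|w - y| `^ alpha.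
  clearbody r1 r2 r3 q1 q2 q3.
  norm_lra.
have dist J x y : D <= `|x - y| ->
    slice_dist u J x y <= 3 * (c * e) * `|x - y| `^ alpha.
  move=> xyD; have [yT|yT] := ltP `|y| T; first exact: dist1.
  have [xT|xT] := ltP `|x| T; first by rewrite slice_distC// distrC; apply: dist1 => //; rewrite distrC.
  by apply: (le_trans (far2 J x y xT yT)); rewrite ler_wpM2r ?powR_ge0// Ce3.
have far1 J x y : D + T <= `|x| ->
    slice_dist u J x y <= 3 * (c * e) * `|x - y| `^ alpha.
  move=> xN; have [yT|yT] := ltP `|y| T.
    apply: dist; have := rV_normD (x - y) y; rewrite subrK.
    by move: xN yT; norm_lra.
  apply: (le_trans (far2 J x y _ yT)); first by move: xN T0 D00; rewrite /D; norm_lra.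
  by rewrite ler_wpM2r ?powR_ge0// Ce3.
exists (D + T); first by move: D00 T0; rewrite /D; norm_lra.
move=> J x y; split; first exact: allA.
case=> [h|h|h|[z Jz h]].
- exact: far1.
- by rewrite slice_distC// distrC; exact: far1.
- by apply: dist; move: h T0; norm_lra.
- apply: (le_trans (farI J x y z Jz _)).
    by move: h D00 T0; rewrite /D; norm_lra.
  by rewrite ler_wpM2r ?powR_ge0// Ce3.
Qed.

(** * Lipschitz cutoffs and means across scales *)

Section cutoff_profile.
Context {R : realType} {n : nat}.
Implicit Types (z w : 'rV[R]_n).

Definition theta (r : R) z : R := Num.min 1 (Num.max 0 (2 - `|z| / r)).

Lemma theta_ge0 r z : 0 <= theta r z.
Proof. by rewrite /theta le_min ler01 le_max lexx. Qed.

Lemma theta_le1 r z : theta r z <= 1.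
Proof. by rewrite /theta ge_min lexx. Qed.

Lemma theta_eq1 r z : 0 < r -> `|z| <= r -> theta r z = 1.
Proof.
move=> r0 zr; apply/min_idPl; rewrite le_max; apply/orP; right.
have : `|z| / r <= 1 by rewrite ler_pdivrMr// mul1r.
by move=> ?; rewrite lerBrDr -lerBrDl (le_trans _ (_ : 1 <= _)) //; lra.
Qed.

Lemma theta_eq0 r z : 0 < r -> 2 * r <= `|z| -> theta r z = 0.
Proof.
move=> r0 zr; have h : 2 <= `|z| / r by rewrite ler_pdivlMr.
rewrite /theta (max_idPl _) ?subr_le0//.
by apply/min_idPr; exact: ler01.
Qed.

Lemma min1_lipschitz (a b : R) : `|Num.min 1 a - Num.min 1 b| <= `|a - b|.
Proof.
have h := ler_norm (a - b); have h' := ler_norm (b - a).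
have h0 := normr_ge0 (a - b); rewrite distrC in h'.
by case: (leP 1 a) => ?; case: (leP 1 b) => ?; rewrite ler_norml; apply/andP; split; lra.
Qed.

Lemma theta_lipschitz r z w : 0 < r -> `|theta r z - theta r w| <= `|z - w| / r.
Proof.
move=> r0; apply: (le_trans (min1_lipschitz _ _)).
apply: (le_trans (max0_lipschitz _ _)).
have -> : 2 - `|z| / r - (2 - `|w| / r) = (`|w| - `|z|) / r by ring.
rewrite normrM normfV (gtr0_norm r0) ler_pM2r ?invr_gt0//.
by apply: (le_trans (ler_dist_dist _ _)); rewrite distrC.
Qed.

Lemma lipschitz_continuous_rV (f : 'rV[R]_n -> R) L :
  (forall z w, `|f z - f w| <= L * `|z - w|) -> continuous f.
Proof.
move=> fL z.
apply/(@cvgrPdist_lt R R^o 'rV[R]_n (nbhs z) (nbhs_filter z)) => e e0.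
have L1 : 0 < `|L| + 1 by rewrite ltr_wpDl.
apply/nbhs_ballP; exists (e / (`|L| + 1)); first by rewrite /= divr_gt0.
move=> t; rewrite -ball_normE/= => zt.
apply: (le_lt_trans (fL z t)).
apply: (@le_lt_trans _ _ ((`|L| + 1) * `|z - t|)).
  by rewrite ler_wpM2r// (le_trans (ler_norm L))// lerDl.
by rewrite mulrC -ltr_pdivlMr.
Qed.

Lemma continuous_theta r : 0 < r -> continuous (theta r).
Proof.
move=> r0; apply: (@lipschitz_continuous_rV _ r^-1) => z w.
by rewrite mulrC; exact: theta_lipschitz.
Qed.

End cutoff_profile.

Section support_mean.
Context {R : realType} {n : nat}.
Implicit Types (Q B : cube R n) (f : 'rV[R]_n -> R).

Lemma mean_support Q B f : continuous f -> (forall z, 0 <= f z) ->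
  (forall z, ~ cube_set B z -> f z = 0) ->
  mean Q f <= (side B / side Q) ^+ n * mean B f.
Proof.
move=> cf f0 fB.
have mf : measurable_fun setT (EFin \o f).
  by apply/measurable_EFinP; exact: continuous_measurable_rV.
have mQ := measurable_cube Q; have mB := measurable_cube B.
have fin K : (\int[unif K]_x (f x)%:E)%E \is a fin_num.
  by apply: integrable_fin_num => //; exact: integrable_unif_continuous.
have f0' x : (0 <= (EFin \o f) x)%E by rewrite lee_fin.
rewrite -lee_fin EFinM /mean /Rintegral !fineK; [|exact: fin|exact: fin].
rewrite (integral_unif Q mf f0') (integral_unif B mf f0').
rewrite muleA -EFinM expr_div_n mulrAC divff ?gt_eqF ?side_exp_gt0// mul1r.
apply: lee_wpmul2l; first by rewrite lee_fin side_expV_ge0.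
rewrite integral_mkcond [leRHS]integral_mkcond; apply: ge0_le_integral => //.
- by move=> x _; apply: erestrict_ge0.
- by apply/(measurable_restrictT _ mQ); exact: measurable_funTS.
- by apply/(measurable_restrictT _ mB); exact: measurable_funTS.
move=> x _; rewrite !patchE; have [xB|xB] := pselect (cube_set B x).
  by rewrite (mem_set xB); case: ifP.
by rewrite /= fB//; case: ifP; case: ifP.
Qed.

Lemma mean_ball_le Q f (S : R) : (0 < n)%N -> 0 < S -> continuous f ->
  (forall z, 0 <= f z <= 1) -> (forall z, S <= `|z| -> f z = 0) ->
  mean Q f <= 2 * S / side Q.
Proof.
move=> n0 S0 cf f01 fS.
have l0 := side_gt0 Q.
have [h|h] := leP 1 (2 * S / side Q).
  by apply: le_trans h; apply: mean_le_cst => // x _; have /andP[] := f01 x.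
have x0 : 0 <= 2 * S / side Q by rewrite divr_ge0 ?mulr_ge0 ?ltW.
apply: (@le_trans _ _ ((2 * S / side Q) ^+ n)); last first.
  by rewrite -[leRHS]expr1; apply: ler_wiXn2l => //; exact: ltW.
rewrite -lee_fin; apply: le_trans (integral_unif_ball Q S0).
rewrite /mean /Rintegral fineK; last first.
  by apply: integrable_fin_num => //; exact: integrable_unif_continuous.
apply: ge0_le_integral => //.
- by move=> x _; rewrite lee_fin; have /andP[] := f01 x.
- by apply/measurable_EFinP; exact: continuous_measurable_rV.
- apply/measurable_EFinP; apply: measurable_indic.
  have := @measurable_rV_ball R n 0 S S0.
  by under eq_set do rewrite subr0.
move=> x _; rewrite lee_fin indicE; have [xS|xS] := ltP `|x| S.
  by rewrite mem_set//; have /andP[] := f01 x.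
by rewrite memNset ?fS//=; apply/negP; rewrite -leNgt.
Qed.

End support_mean.

(** The terms grow geometrically while the scale is below 1 and decay geometrically afterwards.
    Induction peels off the smallest scale and replaces t by 2 t; the two bounds depending on t,
    which replace 20, are made to be stable under this step. *)
Lemma dyadic_min_sum (R : realType) (L : nat) (t : R) : 0 < t ->
  \sum_(i < L) Num.min (2 / (t * 2 ^+ i)) (8 * (t * 2 ^+ i)) <= 20.
Proof.
move=> t0.
suff : if t < 1 then \sum_(i < L) Num.min (2 / (t * 2 ^+ i)) (8 * (t * 2 ^+ i)) <= 20 - 8 * t
    else \sum_(i < L) Num.min (2 / (t * 2 ^+ i)) (8 * (t * 2 ^+ i)) <= 4 / t.
  case: ifPn => [_ h|]; first by apply: (le_trans h); lra.
  rewrite -leNgt => t1 h; apply: (le_trans h).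
  by rewrite ler_pdivrMr//; lra.
elim: L t t0 => [|L IH] t t0.
  rewrite !big_ord0; case: ifP => t1; first by lra.
  by rewrite divr_ge0// ltW.
rewrite !big_ord_recl/= expr0 mulr1.
have -> : \sum_(i < L) Num.min (2 / (t * 2 ^+ bump 0 i)) (8 * (t * 2 ^+ bump 0 i)) =
    \sum_(i < L) Num.min (2 / (2 * t * 2 ^+ i)) (8 * (2 * t * 2 ^+ i)).
  by apply: eq_bigr => i _; rewrite /bump/= add1n exprS mulrA (mulrC t 2).
set S := \sum_(i < L) _.
have := IH (2 * t) ltac:(lra); rewrite -/S.
have m1 : Num.min (2 / t) (8 * t) <= 8 * t by rewrite ge_min lexx orbT.
have m2 : Num.min (2 / t) (8 * t) <= 2 / t by rewrite ge_min lexx.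
have e4 : 4 / (2 * t) = 2 / t by field; rewrite gt_eqF.
have e4' : 4 / t = 2 / t + 2 / t by field; rewrite gt_eqF.
case: ifP => t2; case: ifP => t1 h.
- lra.
- by move/negbT: t1; rewrite -leNgt; lra.
- have : 2 / t <= 4.
    by rewrite ler_pdivrMr//; move/negbT: t2; rewrite -leNgt; lra.
  by rewrite e4 in h; lra.
- by rewrite e4 in h; rewrite e4'; lra.
Qed.

Section dyadic_scale.
Context {R : realType} {n : nat}.
Local Notation V := 'rV[R]_n.

Definition ball_cube (r : R) (r0 : 0 < r) : cube R n :=
  centered_cube (0 : V) (mulr_gt0 (ltr0n R 2) r0).

Lemma ball_cubeP r (r0 : 0 < r) z : cube_set (ball_cube r0) z <-> `|z| <= r.
Proof.
have h : 2 * r / 2 = r by field.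
rewrite -{2}h; split=> [/centered_cubeP|H]; first by rewrite subr0.
by apply/centered_cubeP; rewrite subr0.
Qed.

(** Smallness is assumed for cubes having a far point; this point makes it available for centred
    cubes of large radius. *)
Lemma ball_cube_far r (r0 : 0 < r) : (0 < n)%N ->
  exists2 z, cube_set (ball_cube r0) z & `|z| = r.
Proof.
move=> n0; pose z : V := const_mx r.
have zr : `|z| <= r.
  by apply/rV_norm_le => [|i]; [exact: ltW|rewrite mxE gtr0_norm].
exists z; first exact/ball_cubeP.
apply/eqP; rewrite eq_le zr/=.
by have := coord_le_norm z (Ordinal n0); rewrite mxE gtr0_norm.
Qed.

Lemma ball_cube_sub r s (r0 : 0 < r) (s0 : 0 < s) : r <= s ->
  cube_set (ball_cube r0) `<=` cube_set (ball_cube s0).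
Proof. by move=> rs z /ball_cubeP zr; apply/ball_cubeP; exact: le_trans rs. Qed.

Lemma mean_ball_cube_dist (k : V -> R) (e N r s : R) (r0 : 0 < r) (s0 : 0 < s) :
  (0 < n)%N -> continuous k -> 0 < e -> 0 < N ->
  (forall Q z, cube_set Q z -> N <= `|z| -> mosc Q k <= e) ->
  r <= s -> N <= s ->
  `|mean (ball_cube r0) k - mean (ball_cube s0) k| <= (s / r) ^+ n * e.
Proof.
move=> n_gt0 ck e0 N0 He rs Ns; apply: (le_trans (mean_subcube_dist ck (@ball_cube_sub _ _ r0 s0 rs))).
have -> : side (ball_cube s0) / side (ball_cube r0) = s / r.
  by rewrite /= -mulf_div divff ?mul1r.
rewrite ler_wpM2l ?exprn_ge0 ?divr_ge0 ?(ltW s0) ?(ltW r0)//.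
have [z zD zs] := ball_cube_far s0 n_gt0.
by apply: (He _ _ zD); rewrite zs.
Qed.

Definition double_cube (Q : cube R n) : cube R n :=
  Cube (corner Q) (mulr_gt0 (ltr0n R 2) (side_gt0 Q)).

Lemma double_cube_sub Q : cube_set Q `<=` cube_set (double_cube Q).
Proof.
move=> z Qz i; have /andP[h1 h2] := Qz i; rewrite /= h1/=.
by apply: (le_trans h2); rewrite lerD2l ler_peMl ?ler1n// ltW// side_gt0.
Qed.

Lemma eq_mean (Q : cube R n) (h g : V -> R) : continuous h -> continuous g ->
  (forall z, cube_set Q z -> h z = g z) -> mean Q h = mean Q g.
Proof.
move=> ch cg hg; apply/eqP; rewrite eq_le; apply/andP; split.
  by apply: (le_mean ch cg) => z Qz; rewrite hg.
by apply: (le_mean cg ch) => z Qz; rewrite hg.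
Qed.

Lemma eq_mosc (Q : cube R n) (h g : V -> R) : continuous h -> continuous g ->
  (forall z, cube_set Q z -> h z = g z) -> mosc Q h = mosc Q g.
Proof.
move=> ch cg hg; rewrite /mosc (eq_mean ch cg hg).
by apply: eq_mean => [||z Qz]; [exact: continuous_dev|exact: continuous_dev|rewrite hg].
Qed.

Lemma mean_dist_le (Q : cube R n) (h : V -> R) (c : R) : continuous h ->
  mean Q (fun z => `|h z - c|) <= mosc Q h + `|mean Q h - c|.
Proof.
move=> ch; have cd := continuous_dev (c := mean Q h) ch.
have cc := @continuous_cst R V `|mean Q h - c|.
rewrite -[in leRHS](mean_cst Q `|mean Q h - c|) -meanD//.
apply: le_mean; [exact: continuous_dev|exact: continuous_add|].
by move=> z _; exact: ler_distD.
Qed.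

Local Notation G := (2 * (8 ^+ n + 4 ^+ n) : R).

(** Q is doubled until its side reaches r, always keeping the far point z2 and the point z1 that
    ties it to the ball of radius 4 r. The growth so obtained is logarithmic in r / [side Q], but a
    linear bound suffices, as it is later multiplied by [side Q] / r. The constant G is twice the
    error of one step, which lets the halved bound of the doubled cube absorb it. *)
Lemma mean_descent (k : V -> R) (e N r : R) (r0 : 0 < r) (m : nat) Q z1 z2 :
  (0 < n)%N -> continuous k -> 0 < e -> 0 < N ->
  (forall Q z, cube_set Q z -> N <= `|z| -> mosc Q k <= e) ->
  N <= r ->
  side Q <= 2 * r -> r <= 2 ^+ m * side Q ->
  cube_set Q z1 -> `|z1| <= 2 * r -> cube_set Q z2 -> r <= `|z2| ->
  side Q * `|mean Q k - mean (ball_cube r0) k| <= G * e * r.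
Proof.
move=> n_gt0 ck e0 N0 He Nr; set c := mean (ball_cube r0) k.
have p8 : 0 <= 8 ^+ n :> R by rewrite exprn_ge0.
have p4 : 0 <= 4 ^+ n :> R by rewrite exprn_ge0.
have base (P : cube R n) : r <= side P -> side P <= 2 * r -> cube_set P z1 ->
    `|z1| <= 2 * r -> side P * `|mean P k - c| <= G * e * r.
  move=> rP Pr Pz1 z1r.
  have r40 : 0 < 4 * r by rewrite mulr_gt0.
  have PD : cube_set P `<=` cube_set (ball_cube r40).
    move=> z Pz; apply/ball_cubeP; rewrite -[z](subrK z1).
    apply: (le_trans (rV_normD _ _)); have := cube_diam Pz Pz1.
    by move: z1r Pr => h1 h2 h3; apply: (le_trans (lerD h3 h1)); move: h2; clear; lra.
  have h1 : `|mean P k - mean (ball_cube r40) k| <= 8 ^+ n * e.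
    apply: (le_trans (mean_subcube_dist ck PD)).
    apply: ler_pM => //; first by rewrite exprn_ge0// divr_ge0// ltW// side_gt0.
    - exact: mosc_ge0.
    - have h : side (ball_cube r40) / side P <= 8.
        by rewrite ler_pdivrMr ?side_gt0//=; move: rP; clear; lra.
      by apply: lerXn2r => //; rewrite nnegrE ?divr_ge0// ltW// side_gt0.
    have [z zD zs] := ball_cube_far r40 n_gt0; apply: (He _ _ zD); rewrite zs.
    by move: Nr (r0); clear; lra.
  have h2 : `|c - mean (ball_cube r40) k| <= 4 ^+ n * e.
    have -> : 4 ^+ n = (4 * r / r) ^+ n :> R by rewrite mulfK// gt_eqF.
    by apply: (@mean_ball_cube_dist k e N r (4 * r) r0 r40 n_gt0 ck e0 N0 He); move: Nr (r0); clear; lra.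
  have h3 : `|mean P k - c| <= (8 ^+ n + 4 ^+ n) * e.
    rewrite mulrDl; apply: (le_trans (ler_distD (mean (ball_cube r40) k) _ _)).
    by apply: lerD => //; rewrite distrC.
  have -> : G * e * r = 2 * r * ((8 ^+ n + 4 ^+ n) * e) by ring.
  by apply: ler_pM => //; rewrite ltW// side_gt0.
elim: m Q => [|m IH] Q Qr rQ Qz1 z1r Qz2 z2r.
  by apply: base => //; rewrite expr0 mul1r in rQ.
have [rl|lr] := leP r (side Q); first exact: base.
have QQ := @double_cube_sub Q.
have s2 : side (double_cube Q) <= 2 * r by rewrite /= ler_pM2l// ltW.
have rs : r <= 2 ^+ m * side (double_cube Q) by rewrite /= mulrA -exprSr.
have := IH _ s2 rs (QQ _ Qz1) z1r (QQ _ Qz2) z2r.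
have e2 : `|mean Q k - mean (double_cube Q) k| <= 2 ^+ n * e.
  apply: (le_trans (mean_subcube_dist ck QQ)).
  rewrite /= mulfK ?gt_eqF ?side_gt0// ler_wpM2l ?exprn_ge0//.
  by apply: (He _ _ (QQ _ Qz2)); apply: le_trans z2r.
rewrite /=; set a := `|mean (double_cube Q) k - c| => ha.
have l0 := side_gt0 Q.
have tri : `|mean Q k - c| <= 2 ^+ n * e + a.
  by apply: (le_trans (ler_distD (mean (double_cube Q) k) _ _)); rewrite lerD2r.
have p24 : 2 ^+ n * e <= (8 ^+ n + 4 ^+ n) * e.
  apply: ler_wpM2r; first exact: ltW.
  apply: (@le_trans _ _ (4 ^+ n)); last by rewrite lerDr.
  by apply: lerXn2r; rewrite ?nnegrE// ler_nat.
have GE : G * e * r = 2 * (r * ((8 ^+ n + 4 ^+ n) * e)) by ring.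
have t1 : side Q * (2 ^+ n * e) <= r * ((8 ^+ n + 4 ^+ n) * e).
  by apply: ler_pM => //; rewrite ?mulr_ge0 ?exprn_ge0// ltW.
apply: (le_trans (ler_wpM2l (ltW l0) tri)).
move: t1 ha; rewrite GE mulrDr -mulrA; clear.
set x := side Q * a; set y := r * _; set w := side Q * _; clearbody x y w; lra.
Qed.

(** It dominates 1 + 2 * (4^n * (1 + 2^n)), arising for cubes of side at least r, and 3 + 2 * G,
    arising for small cubes in the transition region of the cutoff. *)
Definition scale_constant : R :=
  3 + 2 * (4 ^+ n * (1 + 2 ^+ n)) + 2 * G.

(** Four positions of Q: inside the ball of radius r the function vanishes; a cube of side at least
    r sees the removed part as supported in the ball of radius 2 r; a small cube off that ball sees
    only k - c; and a small cube in between pays for the slope of the cutoff. *)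
Lemma mosc_far_part (k : V -> R) (e N r : R) (r0 : 0 < r) Q :
  (0 < n)%N -> continuous k -> 0 < e -> 0 < N ->
  (forall Q z, cube_set Q z -> N <= `|z| -> mosc Q k <= e) ->
  N <= r ->
  mosc Q (fun z => (1 - theta r z) * (k z - mean (ball_cube r0) k)) <=
    scale_constant * e.
Proof.
move=> n_gt0 ck e0 N0 He Nr; set c := mean (ball_cube r0) k; pose a z := k z - c.
have p8 : 0 <= 8 ^+ n :> R by rewrite exprn_ge0.
have p4 : 0 <= 4 ^+ n :> R by rewrite exprn_ge0.
have p2 : 0 <= 2 ^+ n :> R by rewrite exprn_ge0.
have G0 : 0 <= G by rewrite mulr_ge0// addr_ge0.
have p42 : 0 <= 4 ^+ n * (1 + 2 ^+ n) :> R by rewrite mulr_ge0// addr_ge0.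
have sc0 : 0 <= scale_constant by rewrite /scale_constant !addr_ge0// mulr_ge0.
have l0 := side_gt0 Q.
have ca : continuous a by apply: continuous_sub => //; exact: continuous_cst.
have ct := @continuous_theta R n _ r0.
have c1t : continuous (fun z : V => 1 - theta r z).
  by apply: continuous_sub => //; exact: continuous_cst.
have caa : continuous (fun z => `|a z|) by exact: continuous_abs.
have [[z2 Qz2 z2r]|near0] := pselect (exists2 z, cube_set Q z & r <= `|z|); last first.
  apply: (@le_trans _ _ 0); last by rewrite mulr_ge0// ltW.
  rewrite -(mulr0 2); apply: (@mosc_le_sup _ _ _ _ 0); first exact: continuous_mul.
  move=> z Qz; rewrite theta_eq1// ?subrr ?mul0r ?subr0 ?normr0//.
  by rewrite leNgt; apply/negP => zr; apply: near0; exists z => //; exact: ltW.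
have mk : mosc Q k <= e by apply: (He _ _ Qz2); exact: le_trans z2r.
have ma : mosc Q a <= e by rewrite mosc_shift.
have [rl|lr] := leP r (side Q).
  have cta : continuous (fun z => theta r z * a z) by exact: continuous_mul.
  have -> : (fun z => (1 - theta r z) * (k z - c)) = (fun z => a z - theta r z * a z).
    by apply/funext => z; rewrite /a; ring.
  apply: (le_trans (moscB Q ca cta)).
  have r20 : 0 < 2 * r by rewrite mulr_gt0.
  (* The product is supported in the ball of radius 2 r, so its mean over Q is at most 4^n times its
     mean there, where k differs from c by O(e) on average. *)
  have mta : mean Q (fun z => `|theta r z * a z - 0|) <= 4 ^+ n * (1 + 2 ^+ n) * e.
    have cf : continuous (fun z => `|theta r z * a z - 0|) by exact: continuous_dev.
    apply: (le_trans (@mean_support _ _ Q (ball_cube r20) _ cf _ _)) => //.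
      move=> z zD; rewrite theta_eq0 ?mul0r ?subrr ?normr0//.
      by rewrite leNgt; apply/negP => zr; apply: zD; apply/ball_cubeP; exact: ltW.
    rewrite -mulrA; apply: ler_pM.
    - by rewrite exprn_ge0// divr_ge0// ltW// side_gt0.
    - exact: mean_ge0.
    - have h : side (ball_cube r20) / side Q <= 4.
        by rewrite ler_pdivrMr//=; move: rl; clear; lra.
      by apply: lerXn2r => //; rewrite nnegrE ?divr_ge0// ltW// side_gt0.
    apply: (@le_trans _ _ (mean (ball_cube r20) (fun z => `|a z|))).
      apply: le_mean => // z _; rewrite subr0 normrM ler_piMl//.
      by rewrite ger0_norm ?theta_ge0// theta_le1.
    have [z zD zs] := ball_cube_far r20 n_gt0.
    have N2r : N <= 2 * r by move: Nr (r0); clear; lra.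
    have mD : mosc (ball_cube r20) k <= e by apply: (He _ _ zD); rewrite zs.
    have dD : `|c - mean (ball_cube r20) k| <= 2 ^+ n * e.
      have -> : 2 ^+ n = (2 * r / r) ^+ n :> R by rewrite mulfK// gt_eqF.
      by apply: (@mean_ball_cube_dist k e N r (2 * r) r0 r20 n_gt0 ck e0 N0 He); move: Nr (r0); clear; lra.
    apply: (le_trans (mean_dist_le _ c ck)).
    by rewrite distrC [leRHS]mulrDl mul1r lerD.
  have h := mosc_le Q 0 cta.
  have e0' := ltW e0.
  have h1 : 0 <= (2 + 2 * G) * e by rewrite mulr_ge0// addr_ge0// mulr_ge0.
  have -> : scale_constant * e = e + 2 * (4 ^+ n * (1 + 2 ^+ n) * e) + (2 + 2 * G) * e.
    by rewrite /scale_constant; ring.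
  apply: (@le_trans _ _ (e + 2 * (4 ^+ n * (1 + 2 ^+ n) * e))); last by rewrite lerDl.
  by apply: lerD => //; apply: (le_trans h); rewrite ler_pM2l.
have [[z1 Qz1 z1r]|far0] := pselect (exists2 z, cube_set Q z & `|z| <= 2 * r); last first.
  have ctc : continuous (fun z => (1 - theta r z) * a z) by exact: continuous_mul.
  apply: (@le_trans _ _ e); last first.
    rewrite ler_peMl//; first exact: ltW.
    rewrite /scale_constant; move: p42 G0; clear.
    by set x := 4 ^+ n * _; set y := G; clearbody x y; lra.
  apply: le_trans ma; rewrite (@eq_mosc Q _ a)// => z Qz.
  rewrite theta_eq0 ?subr0 ?mul1r// leNgt; apply/negP => zr; apply: far0.
  by exists z => //; exact: ltW.
(* Freezing the cutoff at a point of Q leaves an error of size [side Q] / r times |k - c|, which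
   exactly compensates the growth allowed by [mean_descent]. *)
pose z0 := corner Q; have Qz0 := corner_in Q.
pose t (z : V) := theta r z0 - theta r z.
have ctt : continuous t by apply: continuous_sub => //; exact: continuous_cst.
have cta : continuous (fun z => t z * a z) by exact: continuous_mul.
have cza : continuous (fun z => (1 - theta r z0) * a z).
  by apply: continuous_mul => //; exact: continuous_cst.
have -> : (fun z => (1 - theta r z) * (k z - c)) =
    (fun z => (1 - theta r z0) * a z + t z * a z).
  by apply/funext => z; rewrite /a /t; ring.
apply: (le_trans (moscD Q cza cta)).
have h1 : mosc Q (fun z => (1 - theta r z0) * a z) <= e.
  rewrite moscZ//; apply: le_trans ma; apply: ler_piMl; first exact: mosc_ge0.
  by rewrite ger0_norm ?subr_ge0 ?theta_le1// gerBl theta_ge0.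
have lr0 : 0 <= side Q / r by rewrite divr_ge0// ltW.
have maa : mean Q (fun z => `|a z|) <= e + `|mean Q k - c|.
  exact: (le_trans (mean_dist_le Q c ck) (lerD mk (lexx _))).
have h2 : mosc Q (fun z => t z * a z) <= 2 * (side Q / r * (e + `|mean Q k - c|)).
  apply: (le_trans (mosc_le Q 0 cta)); rewrite ler_pM2l//.
  apply: (@le_trans _ _ (mean Q (fun z => side Q / r * `|a z|))).
    apply: le_mean.
    - exact: continuous_dev.
    - by apply: continuous_mul => //; exact: continuous_cst.
    move=> z Qz; rewrite subr0 normrM ler_wpM2r//.
    apply: (le_trans (theta_lipschitz _ _ r0)); rewrite ler_pM2r ?invr_gt0//.
    exact: cube_diam.
  by rewrite meanZ//; exact: ler_wpM2l.
have [m rm] : exists m : nat, r <= 2 ^+ m * side Q.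
  exists (Num.bound (r / side Q)); rewrite -ler_pdivrMr// ltW//.
  have h := archi_boundP (divr_ge0 (ltW r0) (ltW l0)).
  by apply: (lt_le_trans h); rewrite -natrX ler_nat ltnW// ltn_expl.
have l2r : side Q <= 2 * r by move: lr (r0); clear; lra.
have hd := mean_descent r0 n_gt0 ck e0 N0 He Nr l2r rm Qz1 z1r Qz2 z2r.
have h3 : side Q / r * (e + `|mean Q k - c|) <= e + G * e.
  rewrite mulrDr; apply: lerD.
    by rewrite ler_piMl ?(ltW e0)// ler_pdivrMr// mul1r ltW.
  by rewrite mulrAC ler_pdivrMr.
apply: (le_trans (lerD h1 (le_trans h2 (ler_wpM2l (ler0n _ 2) h3)))).
have h4 : 0 <= 2 * (4 ^+ n * (1 + 2 ^+ n)) * e by rewrite !mulr_ge0// ltW.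
have -> : scale_constant * e = 2 * (4 ^+ n * (1 + 2 ^+ n)) * e + (e + 2 * (e + G * e)).
  by rewrite /scale_constant; ring.
by rewrite lerDr.
Qed.

End dyadic_scale.

Arguments scale_constant : clear implicits.

(** * Averaging cutoffs over dyadic scales *)

Section mosc_cutoff.
Context {R : realType} {n : nat}.
Local Notation V := 'rV[R]_n.

Lemma continuous_sumr m (f : nat -> V -> R) : (forall i, continuous (f i)) ->
  continuous (fun z => \sum_(i < m) f i z).
Proof.
move=> cf; elim: m => [|m IH].
  by under eq_fun do rewrite big_ord0; exact: continuous_cst.
by under eq_fun do rewrite big_ord_recr/=; exact: continuous_add.
Qed.

Lemma mosc_sum (Q : cube R n) m (f : nat -> V -> R) : (forall i, continuous (f i)) ->
  mosc Q (fun z => \sum_(i < m) f i z) <= \sum_(i < m) mosc Q (f i).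
Proof.
move=> cf; elim: m => [|m IH].
  rewrite big_ord0; under [X in mosc Q X]eq_fun do rewrite big_ord0.
  by rewrite mosc_cst.
under [X in mosc Q X]eq_fun do rewrite big_ord_recr/=.
rewrite big_ord_recr/=; apply: (le_trans (moscD _ _ _)) => //.
  exact: continuous_sumr.
by rewrite lerD2r.
Qed.

Lemma mosc_rsub (Q : cube R n) (c : R) (h : V -> R) : continuous h ->
  mosc Q (fun z => c - h z) = mosc Q h.
Proof.
move=> ch; rewrite -(moscN Q ch) -(mosc_shift Q (- c) (continuous_opp ch)).
by congr mosc; apply/funext => z; rewrite opprK addrC.
Qed.

(** Small cubes see the slope 1 / r, large cubes see a support filling a small fraction of them.
    Both bounds decay geometrically away from the scale r = [side Q], which makes the sum over
    dyadic r bounded. *)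
Lemma mosc_theta (Q : cube R n) (r : R) : (0 < n)%N -> 0 < r ->
  mosc Q (theta r) <= Num.min (2 / (r / side Q)) (8 * (r / side Q)).
Proof.
move=> n0 r0; have l0 := side_gt0 Q; have ct := @continuous_theta R n _ r0.
rewrite le_min; apply/andP; split.
  have -> : 2 / (r / side Q) = 2 * (side Q / r) by rewrite invf_div.
  apply: (mosc_le_sup (c := theta r (corner Q))) => // z Qz.
  apply: (le_trans (theta_lipschitz _ _ r0)); rewrite ler_pM2r ?invr_gt0//.
  by apply: cube_diam => //; exact: corner_in.
apply: (le_trans (mosc_le Q 0 ct)).
have -> : 8 * (r / side Q) = 2 * (2 * (2 * r) / side Q) by ring.
rewrite ler_pM2l//; apply: mean_ball_le => //; first by rewrite mulr_gt0.
- exact: continuous_dev.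
- by move=> z; rewrite subr0 ger0_norm ?theta_ge0 ?theta_le1.
- by move=> z zr; rewrite subr0 theta_eq0 ?normr0.
Qed.

Definition cutoff_constant : R := scale_constant R n + 20 * (2 ^+ n + 1).

(** The cutoff is built from A, e and N before k is given. For each scale, k is split into k - c i
    and its mean c i: the first part costs O(e), the second costs |c i| times the oscillation of the
    cutoff, and these oscillations sum to at most 20 over all scales before the division by their
    number. *)
Lemma mosc_cutoff (A e N : R) : (0 < n)%N -> 0 <= A -> 0 < e -> 0 < N ->
  exists (eta : V -> R) (S : R), [/\ 0 < S,
    forall z, 0 <= eta z <= 1,
    forall z, S <= `|z| -> eta z = 0,
    forall z w, `|eta z - eta w| <= `|z - w| &
    forall k, continuous k -> (forall Q, mosc Q k <= A) ->
      (forall Q z, cube_set Q z -> N <= `|z| -> mosc Q k <= e) ->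
      mean (ball_cube (ltr01 : 0 < 1 :> R)) k = 0 ->
      forall Q, mosc Q (fun z => (1 - eta z) * k z) <= cutoff_constant * e].
Proof.
move=> n0 A0 e0 N0.
have [J NJ] : exists J : nat, N <= 2 ^+ J :> R.
  exists (Num.bound N); rewrite ltW//; apply: (lt_le_trans (archi_boundP (ltW N0))).
  by rewrite -natrX ler_nat ltnW// ltn_expl.
(* Bounds the mean at the first scale: the mean on the unit ball is 0, and passing to radius 2^J
   costs the volume ratio times A. *)
pose B : R := (2 ^+ J) ^+ n * A.
have B0 : 0 <= B by rewrite mulr_ge0// exprn_ge0.
(* Enough scales for B to be negligible after averaging. *)
have [m Bm] : exists m : nat, B / m.+1%:R <= e.
  exists (Num.bound (B / e)); rewrite ler_pdivrMr// mulrC -ler_pdivrMr// ltW//.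
  by apply: (lt_trans (archi_boundP (divr_ge0 B0 (ltW e0)))); rewrite ltr_nat.
pose r i : R := 2 ^+ (J + i).
have r0 i : 0 < r i by rewrite exprn_gt0.
have r1 i : 1 <= r i by rewrite exprn_ege1// ler1n.
have Nr i : N <= r i.
  by apply: (le_trans NJ); rewrite /r exprD ler_peMr ?exprn_ge0// exprn_ege1// ler1n.
have rm i : (i <= m)%N -> r i <= r m.
  by move=> im; rewrite ler_weXn2l ?ler1n// leq_add2l.
pose M : R := m.+1%:R; have M0 : 0 < M by rewrite ltr0n.
have sumM (c : R) : \sum_(i < m.+1) c = M * c.
  by rewrite sumr_const card_ord -mulr_natl.
pose eta (z : V) := M^-1 * \sum_(i < m.+1) theta (r i) z.
exists eta, (2 * r m); split.
- by rewrite mulr_gt0.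
- move=> z; apply/andP; split.
    by rewrite mulr_ge0 ?invr_ge0 ?(ltW M0)// sumr_ge0// => i _; exact: theta_ge0.
  rewrite /eta mulrC ler_pdivrMr// mul1r -[leRHS]mulr1 -sumM.
  by apply: ler_sum => i _; exact: theta_le1.
- move=> z zS; rewrite /eta big1 ?mulr0// => i _; rewrite theta_eq0//.
  by apply: le_trans zS; rewrite ler_pM2l// rm// -ltnS.
- move=> z w; rewrite /eta -mulrBr -sumrB normrM ger0_norm ?invr_ge0 ?(ltW M0)//.
  rewrite mulrC ler_pdivrMr// mulrC -sumM.
  apply: (le_trans (ler_norm_sum _ _ _)); apply: ler_sum => i _.
  apply: (le_trans (theta_lipschitz _ _ (r0 i))).
  by rewrite ler_pdivrMr// ler_peMr.
move=> k ck kA He k0 Q.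
pose c i := mean (ball_cube (r0 i)) k.
have c0 : `|c 0%N| <= B.
  rewrite -[c _]subr0 -k0 distrC /c.
  have := mean_subcube_dist ck (@ball_cube_sub _ _ 1 (r 0%N) ltr01 (r0 0%N) (r1 _)).
  have -> : side (ball_cube (n := n) (r0 0%N)) / side (ball_cube (n := n) (ltr01 : 0 < 1 :> R)) = 2 ^+ J.
    by rewrite /= mulr1 mulrAC divff ?pnatr_eq0// mul1r /r addn0.
  by move=> h; apply: (le_trans h); rewrite ler_wpM2l ?exprn_ge0.
(* Beyond N each doubling of the radius moves the mean by at most 2^n e, so the means grow linearly
   in the number of scales, with slope proportional to e. *)
have ci i : `|c i| <= B + i%:R * (2 ^+ n * e).
  elim: i => [|i IH]; first by rewrite mul0r addr0.
  have rS : r i.+1 = 2 * r i by rewrite /r addnS exprS.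
  have h := @mean_ball_cube_dist _ _ k e N (r i) (r i.+1) (r0 i) (r0 i.+1)
    n0 ck e0 N0 He _ (Nr _).
  have {}h : `|c i - c i.+1| <= 2 ^+ n * e.
    have -> : 2 ^+ n = (r i.+1 / r i) ^+ n :> R by rewrite rS mulfK// gt_eqF.
    by apply: h; rewrite rS ler_peMl ?ler1n// ltW.
  have := ler_distD (c i) (c i.+1) 0; rewrite !subr0 (distrC (c i.+1)) => t.
  apply: (le_trans t); rewrite -natr1 mulrDl mul1r addrA addrC.
  exact: lerD.
have cM (i : 'I_m.+1) : `|c i| <= B + M * (2 ^+ n * e).
  apply: (le_trans (ci i)); rewrite lerD2l ler_wpM2r ?mulr_ge0 ?exprn_ge0 ?(ltW e0)//.
  by rewrite ler_nat ltnW.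
have ct i := @continuous_theta R n _ (r0 i).
have c1t i : continuous (fun z : V => 1 - theta (r i) z).
  by apply: continuous_sub => //; exact: continuous_cst.
pose f i (z : V) := (1 - theta (r i) z) * (k z - c i).
pose g i (z : V) := c i * (1 - theta (r i) z).
have cf i : continuous (f i).
  by apply: continuous_mul => //; apply: continuous_sub => //; exact: continuous_cst.
have cg i : continuous (g i) by apply: continuous_mul => //; exact: continuous_cst.
have cfg i : continuous (fun z => f i z + g i z) by exact: continuous_add.
have -> : (fun z => (1 - eta z) * k z) =
    (fun z => M^-1 * \sum_(i < m.+1) (f i z + g i z)).
  apply/funext => z; rewrite -[1](@mulVf _ M) ?gt_eqF// -mulrBr -mulrA; congr (_ * _).
  rewrite -[M in LHS]mulr1 -sumM -sumrB mulr_suml; apply: eq_bigr => i _.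
  by rewrite /f /g; ring.
rewrite moscZ; last exact: (continuous_sumr cfg).
rewrite ger0_norm ?invr_ge0 ?(ltW M0)// mulrC ler_pdivrMr//.
apply: (le_trans (mosc_sum Q m.+1 cfg)).
have fi i : mosc Q (f i) <= scale_constant R n * e.
  exact: (@mosc_far_part _ _ k e N (r i) (r0 i) Q n0 ck e0 N0 He (Nr i)).
have gi i : mosc Q (g i) = `|c i| * mosc Q (theta (r i)).
  by rewrite (moscZ Q (c i) (c1t i)) (mosc_rsub Q 1 (ct i)).
have th : \sum_(i < m.+1) mosc Q (theta (r i)) <= 20.
  have t0 : 0 < 2 ^+ J / side Q by rewrite divr_gt0 ?exprn_gt0 ?side_gt0.
  apply: le_trans (dyadic_min_sum m.+1 t0); apply: ler_sum => i _.
  have -> : 2 ^+ J / side Q * 2 ^+ i = r i / side Q by rewrite /r exprD; ring.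
  exact: mosc_theta.
apply: (@le_trans _ _ (\sum_(i < m.+1) (scale_constant R n * e +
    (B + M * (2 ^+ n * e)) * mosc Q (theta (r i))))).
  apply: ler_sum => i _; apply: (le_trans (moscD Q (cf i) (cg i))).
  by rewrite gi; apply: lerD => //; apply: ler_wpM2r => //; exact: mosc_ge0.
rewrite big_split/= sumM -mulr_sumr.
have D0 : 0 <= B + M * (2 ^+ n * e).
  by rewrite addr_ge0// mulr_ge0 ?(ltW M0)// mulr_ge0 ?exprn_ge0 ?(ltW e0).
apply: (le_trans (lerD (lexx _) (ler_wpM2l D0 th))).
have BM : B <= M * e by move: Bm; rewrite ler_pdivrMr// mulrC.
have -> : cutoff_constant * e * M =
    M * (scale_constant R n * e) + (M * e + M * (2 ^+ n * e)) * 20.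
  by rewrite /cutoff_constant; ring.
by rewrite lerD2l ler_pM2r// lerD2r.
Qed.

End mosc_cutoff.

Arguments cutoff_constant : clear implicits.

(** * Locally Lipschitz functions and truncation *)

Section locally_lipschitz_algebra.
Context {R : realType} {d1 d2 : nat}.
Local Notation E := ('rV[R]_d1 * 'rV[R]_d2)%type.
Implicit Types f g : E -> R.

Lemma locally_lipschitz_ge0 f : locally_lipschitz f ->
  forall r, exists2 L, 0 <= L & forall p q, `|p| <= r -> `|q| <= r ->
    `|f p - f q| <= L * `|p - q|.
Proof.
move=> lf r; have [L HL] := lf r; exists `|L| => // p q pr qr.
by apply: (le_trans (HL p q pr qr)); rewrite ler_wpM2r// ler_norm.
Qed.

Lemma locally_lipschitz_bounded f : locally_lipschitz f ->
  forall r, exists2 M, 0 <= M & forall p, `|p| <= r -> `|f p| <= M.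
Proof.
move=> lf r; have [L L0 HL] := locally_lipschitz_ge0 lf `|r|.
exists (`|f 0| + L * `|r|); first by rewrite addr_ge0// mulr_ge0.
move=> p pr; have pr' : `|p| <= `|r| by exact: le_trans (ler_norm r).
have := HL p 0 pr'; rewrite normr0 subr0 => /(_ (normr_ge0 r)) h.
rewrite -[f p](subrK (f 0)); apply: (le_trans (ler_normD _ _)).
rewrite addrC lerD2l; apply: (le_trans h); exact: ler_wpM2l.
Qed.

Lemma locally_lipschitz_sub f g : locally_lipschitz f -> locally_lipschitz g ->
  locally_lipschitz (fun p => f p - g p).
Proof.
move=> lf lg r; have [L L0 HL] := locally_lipschitz_ge0 lf r.
have [K K0 HK] := locally_lipschitz_ge0 lg r; exists (L + K) => p q pr qr.
have -> : f p - g p - (f q - g q) = (f p - f q) - (g p - g q) by ring.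
apply: (le_trans (ler_normB _ _)); rewrite mulrDl.
exact: (lerD (HL _ _ pr qr) (HK _ _ pr qr)).
Qed.

Lemma locally_lipschitz_mul f g : locally_lipschitz f -> locally_lipschitz g ->
  locally_lipschitz (fun p => f p * g p).
Proof.
move=> lf lg r; have [L L0 HL] := locally_lipschitz_ge0 lf r.
have [K K0 HK] := locally_lipschitz_ge0 lg r.
have [M M0 HM] := locally_lipschitz_bounded lf r.
have [P P0 HP] := locally_lipschitz_bounded lg r.
exists (M * K + L * P) => p q pr qr.
have -> : f p * g p - f q * g q = f p * (g p - g q) + (f p - f q) * g q by ring.
apply: (le_trans (ler_normD _ _)); rewrite !normrM mulrDl; apply: lerD.
  rewrite -mulrA; apply: ler_pM => //; [exact: HM|exact: HK].
rewrite mulrAC; apply: ler_pM => //; [exact: HL|exact: HP].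
Qed.

Lemma locally_lipschitz_fst (f : 'rV[R]_d1 -> R) :
  (forall r, exists2 L, 0 <= L & forall x y, `|x| <= r -> `|y| <= r ->
    `|f x - f y| <= L * `|x - y|) ->
  locally_lipschitz (fun p : E => f p.1).
Proof.
move=> lf r; have [L L0 HL] := lf r; exists L => p q.
rewrite !prod_normE !ge_max => /andP[p1 _] /andP[q1 _].
by apply: (le_trans (HL _ _ p1 q1)); rewrite ler_wpM2l// le_max lexx.
Qed.

Lemma locally_lipschitz_snd (f : 'rV[R]_d2 -> R) :
  (forall r, exists2 L, 0 <= L & forall x y, `|x| <= r -> `|y| <= r ->
    `|f x - f y| <= L * `|x - y|) ->
  locally_lipschitz (fun p : E => f p.2).
Proof.
move=> lf r; have [L L0 HL] := lf r; exists L => p q.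
rewrite !prod_normE !ge_max => /andP[_ p1] /andP[_ q1].
by apply: (le_trans (HL _ _ p1 q1)); rewrite ler_wpM2l// le_max lexx orbT.
Qed.

(** Two points in the ball of radius S + 1 are handled by the local constant; a point within S and
    one beyond S + 1 are at distance at least 1, where the sup bound suffices. *)
Lemma locally_lipschitz_support f (S : R) : 0 < S -> locally_lipschitz f ->
  (forall p, S <= `|p| -> f p = 0) ->
  exists2 L, 0 < L & forall p q, `|f p - f q| <= L * `|p - q|.
Proof.
move=> S0 lf fS; have [L L0 HL] := locally_lipschitz_ge0 lf (S + 1).
have [M M0 HM] := locally_lipschitz_bounded lf S.
exists (L + M + 1); first by rewrite ltr_wpDl// addr_ge0.
have LLM (x : R) : 0 <= x -> L * x <= (L + M + 1) * x.
  by move=> x0; rewrite ler_wpM2r//; lra.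
have key p q : `|p| < S -> `|f p - f q| <= (L + M + 1) * `|p - q|.
  move=> pS; have [qS|qS] := leP `|q| (S + 1).
    apply: le_trans (LLM _ (normr_ge0 _)); apply: HL => //.
    by apply: (le_trans (ltW pS)); rewrite lerDl.
  rewrite (fS q) ?subr0; last by apply: le_trans (ltW qS); rewrite lerDl.
  apply: (le_trans (HM p (ltW pS))).
  have pq1 : 1 <= `|p - q|.
    have := ler_normD (q - p) p; rewrite subrK (distrC q) => h.
    by move: pS qS h; set a := `|p|; set b := `|q|; set c := `|p - q|;
      clearbody a b c; clear; lra.
  apply: (@le_trans _ _ (L + M + 1)); first by lra.
  by rewrite ler_peMr//; lra.
move=> p q; have [pS|pS] := ltP `|p| S; first exact: key.
have [qS|qS] := ltP `|q| S; first by rewrite distrC (distrC p); exact: key.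
by rewrite !fS// subrr normr0 mulr_ge0//; lra.
Qed.

(** The way back from slices to oscillations; the 2 is that of [pairs_le_mosc]. *)
Lemma slice_dist_osc_bound (alpha : R) f (k : R) (I : cube R d1) (J : cube R d2) :
  0 <= alpha -> 0 <= k -> locally_lipschitz f ->
  (forall x y, slice_dist f J x y <= k * `|x - y| `^ alpha) ->
  osc_bound alpha f I J (2 * k).
Proof.
move=> a0 k0 lf H; rewrite /osc_bound.
have mf : measurable_fun setT f.
  by apply: continuous_measurable_prod; exact: locally_lipschitz_continuous.
have K0 : 0 <= 2 * k * side I `^ alpha by rewrite mulr_ge0 ?powR_ge0// mulr_ge0.
rewrite -[leRHS](integral_prob_cst (pprod (unif I) (unif I))).
rewrite /ddosc; apply: le_integral_rect => //.
- exact: measurable_ddosc_in.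
- by move=> p; exact: integral_ge0.
move=> [x y] [/= Ix Iy].
apply: (@le_trans _ _ (2 * slice_dist f J x y)%:E).
  have h := pairs_le_mosc J (@continuous_slice_sub _ _ _ f lf x y).
  rewrite /slice_dist; apply: le_trans h.
  rewrite le_eqVlt; apply/orP; left; apply/eqP; apply: eq_integral => q _.
  by congr (_%:E); rewrite /ddiff/=; congr `|_|; ring.
rewrite lee_fin -mulrA ler_pM2l//; apply: (le_trans (H x y)).
by rewrite ler_wpM2l//; apply: powR_le => //; exact: cube_diam.
Qed.

End locally_lipschitz_algebra.

Lemma mosc_weighted_sub (R : realType) n (J : cube R n) (a b : R) (h g : 'rV[R]_n -> R) :
  continuous h -> continuous g ->
  mosc J (fun z => a * h z - b * g z) <=
    `|a| * mosc J (fun z => h z - g z) + `|a - b| * mosc J g.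
Proof.
move=> ch cg; have chg := continuous_sub ch cg.
rewrite -(moscZ J a chg) -(moscZ J (a - b) cg).
have cz (c : R) f : continuous f -> continuous (fun z : 'rV[R]_n => c * f z).
  by move=> cf; apply: continuous_mul => //; exact: continuous_cst.
have -> : (fun z => a * h z - b * g z) =
    (fun z => a * (h z - g z) + (a - b) * g z) by apply/funext => z; ring.
by apply: moscD; apply: cz.
Qed.

Lemma mosc_subC (R : realType) n (J : cube R n) (h g : 'rV[R]_n -> R) :
  continuous h -> continuous g ->
  mosc J (fun z => h z - g z) = mosc J (fun z => g z - h z).
Proof.
move=> ch cg; rewrite -(moscN J (continuous_sub cg ch)).
by congr mosc; apply/funext => z; rewrite opprB.
Qed.

Lemma theta_holder (R : realType) n (alpha r : R) (x y : 'rV[R]_n) :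
  0 < alpha < 1 -> 0 < r -> `|theta r x - theta r y| <= (`|x - y| / r) `^ alpha.
Proof.
move=> /andP[a0 a1] r0; have t0 : 0 <= `|x - y| / r by rewrite divr_ge0// ltW.
have [t1|t1] := leP 1 (`|x - y| / r).
  apply: (@le_trans _ _ 1).
    have := theta_ge0 r x; have := theta_ge0 r y; have := theta_le1 r x.
    by have := theta_le1 r y; rewrite ler_norml; clear; lra.
  by rewrite -[leLHS](powRr0 (`|x - y| / r)) ler_powR// ltW.
apply: (le_trans (theta_lipschitz x y r0)).
move: t0; rewrite le_eqVlt => /orP[/eqP <-|t0]; first exact: powR_ge0.
by apply: ger1_powR; [rewrite t0 ltW|exact: ltW].
Qed.

(** By symmetry |y| <= |x|. In phi x (h x - h y) + (phi x - phi y) h y the second term vanishes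
    unless |y| < 2 r, where h y has size at most B r^alpha and phi varies on the scale r. The weight
    is abstract in order to serve for both [theta r] and its complement. *)
Lemma mosc_truncation (R : realType) n m (alpha r k B : R) (J : cube R m)
    (phi : 'rV[R]_n -> R) (h : 'rV[R]_n -> 'rV[R]_m -> R) :
  0 < r -> 0 <= k -> (forall x, continuous (h x)) -> (forall x, 0 <= phi x <= 1) ->
  (forall x y, `|phi x - phi y| <= (`|x - y| / r) `^ alpha) ->
  (forall x y, 2 * r <= `|x| -> 2 * r <= `|y| -> phi x = phi y) ->
  (forall y, `|y| < 2 * r -> mosc J (h y) <= B * r `^ alpha) ->
  (forall x y, phi x != 0 ->
    mosc J (fun z => h x z - h y z) <= k * `|x - y| `^ alpha) ->
  forall x y, mosc J (fun z => phi x * h x z - phi y * h y z) <=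
    (k + B) * `|x - y| `^ alpha.
Proof.
move=> r0 k0 ch phi01 phiH phi_far hB hk.
have czh x : continuous (fun z => phi x * h x z).
  by apply: continuous_mul => //; exact: continuous_cst.
have key x y : `|y| <= `|x| -> mosc J (fun z => phi x * h x z - phi y * h y z) <=
    (k + B) * `|x - y| `^ alpha.
  move=> yx; apply: (le_trans (mosc_weighted_sub J _ _ (ch x) (ch y))).
  rewrite mulrDl; apply: lerD.
    have /andP[p0 p1] := phi01 x.
    have [->|px] := eqVneq (phi x) 0.
      by rewrite normr0 mul0r mulr_ge0// powR_ge0.
    rewrite (ger0_norm p0); apply: le_trans (hk x y px); apply: ler_piMl => //.
    by apply: mosc_ge0; exact: continuous_sub.
  have [yr|yr] := leP (2 * r) `|y|.
    rewrite (phi_far x y (le_trans yr yx) yr) subrr normr0 mul0r mulr_ge0 ?powR_ge0//.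
    have r00 : `|0 : 'rV[R]_n| < 2 * r by rewrite normr0 mulr_gt0.
    have := le_trans (mosc_ge0 J (ch 0)) (hB 0 r00).
    by rewrite pmulr_lge0// powR_gt0.
  have -> : B * `|x - y| `^ alpha = (`|x - y| / r) `^ alpha * (B * r `^ alpha).
    rewrite powRM ?invr_ge0 ?(ltW r0)// mulrACA [_ `^ _ * B]mulrC.
    rewrite -powRM ?invr_ge0 ?(ltW r0)//.
    by rewrite mulVf ?gt_eqF// powR1 mulr1.
  by apply: ler_pM => //; [exact: mosc_ge0|exact: hB].
move=> x y; have [yx|xy] := leP `|y| `|x|; first exact: key.
rewrite mosc_subC//; rewrite distrC; apply: key; exact: ltW.
Qed.

Section truncation.
Context {R : realType} {d1 d2 : nat}.
Local Notation E := ('rV[R]_d1 * 'rV[R]_d2)%type.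

Let Q0 : cube R d2 := ball_cube (ltr01 : 0 < 1 :> R).

(** Two functions of one variable are removed. Subtracting u(0, .) makes the slice at 0 vanish, so
    that each slice is bounded by its Hoelder distance to it; subtracting the mean over the unit
    ball supplies the normalisation demanded by [mosc_cutoff]. *)
Definition recentered (u : E -> R) (x : 'rV[R]_d1) (z : 'rV[R]_d2) : R :=
  u (x, z) - u (0, z) - mean Q0 (fun w => u (x, w) - u (0, w)).

Lemma continuous_recentered u x : locally_lipschitz u -> continuous (recentered u x).
Proof.
move=> lu; apply: continuous_sub; last exact: continuous_cst.
exact: (@continuous_slice_sub _ _ _ u lu).
Qed.

Lemma mosc_recentered_sub u (J : cube R d2) x y : locally_lipschitz u ->
  mosc J (fun z => recentered u x z - recentered u y z) = slice_dist u J x y.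
Proof.
move=> lu; rewrite /slice_dist.
rewrite -(mosc_shift J (mean Q0 (fun w => u (x, w) - u (0, w)) -
  mean Q0 (fun w => u (y, w) - u (0, w))) (@continuous_slice_sub _ _ _ u lu x y)).
by congr mosc; apply/funext => z; rewrite /recentered; ring.
Qed.

Lemma recentered0 u z : recentered u 0 z = 0.
Proof.
rewrite /recentered subrr; under eq_fun do rewrite subrr.
by rewrite mean_cst subr0.
Qed.

Lemma mosc_recentered u (J : cube R d2) y : locally_lipschitz u ->
  mosc J (recentered u y) = slice_dist u J y 0.
Proof.
move=> lu; rewrite -(mosc_recentered_sub J y 0 lu); congr mosc.
by apply/funext => z; rewrite recentered0 subr0.
Qed.

Lemma mean_recentered u x : locally_lipschitz u -> mean Q0 (recentered u x) = 0.
Proof.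
move=> lu; rewrite /recentered meanB; [|exact: (@continuous_slice_sub _ _ _ u lu)|].
  by rewrite mean_cst subrr.
exact: continuous_cst.
Qed.

Lemma recentered_locally_lipschitz u : locally_lipschitz u ->
  locally_lipschitz (fun p => recentered u p.1 p.2).
Proof.
move=> lu; rewrite /recentered; apply: locally_lipschitz_sub.
  apply: locally_lipschitz_sub; first by move=> r; have [L HL] := lu r;
    exists L => -[x z] [y w]; exact: HL.
  apply: (@locally_lipschitz_snd _ _ _ (fun z => u (0, z))) => r.
  have [L L0 HL] := locally_lipschitz_ge0 lu r; exists L => // z w zr wr.
  have n0 v : `|(0, v) : E| = `|v|.
    by rewrite prod_normE/= normr0; apply/max_idPr.
  have := HL (0, z) (0, w); rewrite !n0 => /(_ zr wr) h; apply: (le_trans h).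
  have -> : (0, z) - (0, w) = (0, z - w) :> E by congr pair; rewrite subrr.
  by rewrite n0.
apply: (@locally_lipschitz_fst _ _ _ (fun x => mean Q0 (fun w => u (x, w) - u (0, w)))) => r.
have [L L0 HL] := locally_lipschitz_ge0 lu (Num.max r 1).
exists L => // x y xr yr.
have cs a := @continuous_slice_sub _ _ _ u lu a.
rewrite -meanB//.
have cd := continuous_sub (cs x 0) (cs y 0).
apply: (le_trans (mean_abs Q0 cd)); apply: mean_le_cst; first exact: continuous_abs.
move=> z /ball_cubeP z1; rewrite opprB addrA subrK.
have h1 : `|(x, z) : E| <= Num.max r 1 by rewrite prod_normE ge_max !le_max xr z1 orbT.
have h2 : `|(y, z) : E| <= Num.max r 1 by rewrite prod_normE ge_max !le_max yr z1 orbT.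
apply: (le_trans (HL _ _ h1 h2)).
have -> : (x, z) - (y, z) = (x - y, 0) :> E by congr pair; rewrite subrr.
rewrite prod_normE/= normr0 ler_wpM2l// ge_max lexx/= normr_ge0//.
Qed.

End truncation.

Definition truncation_constant (R : realType) (d : nat) : R :=
  3 * (cutoff_constant R d + 1).

(** The remainder u - g consists, modulo functions of one variable, of the part cut off in x_1,
    which lives far out, and the part cut off in x_2. Both get a constant proportional to e, while A
    enters only the choice of the scales. *)
Lemma truncation (R : realType) d1 d2 (alpha A e N : R)
    (u : 'rV[R]_d1 * 'rV[R]_d2 -> R) :
  (0 < d2)%N -> 0 < alpha < 1 -> locally_lipschitz u -> 0 <= A -> 0 < e -> 0 < N ->
  slice_holder alpha u A e N ->
  exists (g : 'rV[R]_d1 * 'rV[R]_d2 -> R) (S : R), [/\ 0 < S, locally_lipschitz g,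
    forall p, S <= `|p| -> g p = 0 &
    forall J x y, slice_dist (fun p => u p - g p) J x y <=
      truncation_constant R d2 * e * `|x - y| `^ alpha].
Proof.
move=> n0 alpha01 lu A0 e0 N0 sh; have /andP[a0 a1] := alpha01.
have a0' := ltW a0; have e0' := ltW e0.
(* Near the origin the Hoelder constant is only A, but slices are measured from 0, so for |w| < N
   they are at most A N^alpha; r is chosen so large that this is below e r^alpha. *)
have [T T0 HT] := @powR_large _ alpha (A * N `^ alpha / e) a0.
pose r := N + T; have r0 : 0 < r by rewrite addr_gt0.
have Nr : N <= r by rewrite lerDl ltW.
have Ar : A * N `^ alpha <= e * r `^ alpha.
  have rT : T <= r by rewrite lerDr ltW.
  by have := HT r rT; rewrite ler_pdivrMr// [r `^ alpha * e]mulrC.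
have ra0 : 0 <= r `^ alpha by exact: powR_ge0.
have h2r B (y : 'rV[R]_d1) : 0 <= B -> `|y| < 2 * r -> B * `|y| `^ alpha <= 2 * B * r `^ alpha.
  move=> B0 yr; rewrite [2 * B]mulrC -mulrA ler_wpM2l//.
  by apply: le_trans (powR2_le a1 (ltW r0)); apply: powR_le => //; exact: ltW.
pose h := recentered u.
have ch x : continuous (h x) by exact: continuous_recentered.
have hsub J x y : mosc J (fun z => h x z - h y z) = slice_dist u J x y.
  exact: mosc_recentered_sub.
have h0 J y : mosc J (h y) = slice_dist u J y 0 by exact: mosc_recentered.
have t01 (x : 'rV[R]_d1) : 0 <= theta r x <= 1 by rewrite theta_ge0 theta_le1.
have tH (x y : 'rV[R]_d1) : `|theta r x - theta r y| <= (`|x - y| / r) `^ alpha.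
  exact: theta_holder.
have t_far (x y : 'rV[R]_d1) : 2 * r <= `|x| -> 2 * r <= `|y| -> theta r x = theta r y.
  by move=> xr yr; rewrite !theta_eq0.
pose H (x : 'rV[R]_d1) z := theta r x * h x z.
have cH x : continuous (H x) by apply: continuous_mul => //; exact: continuous_cst.
have HA J x y : mosc J (fun z => H x z - H y z) <= 3 * A * `|x - y| `^ alpha.
  have -> : 3 * A = A + 2 * A by ring.
  apply: (mosc_truncation r0 A0 ch t01 tH t_far) => [w wr|v w _].
    rewrite h0; have [hh _] := sh J w 0; rewrite subr0 in hh.
    exact: (le_trans hh (h2r A w A0 wr)).
  by rewrite hsub; have [] := sh J v w.
have Hfar J x y z : cube_set J z -> N <= `|z| ->
    mosc J (fun z => H x z - H y z) <= 3 * e * `|x - y| `^ alpha.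
  move=> Jz zN; have far v w : slice_dist u J v w <= e * `|v - w| `^ alpha.
    by have [_] := sh J v w; apply; apply: Or44; exists z.
  have -> : 3 * e = e + 2 * e by ring.
  apply: (mosc_truncation r0 e0' ch t01 tH t_far) => [w wr|v w _].
    by rewrite h0; have := far w 0; rewrite subr0 => hh; exact: (le_trans hh (h2r e w e0' wr)).
  by rewrite hsub.
(* Where psi is nonzero one has |x| > r >= N, hence the small constant. *)
pose psi (x : 'rV[R]_d1) := 1 - theta r x.
have Fe J x y : mosc J (fun z => psi x * h x z - psi y * h y z) <= 3 * e * `|x - y| `^ alpha.
  have -> : 3 * e = e + 2 * e by ring.
  apply: (mosc_truncation r0 e0' ch) => [v|v w|v w vr wr|w wr|v w].
  - by rewrite subr_ge0 theta_le1/= gerBl theta_ge0.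
  - have -> : psi v - psi w = theta r w - theta r v by rewrite /psi; ring.
    by rewrite distrC; exact: tH.
  - by rewrite /psi (t_far v w).
  - rewrite h0; have [hA he] := sh J w 0; rewrite subr0 in hA he.
    have [wN|wN] := leP N `|w|.
      by apply: (le_trans (he (Or41 _ _ _ wN))); exact: h2r.
    apply: (le_trans hA); apply: (@le_trans _ _ (A * N `^ alpha)).
      by rewrite ler_wpM2l//; apply: powR_le => //; exact: ltW.
    by apply: (le_trans Ar); rewrite -mulrA ler_peMl ?mulr_ge0// ler1n.
  - move=> pv; rewrite hsub; have [_] := sh J v w; apply; apply: Or41.
    rewrite leNgt; apply/negP => vN; move: pv; rewrite /psi theta_eq1 ?subrr ?eqxx//.
    exact: le_trans (ltW vN) Nr.
have A30 : 0 <= 3 * A by rewrite mulr_ge0.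
have e30 : 0 < 3 * e by rewrite mulr_gt0.
have [eta [S [S0 eta01 etaS etaL etaH]]] := mosc_cutoff n0 A30 e30 N0.
have ceta : continuous eta.
  by apply: (@lipschitz_continuous_rV _ _ _ 1) => z w; rewrite mul1r.
have ceta1 : continuous (fun z => 1 - eta z).
  by apply: continuous_sub => //; exact: continuous_cst.
have [c [cE c0]] : exists c : R, c = cutoff_constant R d2 /\ 0 <= c.
  exists (cutoff_constant R d2); split=> //; rewrite /cutoff_constant /scale_constant.
  by rewrite !addr_ge0 ?mulr_ge0 ?addr_ge0 ?exprn_ge0.
rewrite -cE in etaH.
have cutH J x y : mosc J (fun z => (1 - eta z) * (H x z - H y z)) <=
    3 * e * c * `|x - y| `^ alpha.
  have [->|xy] := eqVneq x y.
    under eq_fun do rewrite subrr mulr0.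
    by rewrite mosc_cst mulr_ge0 ?powR_ge0// mulr_ge0// ltW.
  have w0 : 0 < `|x - y| `^ alpha by rewrite powR_gt0// normr_gt0 subr_eq0.
  set w := `|x - y| `^ alpha in w0 *.
  (* [mosc_cutoff] is applied to the difference quotient: its cutoff is the same for all k with the
     given bounds, hence for all x and y. *)
  pose D z := H x z - H y z.
  have cD : continuous D by exact: continuous_sub.
  pose k z := w^-1 * D z.
  have ck : continuous k by apply: continuous_mul => //; exact: continuous_cst.
  have kE Q : mosc Q k = w^-1 * mosc Q D.
    by rewrite moscZ// ger0_norm// invr_ge0 ltW.
  have -> : (fun z => (1 - eta z) * (H x z - H y z)) = (fun z => w * ((1 - eta z) * k z)).
    apply/funext => z; rewrite /k /D mulrCA; congr (_ * _).
    by rewrite mulrA divff ?mul1r// gt_eqF.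
  rewrite moscZ; last exact: continuous_mul.
  rewrite (ger0_norm (ltW w0)) [leRHS]mulrC ler_pM2l// [3 * e * c]mulrC.
  apply: etaH => //.
  - by move=> Q; rewrite kE mulrC ler_pdivrMr//; exact: HA.
  - by move=> Q z Qz zN; rewrite kE mulrC ler_pdivrMr//; exact: (Hfar _ _ _ z).
  - rewrite meanZ// meanB// /H meanZ// meanZ// !mean_recentered//.
    by rewrite !mulr0 subrr mulr0.
pose g (p : 'rV[R]_d1 * 'rV[R]_d2) := eta p.2 * H p.1 p.2.
exists g, (2 * r + S); split.
- by rewrite addr_gt0// mulr_gt0.
- apply: locally_lipschitz_mul.
    by apply: locally_lipschitz_snd => s; exists 1 => // z w _ _; rewrite mul1r.
  apply: locally_lipschitz_mul; last exact: recentered_locally_lipschitz.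
  apply: locally_lipschitz_fst => s; exists r^-1 => [|z w _ _].
    by rewrite invr_ge0 ltW.
  by rewrite mulrC; exact: theta_lipschitz.
- move=> p; rewrite prod_normE le_max => /orP[] pS; rewrite /g /H.
    by rewrite theta_eq0 ?mul0r ?mulr0//; apply: le_trans pS; rewrite lerDl ltW.
  by rewrite etaS ?mul0r//; apply: le_trans pS; rewrite lerDr mulr_ge0// ltW.
move=> J x y.
pose m (x : 'rV[R]_d1) := mean (ball_cube (ltr01 : 0 < 1 :> R)) (fun w => u (x, w) - u (0, w)).
pose F z := psi x * h x z - psi y * h y z.
pose G z := (1 - eta z) * (H x z - H y z).
have cF : continuous F.
  by apply: continuous_sub; apply: continuous_mul => //; exact: continuous_cst.
have cG : continuous G by apply: continuous_mul => //; exact: continuous_sub.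
(* Here u = h + u(0, .) + m. The second term cancels between the slices at x and y, and m
   contributes a constant, which the mean oscillation ignores. *)
have -> : slice_dist (fun p => u p - g p) J x y = mosc J (fun z => F z + G z - (m y - m x)).
  rewrite /slice_dist; congr mosc; apply/funext => z.
  by rewrite /F /G /g /H /psi /h /recentered /= -!/(m _); ring.
rewrite (mosc_shift J _ (continuous_add cF cG)).
apply: (le_trans (moscD J cF cG)).
have -> : truncation_constant R d2 * e * `|x - y| `^ alpha =
    3 * e * `|x - y| `^ alpha + 3 * e * c * `|x - y| `^ alpha.
  by rewrite /truncation_constant cE; ring.
by apply: lerD; [exact: Fe|exact: cutH].
Qed.

(** * Smooth functions and a smooth step *)

Section Ck_algebra.
Context {R : realType} {E : normedModType R}.
Implicit Types (f g : E -> R) (k : nat).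

Lemma CkW k f : Ck k.+1 f -> Ck k f.
Proof.
elim: k f => [|k IH] f; first by case.
by move=> [cf Hf]; split=> // v; have [dv Cv] := Hf v; split=> //; exact: IH.
Qed.

Lemma Ck_cst k (c : R) : Ck k (fun _ : E => c).
Proof.
elim: k c => [|k IH] c; first exact: continuous_cst.
split=> [|v]; first exact: continuous_cst.
split=> [x|]; first exact: derivable_cst.
by rewrite (_ : 'D_v _ = (fun=> 0))//; apply/funext => x; exact: derive_cst.
Qed.

Lemma Ck_add k f g : Ck k f -> Ck k g -> Ck k (fun x => f x + g x).
Proof.
elim: k f g => [|k IH] f g; first exact: continuous_add.
move=> [cf Hf] [cg Hg]; split=> [|v]; first exact: continuous_add.
have [df Df] := Hf v; have [dg Dg] := Hg v.
split=> [x|]; first exact: (derivableD (df x) (dg x)).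
have -> : 'D_v (fun x => f x + g x) = (fun x => 'D_v f x + 'D_v g x).
  by apply/funext => x; exact: (deriveD (df x) (dg x)).
exact: IH.
Qed.

Lemma Ck_mul k f g : Ck k f -> Ck k g -> Ck k (fun x => f x * g x).
Proof.
elim: k f g => [|k IH] f g; first exact: continuous_mul.
move=> Cf Cg; have [cf Hf] := Cf; have [cg Hg] := Cg.
split=> [|v]; first exact: continuous_mul.
have [df Df] := Hf v; have [dg Dg] := Hg v.
split=> [x|]; first exact: (derivableM (df x) (dg x)).
have -> : 'D_v (fun x => f x * g x) = (fun x => f x * 'D_v g x + g x * 'D_v f x).
  by apply/funext => x; exact: (deriveM (df x) (dg x)).
by apply: Ck_add; apply: IH => //; exact: CkW.
Qed.

Lemma Ck_sum k n (f : 'I_n -> E -> R) : (forall i, Ck k (f i)) ->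
  Ck k (fun x => \sum_(i < n) f i x).
Proof.
elim: n f => [|n IH] f Cf.
  by under eq_fun do rewrite big_ord0; exact: Ck_cst.
under eq_fun do rewrite big_ord_recr/=.
by apply: Ck_add => //; apply: IH.
Qed.

Lemma continuous_inv f : (forall x, f x != 0) -> continuous f ->
  continuous (fun x => (f x)^-1).
Proof.
move=> f0 cf x; apply: (@continuous_comp _ _ _ f (fun y : R => y^-1) x); first exact: cf.
exact: inv_continuous.
Qed.

Lemma Ck_inv k f : (forall x, f x != 0) -> Ck k f -> Ck k (fun x => (f x)^-1).
Proof.
move=> f0; elim: k => [|k IH]; first exact: continuous_inv.
move=> Cf; have [cf Hf] := Cf; split=> [|v]; first exact: continuous_inv.
have [df Df] := Hf v; split=> [x|]; first exact: (derivableV (f0 x) (df x)).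
have -> : 'D_v (fun x => (f x)^-1) =
    (fun x => -1 * ((f x)^-1 * (f x)^-1) * 'D_v f x).
  apply/funext => x; rewrite (deriveV (f0 x) (df x)) /GRing.scale/=.
  by rewrite -exprVn expr2 mulN1r.
have Ci := IH (CkW Cf).
by apply: Ck_mul => //; apply: Ck_mul; [exact: Ck_cst|exact: Ck_mul].
Qed.

End Ck_algebra.

Section flat_exponential.
Context {R : realType}.
Implicit Types (q : {poly R}) (t : R).

(* The family is closed under differentiation, and its members vanish to
   infinite order at 0. *)
Definition flat_exp q t : R := if 0 < t then q.[t^-1] * expR (- t^-1) else 0.

(** With s = t^-1, the derivative in t of q(s) exp(-s) is s^2 (q(s) - q'(s)) exp(-s). *)
Definition flat_exp_deriv q : {poly R} := 'X^2 * (q - q^`()).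

Lemma horner_bound q : exists2 C, 0 <= C & forall s, 1 <= s ->
  `|q.[s]| <= C * s ^+ size q.
Proof.
elim/poly_ind: q => [|q c [C C0 HC]].
  by exists 0 => // s _; rewrite horner0 normr0 mul0r.
exists (C + `|c|) => [|s s1]; first by rewrite addr_ge0.
have s0 : 0 <= s by apply: le_trans s1.
rewrite hornerMXaddC; apply: (le_trans (ler_normD _ _)); rewrite normrM (ger0_norm s0).
have [q0|q0] := eqVneq q 0.
  rewrite q0 horner0 normr0 mul0r add0r.
  rewrite -[leLHS]mulr1; apply: ler_pM => //; first by rewrite lerDr.
  exact: exprn_ege1.
have -> : size (q * 'X + c%:P) = (size q).+1.
  by rewrite size_MXaddC (negbTE q0).
rewrite mulrDl; apply: lerD.
  by rewrite exprSr mulrA ler_wpM2r// HC.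
by rewrite ler_peMr// exprn_ege1.
Qed.

(** The bound exp(s) >= s^m / m! with m = [size q] + 2 beats the growth of q by s^2; quadratic decay
    in t = 1 / s forces the derivative at 0 to vanish. *)
Lemma flat_exp_small q : exists2 C, 0 <= C & forall t, t <= 1 ->
  `|flat_exp q t| <= C * t ^+ 2.
Proof.
have [C C0 HC] := horner_bound q.
pose m := (size q).+2; pose K : R := (m.-1.+1)`!%:R.
have K0 : 0 < K by rewrite ltr0n fact_gt0.
exists (C * K) => [|t t1]; first by rewrite mulr_ge0// ltW.
rewrite /flat_exp; case: ifPn => t0; last first.
  by rewrite normr0 mulr_ge0// ?sqr_ge0// mulr_ge0// ltW.
have s1 : 1 <= t^-1 by rewrite invf_ge1.
have s0 : 0 <= t^-1 by apply: le_trans s1.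
rewrite normrM (ger0_norm (expR_ge0 _)) expRN.
apply: (@le_trans _ _ (C * t^-1 ^+ size q * (expR t^-1)^-1)).
  by rewrite ler_wpM2r ?invr_ge0 ?expR_ge0// HC.
have he : t^-1 ^+ m / K <= expR t^-1.
  by apply: le_trans (expR_ge1Dxn m.-1 s0); rewrite lerDr ler01.
have hi : (expR t^-1)^-1 <= K * t ^+ m.
  have Kt : 0 < K * t ^+ m by apply: mulr_gt0 => //; exact: exprn_gt0.
  rewrite invf_ple ?posrE ?expR_gt0 ?Kt//.
  by rewrite invfM mulrC -exprVn.
have tE : t^-1 ^+ size q * t ^+ m = t ^+ 2.
  by rewrite exprVn /m -addn2 exprD mulrA mulVf ?mul1r// expf_neq0// gt_eqF.
have -> : C * K * t ^+ 2 = C * t^-1 ^+ size q * (K * t ^+ m).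
  by rewrite -tE; ring.
by rewrite ler_wpM2l// mulr_ge0// exprn_ge0.
Qed.

Lemma is_derive_flat_exp q t :
  is_derive t (1 : R) (flat_exp q) (flat_exp (flat_exp_deriv q) t).
Proof.
have [t0|t0|->] := ltgtP t 0.
- rewrite [flat_exp (_ q) t]/flat_exp ltNge (ltW t0)/=.
  apply: (@near_eq_is_derive R R^o R^o (cst 0)).
  near=> s; rewrite /flat_exp ifF//; apply/negbTE; rewrite -leNgt ltW//.
  by near: s; exact: lt_nbhsl.
- rewrite [flat_exp (_ q) t]/flat_exp t0.
  have tn0 : t != 0 by rewrite gt_eqF.
  apply: (@near_eq_is_derive R R^o R^o (fun s => q.[s^-1] * expR (- s^-1))).
    near=> s; rewrite /flat_exp ifT//.
    by near: s; exact: lt_nbhsr.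
  have di : is_derive t (1 : R) (fun s : R => s^-1) (- t ^- 2).
    have h := @is_deriveV R id t 1 1 tn0 (is_derive_id t 1).
    by apply: is_derive_eq h _; rewrite /GRing.scale/= mulr1.
  have dq := is_derive1_comp (is_derive_poly q t^-1) di.
  have de : is_derive t (1 : R) (expR \o (fun s : R => - s^-1)) (expR (- t^-1) * t ^- 2).
    apply: is_derive1_comp.
    have h := is_deriveN di; apply: is_derive_eq h _; by rewrite opprK.
  have h := is_deriveM dq de; apply: is_derive_eq h _.
  rewrite /flat_exp_deriv/= hornerM hornerXn hornerD hornerN /GRing.scale/= -exprVn.
  by ring.
rewrite [flat_exp (_ q) 0]/flat_exp ltxx.
have [C C0 HC] := flat_exp_small q.
have F0 : flat_exp q 0 = 0 by rewrite /flat_exp ltxx.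
have lim0 : (fun h : R => h^-1 *: ((flat_exp q \o shift 0) (h *: 1) - flat_exp q 0))
    @ 0^' --> (0 : R).
  apply/cvgrPdist_le => e e0; have C1 : 0 < C + 1 by rewrite ltr_wpDl.
  near=> h; rewrite sub0r normrN/= F0 subr0 addr0 /GRing.scale/= mulr1 normrM normfV.
  have h0 : h != 0 by near: h; exact: nbhs_dnbhs_neq.
  have h1 : `|h| <= 1.
    near: h; apply: nbhs_dnbhs.
    by apply: (@nbhs0_le _ R).
  have he : `|h| <= e / (C + 1).
    near: h; apply: nbhs_dnbhs.
    by apply: (@nbhs0_le _ R); rewrite divr_gt0.
  have hn : 0 < `|h| by rewrite normr_gt0.
  rewrite mulrC ler_pdivrMr//.
  apply: (le_trans (HC h (le_trans (ler_norm h) h1))).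
  rewrite -real_normK ?num_real// expr2 mulrA ler_pM2r//.
  apply: (@le_trans _ _ ((C + 1) * `|h|)); first by rewrite ler_wpM2r// lerDl.
  by rewrite mulrC -ler_pdivlMr.
split; first by apply/cvg_ex; exists 0.
exact: cvg_lim lim0.
Unshelve. all: by end_near. Qed.

Lemma continuous_flat_exp q : continuous (flat_exp q).
Proof.
move=> t; apply: differentiable_continuous; apply/derivable1_diffP.
by have [] := is_derive_flat_exp q t.
Qed.

End flat_exponential.

Section smooth_step.
Context {R : realType}.

(** An affine function with linear part lam. Composition with it reduces a directional derivative to
    one variable, at the cost of the factor [lam v], which does not depend on the point; all orders
    then follow by induction. *)
Definition affine_along {E : normedModType R} (a lam : E -> R) : Prop :=
  continuous a /\ forall h v x, a (h *: v + x) = h * lam v + a x.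

Lemma derive_flat_exp_affine (E : normedModType R) (a lam : E -> R) q x v :
  affine_along a lam ->
  is_derive x v (fun p => flat_exp q (a p)) (lam v * flat_exp (flat_exp_deriv q) (a x)).
Proof.
move=> [ca aE]; pose G (s : R) : R := flat_exp q (s * lam v + a x).
have e : (fun h : R => h^-1 *: (((fun p => flat_exp q (a p)) \o shift x) (h *: v) -
      flat_exp q (a x))) =
    (fun h : R => h^-1 *: ((G \o shift 0) (h *: 1) - G 0)).
  apply/funext => h /=; rewrite aE /G mul0r add0r addr0.
  by rewrite [h *: 1]mulr1.
have dG : is_derive (0 : R) (1 : R) G (flat_exp (flat_exp_deriv q) (a x) * lam v).
  apply: (@is_derive1_comp _ (flat_exp q) (fun s => s * lam v + a x)).
    by rewrite mul0r add0r; exact: is_derive_flat_exp.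
  have h : is_derive (0 : R) (1 : R) (fun s : R => s * lam v + a x)
      ((0 *: 0 + lam v *: 1) + 0).
    apply: is_deriveD; apply: is_deriveM.
  by apply: is_derive_eq h _; rewrite scale0r add0r addr0 /GRing.scale/= mulr1.
have [dG1 dG2] := dG; split; first by rewrite /derivable e.
by rewrite /derive e mulrC -dG2.
Qed.

Lemma Ck_flat_exp_affine (E : normedModType R) (a lam : E -> R) q k :
  affine_along a lam -> Ck k (fun p => flat_exp q (a p)).
Proof.
move=> Ha; have [ca _] := Ha; elim: k q => [|k IH] q.
  by move=> x; apply: (continuous_comp (ca x)); exact: continuous_flat_exp.
split=> [x|v].
  by apply: (continuous_comp (ca x)); exact: continuous_flat_exp.
have dE x := @derive_flat_exp_affine E a lam q x v Ha.
split=> [x|]; first by have [] := dE x.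
rewrite (_ : 'D_v _ = fun p => lam v * flat_exp (flat_exp_deriv q) (a p)).
  by apply: Ck_mul; [exact: Ck_cst|exact: IH].
by apply/funext => x; have [_] := dE x.
Qed.

Definition smooth_step (t : R) : R :=
  flat_exp 1 t / (flat_exp 1 t + flat_exp 1 (1 - t)).

Lemma flat_exp1_ge0 t : 0 <= flat_exp 1 t :> R.
Proof. by rewrite /flat_exp; case: ifP => // _; rewrite hornerC mul1r expR_ge0. Qed.

Lemma smooth_step_denom t : 0 < flat_exp 1 t + flat_exp 1 (1 - t) :> R.
Proof.
have p s : 0 < s -> 0 < flat_exp 1 s :> R.
  by move=> s0; rewrite /flat_exp s0 hornerC mul1r expR_gt0.
have [t0|t0] := ltP 0 t; first by rewrite ltr_pwDl ?flat_exp1_ge0 ?p.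
by rewrite ltr_wpDl ?flat_exp1_ge0 ?p//; move: t0; lra.
Qed.

Lemma smooth_step_ge0 t : 0 <= smooth_step t.
Proof. by rewrite divr_ge0 ?flat_exp1_ge0// ltW// smooth_step_denom. Qed.

Lemma smooth_step_le1 t : smooth_step t <= 1.
Proof.
by rewrite /smooth_step ler_pdivrMr ?smooth_step_denom// mul1r lerDl flat_exp1_ge0.
Qed.

Lemma smooth_step_eq0 t : t <= 0 -> smooth_step t = 0.
Proof. by move=> t0; rewrite /smooth_step /flat_exp ltNge t0/= mul0r. Qed.

Lemma smooth_step_eq1 t : 1 <= t -> smooth_step t = 1.
Proof.
move=> t1; rewrite /smooth_step; have := smooth_step_denom t.
rewrite [flat_exp 1 (1 - t)]/flat_exp subr_gt0 (ltNge t 1) t1/= addr0 => h.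
by rewrite divff// gt_eqF.
Qed.

Lemma Ck_smooth_step_affine (E : normedModType R) (a lam : E -> R) k :
  affine_along a lam -> Ck k (fun p => smooth_step (a p)).
Proof.
move=> Ha; have [ca aE] := Ha.
have Hb : affine_along (fun p => 1 - a p) (fun v => - lam v).
  split=> [|h v x]; last by rewrite aE; ring.
  by apply: continuous_sub => //; exact: continuous_cst.
have Cd : Ck k (fun p => flat_exp 1 (a p) + flat_exp 1 (1 - a p)).
  by apply: Ck_add; [exact: Ck_flat_exp_affine Ha|exact: Ck_flat_exp_affine Hb].
apply: Ck_mul; first exact: Ck_flat_exp_affine Ha.
by apply: Ck_inv => // x; rewrite gt_eqF// smooth_step_denom.
Qed.

Lemma smooth_step_lipschitz : exists2 K, 1 <= K &
  forall s t, `|smooth_step s - smooth_step t| <= K * `|s - t|.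
Proof.
have aid : affine_along (fun t : R^o => t) (fun t => t) by split=> // t; exact: cvg_id.
have [cS HS] := @Ck_smooth_step_affine R^o _ _ 1 aid.
have [dS cD] := HS 1.
have /compact_bounded[M [_ HM]] : compact ('D_(1 : R^o) (smooth_step : R^o -> R) @` `[0, 1]).
  by apply: continuous_compact (@segment_compact R 0 1); exact: continuous_subspaceT.
pose K := `|M| + 1; have K1 : 1 <= K by rewrite lerDr.
have HK c : c \in `[0, 1] -> `|'D_(1 : R^o) (smooth_step : R^o -> R) c| <= K.
  move=> c01; apply: HM; last by exists c.
  by rewrite /K; have := ler_norm M; lra.
exists K => //.
have inner s t : 0 <= s -> s <= t -> t <= 1 -> `|smooth_step t - smooth_step s| <= K * (t - s).
  move=> s0 st t1.
  have dd (x : R) : is_derive x (1 : R) smooth_step ('D_(1 : R^o) (smooth_step : R^o -> R) x).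
    by split=> //; exact: dS.
  have cw : {within `[s, t], continuous smooth_step} by exact: continuous_subspaceT.
  have [c] := MVT_segment st (fun x _ => dd x) cw.
  rewrite in_itv/= => /andP[sc ct] ->.
  rewrite normrM (ger0_norm (_ : 0 <= t - s)) ?subr_ge0// ler_wpM2r ?subr_ge0//.
  by apply: HK; rewrite in_itv/= (le_trans s0 sc) (le_trans ct t1).
have inner' s t : 0 <= s <= 1 -> 0 <= t <= 1 ->
    `|smooth_step s - smooth_step t| <= K * `|s - t|.
  move=> /andP[s0 s1] /andP[t0 t1]; have [st|/ltW ts] := leP s t.
    by rewrite distrC (distrC s) (ger0_norm (_ : 0 <= t - s)) ?subr_ge0// inner.
  by rewrite (ger0_norm (_ : 0 <= s - t)) ?subr_ge0// inner.
(* The step is constant outside [0, 1], so it factors through the clamping to [0, 1], which is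
   1-Lipschitz. *)
pose cl (x : R) := Num.max 0 (Num.min 1 x).
have clE x : smooth_step x = smooth_step (cl x).
  rewrite /cl; have [x1|x1] := leP 1 x.
    by rewrite (max_idPr (ler01 : 0 <= 1 :> R)) !smooth_step_eq1.
  have [x0|x0] := leP 0 x; first by [].
  by rewrite !smooth_step_eq0// ltW.
have cl01 x : 0 <= cl x <= 1.
  by rewrite /cl le_max lexx ge_max ler01 ge_min lexx.
move=> s t; rewrite clE (clE t); apply: (le_trans (inner' _ _ (cl01 s) (cl01 t))).
rewrite ler_wpM2l//; first by apply: le_trans K1.
exact: (le_trans (max0_lipschitz _ _) (min1_lipschitz _ _)).
Qed.

End smooth_step.

(** * Smooth interpolation on a grid *)

Section interpolation.
Context {R : realType}.
Implicit Types (b : nat -> R) (t : R).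

(** Each step rises from 0 to 1 over one cell, so at an integer i between 0 and n the increments
    telescope to b i - b 0. Written with increments, the interpolant is a finite sum of smooth
    functions. *)
Definition interp (n : nat) b t : R :=
  \sum_(j < n) (b j.+1 - b j) * smooth_step (t - j%:R).

Lemma interpS n b t : interp n.+1 b t = interp n b t + (b n.+1 - b n) * smooth_step (t - n%:R).
Proof. by rewrite /interp big_ord_recr. Qed.

Lemma interp_before n b t : t <= 0 -> interp n b t = 0.
Proof.
move=> t0; rewrite /interp big1// => j _; rewrite smooth_step_eq0 ?mulr0//.
by rewrite subr_le0 (le_trans t0).
Qed.

Lemma interp_after n b t : n%:R <= t -> interp n b t = b n - b 0%N.
Proof.
elim: n => [|n IH] nt; first by rewrite /interp big_ord0 subrr.
rewrite interpS IH; last by apply: le_trans nt; rewrite ler_nat.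
rewrite smooth_step_eq1; first by ring.
by rewrite lerBrDr addrC natr1.
Qed.

(** The cell and the weight are found before b is given: the same convex combination serves all
    data, which later preserves the Lipschitz bounds in the other coordinates. *)
Lemma interp_cell n t : (0 < n)%N -> 0 <= t <= n%:R ->
  exists j : nat, [/\ j%:R <= t, t <= j.+1%:R & forall b, b 0%N = 0 ->
    interp n b t = (1 - smooth_step (t - j%:R)) * b j + smooth_step (t - j%:R) * b j.+1].
Proof.
move=> n0 /andP[t0 tn]; elim: n n0 tn => [//|n IH] _ tn.
have [nt|tn'] := leP n%:R t.
  by exists n; split=> // b b0; rewrite interpS interp_after// b0; ring.
have n0 : (0 < n)%N by rewrite -(ltr0n R); exact: le_lt_trans tn'.
have [j [jt tj jE]] := IH n0 (ltW tn'); exists j; split=> // b b0.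
by rewrite interpS jE// [smooth_step (t - n%:R)]smooth_step_eq0 ?mulr0 ?addr0// subr_le0 ltW.
Qed.

Lemma lipschitz_glue (f : R -> R) (c K : R) :
  (forall s t, s <= c -> t <= c -> `|f s - f t| <= K * `|s - t|) ->
  (forall s t, c <= s -> c <= t -> `|f s - f t| <= K * `|s - t|) ->
  forall s t, `|f s - f t| <= K * `|s - t|.
Proof.
move=> H1 H2.
have key s t : s <= c -> c <= t -> `|f s - f t| <= K * `|s - t|.
  move=> sc ct; apply: (le_trans (ler_distD (f c) _ _)).
  apply: (le_trans (lerD (H1 _ _ sc (lexx c)) (H2 _ _ (lexx c) ct))).
  have st := le_trans sc ct.
  rewrite -mulrDr (distrC s c) (distrC c t) (distrC s t) !ger0_norm ?subr_ge0//.
  by have -> : c - s + (t - c) = t - s by ring.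
move=> s t; have [sc|/ltW cs] := leP s c; have [tc|/ltW ct] := leP t c.
- exact: H1.
- exact: key.
- by rewrite distrC (distrC s); exact: key.
- exact: H2.
Qed.

(** No factor n appears: before n the last step is still 0, after n the earlier ones are constant,
    so bounds on the two half-lines are glued at n. *)
Lemma interp_lipschitz K D n b : 0 <= D ->
  (forall s t, `|smooth_step s - smooth_step t| <= K * `|s - t|) ->
  (forall j, `|b j.+1 - b j| <= D) ->
  forall s t, `|interp n b s - interp n b t| <= K * D * `|s - t|.
Proof.
move=> D0 HK HD; have K0 : 0 <= K.
  by have := le_trans (normr_ge0 _) (HK 1 0); rewrite subr0 normr1 mulr1.
elim: n => [|n IH].
  by move=> s t; rewrite /interp !big_ord0 subrr normr0 !mulr_ge0.
apply: (@lipschitz_glue _ n%:R) => s t sn tn; rewrite !interpS.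
  by rewrite !(@smooth_step_eq0 _ (_ - n%:R)) ?subr_le0// !mulr0 !addr0.
rewrite !interp_after//.
rewrite opprD addrACA subrr add0r -mulrBr normrM [K * D]mulrC -mulrA.
apply: ler_pM => //.
apply: (le_trans (HK _ _)).
by have -> : s - n%:R - (t - n%:R) = s - t by ring.
Qed.

End interpolation.

(** * Smoothing one coordinate at a time *)

Section coordinate_smoothing.
Context {R : realType} {I : finType}.
Implicit Types (h : (I -> R) -> R) (x y : I -> R) (c : I).

Definition upd c (s : R) x : I -> R := fun c' => if c' == c then s else x c'.

Lemma updE c s x : upd c s x c = s.
Proof. by rewrite /upd eqxx. Qed.

Lemma updN c c' s x : c' != c -> upd c s x c' = x c'.
Proof. by rewrite /upd => /negbTE ->. Qed.

Lemma upd_same c x : upd c (x c) x = x.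
Proof. by apply/funext => c'; rewrite /upd; case: eqP => [->|]. Qed.

Lemma upd_upd c s t x : upd c s (upd c t x) = upd c s x.
Proof. by apply/funext => c'; rewrite /upd; case: eqP. Qed.

Lemma updC c c' s t x : c' != c -> upd c s (upd c' t x) = upd c' t (upd c s x).
Proof.
move=> cc; apply/funext => i; rewrite /upd; case: eqP => [->|//].
by rewrite eq_sym (negbTE cc).
Qed.

(** One constant for each coordinate separately: this is what a smoothing in a single coordinate can
    control, and telescoping recovers a Lipschitz bound in all of them. *)
Definition coord_lipschitz (L : R) h := forall c s t x,
  `|h (upd c s x) - h (upd c t x)| <= L * `|s - t|.

Definition coord_support (S : R) h := forall x c, S <= `|x c| -> h x = 0.

Lemma coord_lipschitz_ge0 L h c : coord_lipschitz L h -> 0 <= L.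
Proof.
move=> hL; have := le_trans (normr_ge0 _) (hL c 1 0 (fun=> 0)).
by rewrite subr0 normr1 mulr1.
Qed.

Lemma coord_lipschitz_dist L h c x s t : coord_lipschitz L h -> x c = t ->
  `|h (upd c s x) - h x| <= L * `|s - t|.
Proof. by move=> hL <-; rewrite -{2}(upd_same c x); exact: hL. Qed.

Lemma coord_lipschitz_sum L h x y : coord_lipschitz L h ->
  `|h x - h y| <= L * \sum_c `|x c - y c|.
Proof.
move=> hL; pose m (cs : seq I) c := if c \in cs then y c else x c.
suff H cs : `|h x - h (m cs)| <= L * \sum_(c <- cs) `|x c - y c|.
  have := H (index_enum I); suff -> : m (index_enum I) = y by [].
  by apply/funext => c; rewrite /m mem_index_enum.
elim: cs => [|c cs IH].
  rewrite (_ : m [::] = x) ?subrr ?normr0 ?big_nil ?mulr0//.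
rewrite big_cons mulrDr [leRHS]addrC; apply: (le_trans (ler_distD (h (m cs)) _ _)).
apply: lerD => //.
have -> : m (c :: cs) = upd c (y c) (m cs).
  by apply/funext => c'; rewrite /m /upd inE; case: eqP => [->|].
rewrite distrC; apply: (le_trans (coord_lipschitz_dist _ hL (erefl _))).
rewrite ler_wpM2l ?(coord_lipschitz_ge0 c hL)// /m; case: ifP => _.
  by rewrite subrr normr0.
by rewrite distrC.
Qed.

(** Interpolates h along the coordinate c between the grid points (j - M) delta with 0 <= j <= 2 M.
    The grid will cover the support, so h vanishes at both end points; at the first one this is the
    condition b 0 = 0 of [interp_cell]. *)
Definition smoothing c (delta : R) (M : nat) h x : R :=
  interp (M + M) (fun j => h (upd c ((j%:R - M%:R) * delta) x)) (x c / delta + M%:R).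

Variables (delta K L S : R) (M : nat) (h : (I -> R) -> R) (c : I).
Hypotheses (delta0 : 0 < delta) (K1 : 1 <= K)
  (HK : forall s t : R, `|smooth_step s - smooth_step t| <= K * `|s - t|)
  (hL : coord_lipschitz L h) (hS : coord_support S h) (M0 : (0 < M)%N)
  (SM : S <= M%:R * delta).

(** The nodes and the weight depend on x only through its coordinate c, so they are common to points
    differing in other coordinates. Off the support both sides vanish, and a itself serves as both
    nodes. *)
Lemma smoothing_convex (a : R) : exists s0 s1 w, [/\ 0 <= w <= 1,
  `|s0 - a| <= delta, `|s1 - a| <= delta &
  forall x, x c = a ->
    smoothing c delta M h x = (1 - w) * h (upd c s0 x) + w * h (upd c s1 x)].
Proof.
pose t := a / delta + M%:R.
have at_ : a = (t - M%:R) * delta by rewrite /t addrK mulfVK// gt_eqF.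
have b0 x : h (upd c ((0%:R - M%:R) * delta) x) = 0.
  apply: (hS (c := c)); rewrite updE sub0r mulNr normrN ger0_norm//.
  by rewrite mulr_ge0// ltW.
have b1 x : h (upd c (((M + M)%:R - M%:R) * delta) x) = 0.
  apply: (hS (c := c)); rewrite updE natrD addrK ger0_norm//.
  by rewrite mulr_ge0// ltW.
have MM : (0 < M + M)%N by rewrite addn_gt0 M0.
have out : S <= `|a| -> (forall x, x c = a -> smoothing c delta M h x = 0) ->
    exists s0 s1 w, [/\ 0 <= w <= 1, `|s0 - a| <= delta, `|s1 - a| <= delta &
      forall x, x c = a ->
        smoothing c delta M h x = (1 - w) * h (upd c s0 x) + w * h (upd c s1 x)].
  move=> Sa sm0; exists a, a, 0; rewrite lexx ler01 subrr normr0 (ltW delta0).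
  split=> // x xa; rewrite sm0// (hS (c := c)) ?updE// !mulr0 addr0//.
have [t0|t0] := leP t 0.
  apply: out => [|x xa]; last by rewrite /smoothing interp_before// xa.
  apply: (le_trans SM); rewrite at_ -normrN -mulNr opprB.
  apply: (le_trans _ (ler_norm _)); rewrite ler_pM2r// lerDl oppr_ge0//.
have [tM|tM] := leP (M + M)%:R t.
  apply: out => [|x xa].
    apply: (le_trans SM); rewrite at_.
    apply: (le_trans _ (ler_norm _)); rewrite ler_pM2r//.
    by rewrite lerBrDr -natrD.
  by rewrite /smoothing interp_after ?xa// b1 b0 subrr.
have t01 : 0 <= t <= (M + M)%:R by rewrite !ltW.
have near j : `|j - t| <= 1 -> `|(j - M%:R) * delta - a| <= delta.
  move=> jt; have -> : (j - M%:R) * delta - a = (j - t) * delta by rewrite at_; ring.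
  by rewrite normrM (gtr0_norm delta0) ler_piMl// ltW.
have [j [jt tj jE]] := @interp_cell R (M + M) t MM t01.
rewrite -natr1 in tj.
exists ((j%:R - M%:R) * delta), ((j.+1%:R - M%:R) * delta), (smooth_step (t - j%:R)).
rewrite smooth_step_ge0 smooth_step_le1; split=> //.
- by apply: near; rewrite ler_distl lerBlDr tj/= (le_trans jt)// lerDl.
- apply: near; rewrite -natr1 ler_distl lerBlDr lerD2r jt andbT.
  by rewrite (le_trans tj)// lerDl.
- by move=> x xa; rewrite /smoothing xa -/t jE.
Qed.

Lemma dist_convex (w a b B : R) : 0 <= w <= 1 -> `|a| <= B -> `|b| <= B ->
  `|(1 - w) * a + w * b| <= B.
Proof.
move=> /andP[w0 w1] aB bB; apply: (le_trans (ler_normD _ _)); rewrite !normrM.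
rewrite (ger0_norm w0) ger0_norm ?subr_ge0//.
have -> : B = (1 - w) * B + w * B by ring.
by apply: lerD; rewrite ler_wpM2l// subr_ge0.
Qed.

Lemma smoothing_dist x : `|smoothing c delta M h x - h x| <= L * delta.
Proof.
have L0 := coord_lipschitz_ge0 c hL.
have [s0 [s1 [w [w01 h0 h1 ->//]]]] := smoothing_convex (x c).
have -> : (1 - w) * h (upd c s0 x) + w * h (upd c s1 x) - h x =
  (1 - w) * (h (upd c s0 x) - h x) + w * (h (upd c s1 x) - h x) by ring.
by apply: dist_convex => //; apply: (le_trans (coord_lipschitz_dist _ hL erefl));
  rewrite ler_wpM2l.
Qed.

Lemma smoothing_support : coord_support (S + delta) (smoothing c delta M h).
Proof.
move=> x c' Sx; have [s0 [s1 [w [w01 h0 h1 ->//]]]] := smoothing_convex (x c).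
have [cc|cc] := eqVneq c' c; last first.
  have Sx' : S <= `|x c'| by apply: le_trans Sx; rewrite lerDl ltW.
  by rewrite !(hS (c := c')) ?updN// !mulr0 addr0.
rewrite cc in Sx.
have far s : `|s - x c| <= delta -> S <= `|s|.
  move=> sx; have := ler_normD (x c - s) s; rewrite subrK distrC => hh.
  by have := le_trans Sx (le_trans hh (lerD sx (lexx _))); rewrite [delta + _]addrC lerD2r.
by rewrite !(hS (c := c)) ?updE ?far// !mulr0 addr0.
Qed.

(** Along c the increments of h are at most L delta and the steps have slope K / delta, so delta
    cancels. Across c a convex combination with fixed weights keeps the constant L. *)
Lemma smoothing_lipschitz : coord_lipschitz (K * L) (smoothing c delta M h).
Proof.
have L0 := coord_lipschitz_ge0 c hL; move=> c' s t x.
have [->|cc] := eqVneq c' c.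
  rewrite /smoothing !updE; under eq_fun do rewrite upd_upd.
  under [X in interp _ X (t / _ + _)]eq_fun do rewrite upd_upd.
  have D0 : 0 <= L * delta by rewrite mulr_ge0// ltW.
  apply: (le_trans (interp_lipschitz (M + M) D0 HK _ _ _)).
    move=> j; apply: (le_trans (hL _ _ _ _)); rewrite -mulrBl opprB addrA subrK.
    by rewrite -natr1 addrAC subrr add0r mul1r gtr0_norm.
  have -> : s / delta + M%:R - (t / delta + M%:R) = (s - t) / delta by ring.
  rewrite normrM (gtr0_norm (_ : 0 < delta^-1)) ?invr_gt0//.
  have -> // : K * (L * delta) * (`|s - t| / delta) = K * L * `|s - t|.
  by field; rewrite gt_eqF.
have xc r : upd c' r x c = x c by rewrite updN// eq_sym.
have [s0 [s1 [w [w01 _ _ smE]]]] := smoothing_convex (x c).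
rewrite !smE ?xc// !(@updC c c')//.
set a := h _; set b := h _; set a' := h _; set b' := h _.
have -> : (1 - w) * a + w * b - ((1 - w) * a' + w * b') =
  (1 - w) * (a - a') + w * (b - b') by ring.
have KL : L * `|s - t| <= K * L * `|s - t|.
  by rewrite -mulrA ler_peMl// mulr_ge0.
by apply: le_trans KL; apply: dist_convex => //; exact: hL.
Qed.

End coordinate_smoothing.

(** * Smooth approximation of compactly supported Lipschitz functions *)

Section smooth_approximation.
Context {R : realType} {d1 d2 : nat}.
Local Notation E := ('rV[R]_d1 * 'rV[R]_d2)%type.
Local Notation I := ('I_d1 + 'I_d2)%type.
Implicit Types (p q : E) (x y : I -> R) (c : I).

Definition coords p : I -> R :=
  fun c => match c with inl i => p.1 ord0 i | inr i => p.2 ord0 i end.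

Definition of_coords x : E := (\row_i x (inl i), \row_i x (inr i)).

Lemma coordsK : cancel coords of_coords.
Proof. by case=> x y; congr pair; apply/rowP => i; rewrite mxE. Qed.

Lemma coords_le_norm p c : `|coords p c| <= `|p|.
Proof.
rewrite prod_normE le_max; case: c => i; first by rewrite coord_le_norm.
by rewrite orbC coord_le_norm.
Qed.

Lemma coords_sub p q c : coords (p - q) c = coords p c - coords q c.
Proof. by case: c => i; rewrite /coords/= !mxE. Qed.

Lemma coordsZD (h : R) p q c : coords (h *: p + q) c = h * coords p c + coords q c.
Proof. by case: c => i; rewrite /coords/= !mxE. Qed.

Lemma of_coords_norm_le x r : 0 <= r -> (forall c, `|x c| <= r) -> `|of_coords x| <= r.
Proof.
move=> r0 H; rewrite prod_normE ge_max; apply/andP.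
by split; apply/rV_norm_le => // i; rewrite mxE.
Qed.

Lemma coords_of x c : coords (of_coords x) c = x c.
Proof. by case: c => i; rewrite /coords/= mxE. Qed.

Lemma continuous_coords c : continuous (fun p => coords p c).
Proof.
apply: (@lipschitz_continuous _ _ _ _ 1) => p q.
by rewrite mul1r -coords_sub coords_le_norm.
Qed.

Definition mix (cs : seq I) p x : I -> R := fun c => if c \in cs then coords p c else x c.

(** Joint smoothness in the coordinates of [cs] with the others frozen: the property that survives
    the induction over coordinates. *)
Definition smooth_in (cs : seq I) (h : (I -> R) -> R) : Prop :=
  forall k x, Ck k (fun p => h (mix cs p x)).

Lemma affine_along_coords c (a b : R) :
  affine_along (fun p => coords p c / a + b) (fun p => coords p c / a).
Proof.
split=> [|h v x]; last by rewrite coordsZD; ring.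
apply: continuous_add; last exact: continuous_cst.
by apply: continuous_mul; [exact: continuous_coords|exact: continuous_cst].
Qed.

(** The smoothed function is a finite sum of products of increments of h with c frozen at grid
    values, smooth in the coordinates of [cs], with a step depending on the coordinate c alone. *)
Lemma smooth_in_smoothing (delta : R) M h c cs : c \notin cs -> smooth_in cs h ->
  smooth_in (c :: cs) (smoothing c delta M h).
Proof.
move=> ccs Sh k x; rewrite /smoothing.
have mixE p s : upd c s (mix (c :: cs) p x) = mix cs p (upd c s x).
  apply/funext => c'; rewrite /upd /mix inE; case: eqP => [->|//].
  by rewrite (negbTE ccs).
have mixc p : mix (c :: cs) p x c = coords p c by rewrite /mix inE eqxx.
rewrite /interp; apply: Ck_sum => j; under eq_fun do rewrite !mixE mixc.
have mulN1 : (fun p => h (mix cs p (upd c ((j.+1%:R - M%:R) * delta) x)) -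
       h (mix cs p (upd c ((j%:R - M%:R) * delta) x))) =
    (fun p => h (mix cs p (upd c ((j.+1%:R - M%:R) * delta) x)) +
      -1 * h (mix cs p (upd c ((j%:R - M%:R) * delta) x))).
  by apply/funext => p; rewrite mulN1r.
apply: Ck_mul.
  rewrite mulN1; apply: Ck_add; first exact: Sh.
  by apply: Ck_mul; [exact: Ck_cst|exact: Sh].
under eq_fun do rewrite -addrA.
by apply: Ck_smooth_step_affine; exact: affine_along_coords.
Qed.

(** Each coordinate multiplies the Lipschitz constant by K whatever delta is, and enlarges the
    support by delta <= 1; only the uniform error carries the factor delta. *)
Lemma iterated_smoothing (K L S delta : R) (cs : seq I) h :
  0 < delta <= 1 -> 1 <= K ->
  (forall s t : R, `|smooth_step s - smooth_step t| <= K * `|s - t|) ->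
  coord_lipschitz L h -> coord_support S h -> 0 <= L -> uniq cs ->
  exists H, [/\ smooth_in cs H, coord_lipschitz (K ^+ size cs * L) H,
    coord_support (S + (size cs)%:R) H &
    forall x, `|H x - h x| <= (size cs)%:R * (K ^+ size cs * L * delta)].
Proof.
move=> /andP[delta0 delta1] K1 HK hL hS L0; elim: cs => [_|c cs IH].
  exists h; rewrite /= expr0 mul1r addr0; split=> // [k x|x].
    exact: (@Ck_cst R E k (h x)).
  by rewrite subrr normr0 mul0r.
move=> /andP[ccs /IH[H [Hsm HL HS Hd]]].
have [M [M0 SM]] : exists M, (0 < M)%N /\ S + (size cs)%:R <= M%:R * delta.
  exists (Num.bound `|(S + (size cs)%:R) / delta|).+1; split=> //.
  rewrite -ler_pdivrMr// ltW//.
  apply: (lt_le_trans (le_lt_trans (ler_norm _) (archi_boundP (normr_ge0 _)))).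
  by rewrite ler_nat.
have K0 : 0 <= K by apply: le_trans K1.
have B0 : 0 <= K ^+ size cs * L by rewrite mulr_ge0// exprn_ge0.
exists (smoothing c delta M H); split.
- exact: smooth_in_smoothing.
- by rewrite /= exprS -mulrA; exact: (smoothing_lipschitz c delta0 K1 HK HL HS M0 SM).
- move=> x c' Sx; apply: (@smoothing_support _ _ delta _ M H c delta0 HS M0 SM x c').
  apply: le_trans Sx; rewrite /= -natr1 addrA lerD2l//.
- move=> x; apply: (le_trans (ler_distD (H x) _ _)).
  have h1 := smoothing_dist c delta0 HL HS M0 SM x.
  apply: (le_trans (lerD h1 (Hd x))).
  rewrite /= exprS -natr1; set B := K ^+ size cs * L in B0 *.
  have -> : K * K ^+ size cs * L * delta = K * (B * delta) by rewrite /B; ring.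
  have BD : 0 <= B * delta by rewrite mulr_ge0// ltW.
  rewrite mulrDl mul1r addrC; apply: lerD; last by rewrite ler_peMl.
  by rewrite ler_wpM2l// ler_peMl.
Qed.

(** Up to a distance tau the Lipschitz bounds of g and phi beat e |x - y|^alpha; beyond it, uniform
    closeness does. Increments in x_1 at a common z are enough, since mean oscillation in z is
    bounded by the supremum. *)
Lemma smooth_approximation (alpha e S : R) (g : E -> R) :
  0 < alpha < 1 -> 0 < e -> 0 < S -> locally_lipschitz g ->
  (forall p, S <= `|p| -> g p = 0) ->
  exists2 phi : E -> R, Cc_smooth phi & exists2 L, 0 < L &
    (forall p q, `|phi p - phi q| <= L * `|p - q|) /\
    forall (x y : 'rV[R]_d1) z, `|(g (x, z) - phi (x, z)) - (g (y, z) - phi (y, z))| <=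
      e * `|x - y| `^ alpha.
Proof.
move=> /andP[a0 a1] e0 S0 lg gS.
have [L L0 gL] := locally_lipschitz_support S0 lg gS.
have [K K1 HK] := @smooth_step_lipschitz R.
have K0 : 0 < K by apply: lt_le_trans K1.
pose cs := index_enum I; pose n := size cs.
pose h x := g (of_coords x).
have hL : coord_lipschitz L h.
  move=> c s t x; apply: (le_trans (gL _ _)); rewrite ler_pM2l//.
  have -> : of_coords (upd c s x) - of_coords (upd c t x) =
      of_coords (fun c' => upd c s x c' - upd c t x c').
    by congr pair; apply/rowP => i; rewrite !mxE.
  apply: of_coords_norm_le => // c'; rewrite /upd; case: eqP => // _.
  by rewrite subrr normr0.
have hS : coord_support S h.
  move=> x c Sx; apply: gS; apply: (le_trans Sx).
  by rewrite -(coords_of x c) coords_le_norm.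
have Ln0 : 0 < K ^+ n * L by rewrite mulr_gt0// exprn_gt0.
(* The n compares a sum over the coordinates with the sup norm; the 1 keeps the constant
   positive. *)
pose Lp := K ^+ n * L * (n%:R + 1).
have Lp0 : 0 < Lp by rewrite mulr_gt0// ltr_wpDl.
have b0 : 0 < 1 - alpha by rewrite subr_gt0.
have [T T0 HT] := @powR_large _ (1 - alpha) ((L + Lp) / e) b0.
pose tau := T^-1; have tau0 : 0 < tau by rewrite invr_gt0.
pose B := n%:R * (K ^+ n * L) + 1.
have B0 : 0 < B by rewrite ltr_wpDl// mulr_ge0// ltW.
have ta0 := powR_gt0 alpha tau0.
(* tau depends on [Lp] but not on delta, so delta can be chosen last, making twice the uniform error
   at most e tau^alpha. *)
pose delta := Num.min 1 (e * tau `^ alpha / (2 * B)).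
have delta01 : 0 < delta <= 1.
  by rewrite lt_min ltr01 divr_gt0 ?mulr_gt0//= ge_min lexx.
have [H [Hsm HL HS Hd]] := iterated_smoothing delta01 K1 HK hL hS (ltW L0)
  (index_enum_uniq I : uniq cs).
rewrite -/n in HL HS Hd.
pose phi p := H (coords p).
have phiE : phi = fun p => H (mix cs p (fun=> 0)).
  apply/funext => p; congr H; apply/funext => c.
  by rewrite /mix mem_index_enum.
have phiL p q : `|phi p - phi q| <= Lp * `|p - q|.
  apply: (le_trans (coord_lipschitz_sum _ _ HL)); rewrite /Lp -[leRHS]mulrA ler_pM2l//.
  apply: (@le_trans _ _ (\sum_(c <- cs) `|p - q|)).
    by apply: ler_sum => c _; rewrite -coords_sub coords_le_norm.
  have -> : \sum_(c <- cs) `|p - q| = n%:R * `|p - q|.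
    by rewrite big_const_seq count_predT iter_addr_0 mulr_natl.
  by rewrite ler_wpM2r// lerDl.
have phiS p : S + n%:R + 1 <= `|p| -> phi p = 0.
  move=> Sp; apply: contrapT => p0; move: Sp; apply/negP; rewrite -ltNge.
  apply: (@le_lt_trans _ _ (S + n%:R)); last by rewrite ltrDl.
  rewrite -{1}(coordsK p); apply: of_coords_norm_le => [|c].
    by rewrite addr_ge0// ltW.
  by apply: contrapT => /negP; rewrite -ltNge => /ltW h0; apply: p0; exact: HS h0.
have D p : `|g p - phi p| <= B * delta.
  rewrite distrC -{2}(coordsK p); apply: (le_trans (Hd (coords p))).
  have /andP[dl0 _] := delta01.
  by rewrite /B mulrDl mul1r mulrA lerDl ltW.
exists phi; [split|exists Lp => //; split=> // x y z].
- by move=> k; rewrite phiE; exact: Hsm.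
- have r0 : 0 < 2 * (S + n%:R + 1) by rewrite mulr_gt0// addr_gt0// ltr_wpDr.
  pose Q : set E := rect (centered_cube (0 : 'rV[R]_d1) r0) (centered_cube (0 : 'rV[R]_d2) r0).
  have cQ : compact Q by exact: compact_rect.
  apply: (@subclosed_compact _ (closure [set p | phi p != 0]) Q) => //.
    exact: closed_closure.
  have /closure_id -> : closed Q by apply: compact_closed.
  apply: closure_subset => p /eqP p0.
  have pS : `|p| <= S + n%:R + 1.
    by rewrite leNgt; apply/negP => h0; apply: p0; apply: phiS; exact: ltW.
  move: pS; rewrite prod_normE ge_max => /andP[p1 p2].
  by split; apply/centered_cubeP; rewrite subr0 mulrAC divff ?mul1r.
have Lxy : `|(g (x, z) - phi (x, z)) - (g (y, z) - phi (y, z))| <= (L + Lp) * `|x - y|.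
  have E1 : `|(x, z) - (y, z)| = `|x - y|.
    by rewrite prod_normE/= subrr normr0; apply/max_idPl.
  have -> : g (x, z) - phi (x, z) - (g (y, z) - phi (y, z)) =
    (g (x, z) - g (y, z)) - (phi (x, z) - phi (y, z)) by ring.
  apply: (le_trans (ler_normB _ _)); rewrite mulrDl -E1.
  exact: lerD.
have [xy|xy] := leP `|x - y| tau; last first.
  apply: (le_trans (ler_normB _ _)); apply: (le_trans (lerD (D _) (D _))).
  apply: (@le_trans _ _ (e * tau `^ alpha)); last first.
    by rewrite ler_pM2l//; apply: powR_le; exact: ltW.
  have -> : B * delta + B * delta = delta * (2 * B) by ring.
  by rewrite -ler_pdivlMr ?mulr_gt0// /delta ge_min lexx orbT.
have [->|xy0] := eqVneq x y.
  by rewrite subrr normr0 mulr_ge0 ?powR_ge0// ltW.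
have n0 : 0 < `|x - y| by rewrite normr_gt0 subr_eq0.
apply: (le_trans Lxy); rewrite {1}(powR_split alpha n0) mulrCA mulrC ler_pM2r ?powR_gt0//.
have sm := powR_small (ltW b0) n0 xy T0.
have big := HT T (lexx T); rewrite ler_pdivrMr// in big.
apply: (@le_trans _ _ (T `^ (1 - alpha) * e * `|x - y| `^ (1 - alpha))).
  by rewrite ler_wpM2r// powR_ge0.
have -> : T `^ (1 - alpha) * e * `|x - y| `^ (1 - alpha) =
  e * (`|x - y| `^ (1 - alpha) * T `^ (1 - alpha)) by ring.
by rewrite ler_piMr// ltW.
Qed.

End smooth_approximation.

(** * Density of the smooth functions *)

Section density.
Context {R : realType} {d1 d2 : nat} (alpha : R).
Local Notation E := ('rV[R]_d1 * 'rV[R]_d2)%type.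
Implicit Types f g phi : E -> R.

Lemma osc_boundD f g (I1 : cube R d1) (I2 : cube R d2) a b :
  measurable_fun setT f -> measurable_fun setT g ->
  osc_bound alpha f I1 I2 a -> osc_bound alpha g I1 I2 b ->
  osc_bound alpha (fun p => f p + g p) I1 I2 (a + b).
Proof.
move=> mf mg fa gb; apply: (le_trans (ddoscD (unif I1) (unif I2) mf mg)).
by rewrite mulrDl EFinD; exact: leeD.
Qed.

Lemma osc_boundN f (I1 : cube R d1) (I2 : cube R d2) a :
  osc_bound alpha f I1 I2 a -> osc_bound alpha (fun p => - f p) I1 I2 a.
Proof.
apply: le_trans; rewrite le_eqVlt; apply/orP; left; apply/eqP.
rewrite /ddosc; apply: eq_integral => p _; apply: eq_integral => q _.
by congr (_%:E); rewrite -normrN /ddiff; congr `|_|; ring.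
Qed.

Lemma loc_integrableB f g : loc_integrable f -> loc_integrable g ->
  loc_integrable (f \- g).
Proof.
move=> [mf lf] [mg lg]; split; first exact: measurable_funB.
move=> K cK; have mK := compact_measurable_prod cK.
have -> : EFin \o (f \- g) = ((EFin \o f) \- (EFin \o g))%E.
  by apply/funext => p; rewrite /= EFinB.
by apply: integrableB; [exact: mK|exact: lf|exact: lg].
Qed.

Lemma VMO_smooth_approximation f e : (0 < d1)%N -> (0 < d2)%N -> 0 < alpha < 1 ->
  VMO d1 d2 alpha f -> 0 < e ->
  exists2 phi, Cc_smooth phi &
    forall I1 I2, osc_bound alpha (f \- phi) I1 I2 e.
Proof.
move=> n1 n2 alpha01 /VMO_vanishing[lf vf [A A0 fA]] e0.
have /andP[a0 a1] := alpha01; have [mf _] := lf.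
have [C [C0 CE]] : exists C, 0 < C /\ C = @campanato_constant R d1 alpha.
  by exists (@campanato_constant R d1 alpha); split=> //; exact: campanato_constant_gt0.
have [D [D0 DE]] : exists D, 0 <= D /\ D = truncation_constant R d2.
  exists (truncation_constant R d2); split=> //.
  rewrite /truncation_constant /cutoff_constant /scale_constant.
  by rewrite mulr_ge0// !addr_ge0 ?mulr_ge0 ?addr_ge0 ?exprn_ge0.
(* The three errors are k from mollification, 2 D (3 C (2 k)) from truncation and 2 (2 k) from
   smoothing. The inner 2 k is the far bound of u, one k from f and one from f - u; the outer
   factors 2 come from [slice_dist_osc_bound]. *)
pose k := e / (5 + 12 * D * C).
have den : 0 < 5 + 12 * D * C by rewrite ltr_pwDl// !mulr_ge0// ltW.
have k0 : 0 < k by rewrite divr_gt0.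
have kE : k + 2 * (D * (3 * (C * (2 * k)))) + 2 * (2 * k) = e.
  have -> : k + 2 * (D * (3 * (C * (2 * k)))) + 2 * (2 * k) = k * (5 + 12 * D * C) by ring.
  by rewrite /k mulfVK// gt_eqF.
have [u lu fu] := vanishing_mollification (ltW a0) lf vf k0.
have mu : measurable_fun setT u.
  by apply: continuous_measurable_prod; exact: locally_lipschitz_continuous.
have mfu : measurable_fun setT (f \- u) by exact: measurable_funB.
have uE : u = fun p => f p + - (f \- u) p.
  by apply/funext => p; rewrite /= opprB addrC subrK.
have uf I1 I2 a : osc_bound alpha f I1 I2 a -> osc_bound alpha u I1 I2 (a + k).
  move=> fa; rewrite uE; apply: osc_boundD => //.
    by apply: measurableT_comp.
  by apply: osc_boundN; exact: fu.
have [T T0 HT] := vf k k0.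
have Ak0 : 0 <= A + k by rewrite addr_ge0// ltW.
have k20 : 0 < 2 * k by rewrite mulr_gt0.
have [|N N0 sh] := osc_bound_slice_holder n1 alpha01 lu Ak0 k20 T0 (fun I1 I2 => uf _ _ _ (fA I1 I2)).
  move=> I1 I2 p Rp Tp; have -> : 2 * k = k + k by ring.
  by apply: uf; apply: HT; apply: Or33; exists p.
rewrite -CE in sh.
have CA0 : 0 <= C * (A + k) by rewrite mulr_ge0// ltW.
have Ck0 : 0 < 3 * (C * (2 * k)) by rewrite mulr_gt0// mulr_gt0.
have [g [S [S0 lg gS gE]]] := truncation n2 alpha01 lu CA0 Ck0 N0 sh.
rewrite -DE in gE.
have [phi sphi [L L0 [phiL phiE]]] := smooth_approximation alpha01 k0 S0 lg gS.
have lphi : locally_lipschitz phi by move=> r; exists L => p q _ _; exact: phiL.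
exists phi => // I1 I2.
have -> : f \- phi = (fun p => ((f \- u) p + (u p - g p)) + (g p - phi p)).
  by apply/funext => p /=; ring.
have lug : locally_lipschitz (fun p => u p - g p) by exact: locally_lipschitz_sub.
have lgp : locally_lipschitz (fun p => g p - phi p) by exact: locally_lipschitz_sub.
have mll h : locally_lipschitz h -> measurable_fun setT h.
  by move=> lh; apply: continuous_measurable_prod; exact: locally_lipschitz_continuous.
rewrite -kE; apply: osc_boundD; [|exact: mll| |].
- by apply: measurable_funD => //; exact: mll.
- apply: osc_boundD => //; first exact: mll.
  apply: slice_dist_osc_bound => //; first exact: ltW.
  by rewrite mulr_ge0// ltW.
apply: slice_dist_osc_bound => // [||x y].
- exact: ltW.
- exact: ltW.
rewrite /slice_dist -mulrA; apply: (@mosc_le_sup _ _ _ _ 0).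
  exact: (@continuous_slice_sub _ _ _ (fun p => g p - phi p)).
by move=> z _; rewrite subr0; exact: phiE.
Qed.

Lemma oscillation_ge0 f (I1 : cube R d1) (I2 : cube R d2) : 0 <= oscillation alpha f I1 I2.
Proof.
rewrite /oscillation /average mulr_ge0 ?powR_ge0// mulr_ge0 ?invr_ge0 ?fine_ge0//.
by apply: integral_ge0 => p _; rewrite lee_fin.
Qed.

Lemma bmo_norm_ge0 f : (0 <= bmo_norm alpha f)%E.
Proof.
pose I n : cube R n := Cube 0 ltr01.
apply: (@le_trans _ _ (oscillation alpha f (I d1) (I d2))%:E).
  by rewrite lee_fin oscillation_ge0.
by apply: ereal_sup_ubound; exists (I d1, I d2).
Qed.

(** An approximant phi within e / 8 in norm leaves 4 (e / 8) = e / 2 in terms of double differences,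
    and phi, being Lipschitz with compact support, contributes the other e / 2 on extreme
    rectangles. *)
Lemma bmo_closure_vanishing f : (0 < d2)%N -> 0 < alpha < 1 ->
  bmo_closure d1 d2 alpha Cc_smooth f -> vanishing alpha f.
Proof.
move=> n2 alpha01 [[lf _] inf0] e e0.
have e80 : 0 < e / 8 by rewrite divr_gt0.
have [_ [phi sphi <-] He] : exists2 y,
    [set bmo_norm alpha (f \- phi) | phi in Cc_smooth] y & (y < (e / 8)%:E)%E.
  by apply: ereal_inf_lt; rewrite inf0 lte_fin.
have [L [M [S [L0 M0 S0 cl]]]] := Cc_smooth_lipschitz sphi.
have e20 : 0 < e / 2 by rewrite divr_gt0.
have [T T0 HT] := compact_lipschitz_vanishing n2 alpha01 L0 M0 S0 cl e20.
have cphi : continuous phi by have [phiL _ _] := cl; exact: lipschitz_continuous phiL.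
have lphi := continuous_loc_integrable cphi.
have lfp := loc_integrableB lf lphi.
exists T => // I1 I2 deg.
have -> : f = fun p => (f \- phi) p + phi p by apply/funext => p /=; rewrite subrK.
have -> : e = 4 * (e / 8) + e / 2 by field.
have [mfp _] := lfp; have [mp _] := lphi.
apply: osc_boundD => //; last exact: HT.
apply: le_oscillation => //; rewrite -lee_fin; apply: le_trans (ltW He).
by apply: ereal_sup_ubound; exists (I1, I2).
Qed.

End density.

Theorem theorem3p11 (R : realType) (d1 d2 : nat) (alpha : R)
    (d1_gt0 : (0 < d1)%N) (d2_gt0 : (0 < d2)%N) (alpha01 : 0 < alpha < 1) :
  VMO d1 d2 alpha = bmo_closure d1 d2 alpha Cc_smooth.
Proof.
apply/seteqP; split=> f Vf; last first.
  by apply: vanishing_VMO => //; [case: Vf|exact: bmo_closure_vanishing].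
have [Bf _] := Vf; split=> //; apply/eqP; rewrite eq_le; apply/andP; split; last first.
  by apply: le_ereal_inf_tmp => _ [phi _ <-]; exact: bmo_norm_ge0.
apply/lee_addgt0Pr => e e0; rewrite add0e.
have [phi sphi Hphi] := VMO_smooth_approximation d1_gt0 d2_gt0 alpha01 Vf e0.
apply: (@le_trans _ _ (bmo_norm alpha (f \- phi))).
  by apply: ereal_inf_lbound; exists phi.
apply: ge_ereal_sup => _ [I _ <-]; rewrite lee_fin; apply: oscillation_le => //.
apply: loc_integrableB; first by case: Bf.
apply: continuous_loc_integrable; have [sm _] := sphi; exact: (sm 0%N).
Qed.
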